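(* The graph $R_{13}$ is gap-extremal. In particular $s(3)=s_2(3)=13$, and the only $3$-extremal graph is $R_{13}$. Moreover, every triangle-free graph $G$ on $11$ or $12$ vertices with $\alpha(G)\le 4$ is stable gap-optimal and connected.
   Context: All graphs are finite, simple and undirected. $\alpha(G)$ denotes the maximum size of a stable set, $\theta(G)$ the minimum number of cliques partitioning $V(G)$, and $\mathrm{gap}(G)=\theta(G)-\alpha(G)$. $R_{13}$ is the graph on vertices $r_1,\dots,r_{13}$ with edges $r_ir_{i+1}$ and $r_ir_{i+5}$ for $i=1,\dots,13$, indices taken modulo $13$. $s(t)$ (resp. $s_2(t)$) is the smallest number of vertices of a graph (resp. triangle-free graph) with gap $t$. A graph is $t$-extremal if it has gap $t$ and $s(t)$ vertices, and gap-extremal if it is $t$-extremal for some $t$. $\mathrm{gap}_2(n)$ is the maximum gap of a triangle-free graph on $n$ vertices. $\alpha(n)$ is the minimum of $\alpha(G)$ over triangle-free graphs on $n$ vertices. A graph $G$ on $n$ vertices is stable gap-optimal if it is triangle-free, $\mathrm{gap}(G)=\mathrm{gap}_2(n)$ and $\alpha(G)=\alpha(n)$. *)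

(* Defs.v *)
From mathcomp Require Import all_boot all_order.
Set Implicit Arguments.
Unset Strict Implicit.
Unset Printing Implicit Defensive.

Record sgraph := SGraph {
  svertex :> finType;
  adj : rel svertex;
  adj_sym : symmetric adj;
  adj_irrefl : irreflexive adj }.

Definition stable (G : sgraph) (S : {set G}) : bool :=
  [forall x in S, forall y in S, ~~ adj x y].

Definition clique (G : sgraph) (S : {set G}) : bool :=
  [forall x in S, forall y in S, (x != y) ==> adj x y].

Definition triangle_free (G : sgraph) : Prop :=
  forall x y z : G, ~ [/\ adj x y, adj y z & adj x z].

Definition connected (G : sgraph) : Prop :=
  forall x y : G, connect (@adj G) x y.

Definition isomorphic (G H : sgraph) : Prop :=
  exists2 f : G -> H, bijective f & forall x y, adj (f x) (f y) = adj x y.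

Definition alpha (G : sgraph) : nat := \max_(S : {set G} | stable S) #|S|.

Definition clique_partition (G : sgraph) (P : {set {set G}}) : bool :=
  partition P [set: G] && [forall K in P, clique K].

Definition singletons (G : sgraph) : {set {set G}} := [set [set x] | x : G].

(* The default of arg min must satisfy the constraint: see singletonsP. *)
Definition theta (G : sgraph) : nat :=
  #|[arg min_(P < singletons G | clique_partition P) #|P|]|.

Lemma singletonsP (G : sgraph) : clique_partition (singletons G).
Proof.
apply/andP; split.
  apply/and3P; split.
  - rewrite eqEsubset subsetT; apply/subsetP => x _.
    by apply/bigcupP; exists [set x]; rewrite ?set11 ?imset_f.
  - apply/trivIsetP => _ _ /imsetP[x _ ->] /imsetP[y _ ->] nxy.
    by rewrite disjoints1 in_set1; apply: contraNneq nxy => ->.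
  - by apply/imsetP => -[x _ /setP/(_ x)]; rewrite !inE eqxx.
apply/forall_inP => _ /imsetP[x _ ->].
apply/forall_inP => y /set1P-> ; apply/forall_inP => z /set1P->.
by rewrite eqxx.
Qed.

Lemma thetaP (G : sgraph) :
  (exists2 P : {set {set G}}, clique_partition P & #|P| = theta G) /\
  (forall P : {set {set G}}, clique_partition P -> theta G <= #|P|).
Proof.
rewrite /theta; case: arg_minnP => [|P cP minP]; first exact: singletonsP.
by split=> //; exists P.
Qed.

Lemma alpha_le_theta (G : sgraph) : alpha G <= theta G.
Proof.
have [[P /andP[/and3P[/eqP covP tiP _] /forall_inP clP] <-] _] := thetaP G.
apply/bigmax_leqP => S /forall_inP stS.
have inP x : pblock P x \in P by rewrite pblock_mem // covP inE.
have inB x : x \in pblock P x by rewrite mem_pblock covP inE.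
rewrite -(@card_in_imset _ _ (pblock P) S).
  by apply/subset_leq_card/subsetP => _ /imsetP[x _ ->].
move=> x y xS yS exy; apply: contraTeq isT => nxy.
have /forall_inP/(_ y) := forall_inP (clP _ (inP x)) x (inB x).
rewrite exy inB => /(_ isT); rewrite nxy /= => axy.
by have /forall_inP/(_ y yS) := stS x xS; rewrite axy.
Qed.

(* Truncated subtraction loses nothing here, by alpha_le_theta. *)
Definition gap (G : sgraph) : nat := theta G - alpha G.

Definition smallest (P : nat -> Prop) (m : nat) : Prop :=
  P m /\ forall k, P k -> m <= k.

Definition largest (P : nat -> Prop) (m : nat) : Prop :=
  P m /\ forall k, P k -> k <= m.

(* The extremal functions are given by their graphs: is_s t n is "s(t) = n",
   is_s2 t n is "s_2(t) = n", is_gap2 n g is "gap_2(n) = g", and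
   is_alpha_min n a is "alpha(n) = a". *)
Definition is_s (t : nat) : nat -> Prop :=
  smallest (fun n => exists G : sgraph, #|G| = n /\ gap G = t).

Definition is_s2 (t : nat) : nat -> Prop :=
  smallest (fun n => exists G : sgraph,
    [/\ triangle_free G, #|G| = n & gap G = t]).

Definition is_gap2 (n : nat) : nat -> Prop :=
  largest (fun g => exists G : sgraph,
    [/\ triangle_free G, #|G| = n & gap G = g]).

Definition is_alpha_min (n : nat) : nat -> Prop :=
  smallest (fun a => exists G : sgraph,
    [/\ triangle_free G, #|G| = n & alpha G = a]).

Definition extremal (t : nat) (G : sgraph) : Prop :=
  gap G = t /\ is_s t #|G|.

Definition gap_extremal (G : sgraph) : Prop := exists t, extremal t G.

Definition stable_gap_optimal (G : sgraph) : Prop :=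
  [/\ triangle_free G, is_gap2 #|G| (gap G) & is_alpha_min #|G| (alpha G)].

(* The vertices r_1, ..., r_13 are indexed from 0. *)
Definition R13_arc : rel 'I_13 :=
  fun i j => (j == i + 1 %[mod 13]) || (j == i + 5 %[mod 13]).

Definition R13_adj : rel 'I_13 := fun i j => R13_arc i j || R13_arc j i.

Lemma R13_adj_sym : symmetric R13_adj.
Proof. by move=> i j; rewrite /R13_adj orbC. Qed.

Lemma R13_adj_irrefl : irreflexive R13_adj.
Proof.
move=> i; apply/negbTE; rewrite /R13_adj orbb /R13_arc.
by rewrite -{1 3}[nat_of_ord i]addn0 !eqn_modDl.
Qed.

Definition R13 : sgraph := SGraph R13_adj_sym R13_adj_irrefl.

(* Main.v *)
Require Import Defs.
From mathcomp Require Import all_boot all_order.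
From mathcomp Require Import zify.
Set Implicit Arguments.
Unset Strict Implicit.
Unset Printing Implicit Defensive.

(* Removing a clique lowers the clique cover number by at most one and does not
   raise the stability number. So if every graph on at most 9 vertices has gap at
   most 1, then a graph on at most 12 vertices that contains a triangle has gap at
   most 2. For triangle-free graphs, gap-criticality means that every vertex is
   missed by a maximum matching; by Gallai's lemma the components are then
   factor-critical, so a connected one on n vertices has clique cover number
   (n + 1) / 2, and R(3,3) = 6, R(3,4) = 9 bound the stability number from below.

   On 13 vertices a graph of gap 3 is triangle-free: deleting a triangle leaves
   10 vertices of gap 2, which forces two disjoint 5-cycles with no edge between
   them, and each vertex of the triangle can be added to one of them without
   raising its stability number; graphs on at most 10 vertices with stability
   number 2 have clique cover number at most 3, which saves one clique. By Gallai
   again a triangle-free graph of gap 3 on 13 vertices has stability number 4.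
   Such a graph is 4-regular, and two non-adjacent vertices with two common
   neighbours determine it up to a short case analysis.

   The remaining small configurations (graphs with 10 vertices and stability
   number at most 3, and the last case analysis) are refuted by decision trees
   that branch on adjacencies and are replayed by a verified checker. *)

(** * Clique covers *)

(** Removing a clique has to save a clique. Hall's theorem provides this when at most three vertices
    remain outside a maximum stable set of the rest and that set has at least three elements. For a
    triangle on 10 vertices the count is 7 <= [sal] + 3, which fails exactly for stability number at
    most 3; this is why the trees concentrate on those graphs. Two disjoint 5-cycles have 10
    vertices and gap 2, so for stability number 4 the bound of gap 1 cannot do without the triangle.

    On the triangle-free side, Gallai's lemma leaves two outcomes for a minimal set that is not
    covered by j cliques: it has more than 2j vertices, or it falls into two parts with no edge
    between them. In the second outcome stability numbers add up, and a part with at most 4 vertices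
    has gap 0, so only few splits remain. All inductions run over subsets of one fixed graph. *)

Section Covers.
Variable G : sgraph.
Implicit Types (A B K S T : {set G}) (x y z : G).

(** Being reflexive, this relation lets cliques and labelled lists contain repetitions without side
    conditions. *)
Definition cadj x y := (x == y) || adj x y.

Lemma cadj_sym x y : cadj x y = cadj y x.
Proof. by rewrite /cadj eq_sym adj_sym. Qed.

Lemma cadjxx x : cadj x x.
Proof. by rewrite /cadj eqxx. Qed.

Lemma adj_cadj x y : adj x y -> cadj x y.
Proof. by rewrite /cadj => ->; rewrite orbT. Qed.

Lemma adj_neq x y : adj x y -> x != y.
Proof. by apply: contraTneq => ->; rewrite adj_irrefl. Qed.

Lemma stableP S : reflect {in S &, forall x y, ~~ adj x y} (stable S).
Proof.
apply: (iffP forall_inP) => [h x y xS yS|h x xS].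
  exact: (forall_inP (h x xS)).
by apply/forall_inP => y; apply: h.
Qed.

Lemma cliqueP K : reflect {in K &, forall x y, cadj x y} (clique K).
Proof.
apply: (iffP forall_inP) => [h x y xK yK|h x xK].
  have /forall_inP/(_ y yK) := h x xK.
  by rewrite /cadj; case: eqP.
apply/forall_inP => y yK; have := h x y xK yK.
by rewrite /cadj; case: eqP.
Qed.

Lemma stable_sub A B : A \subset B -> stable B -> stable A.
Proof.
by move=> /subsetP sAB /stableP h; apply/stableP=> x y /sAB xB /sAB; apply: h.
Qed.

Lemma clique_sub A B : A \subset B -> clique B -> clique A.
Proof.
by move=> /subsetP sAB /cliqueP h; apply/cliqueP=> x y /sAB xB /sAB; apply: h.
Qed.

Lemma clique1 x : clique [set x].
Proof. by apply/cliqueP=> y z /set1P-> /set1P->; apply: cadjxx. Qed.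

Lemma clique2 x y : cadj x y -> clique [set x; y].
Proof.
move=> xy; apply/cliqueP=> u v; rewrite !inE.
by case/orP=> /eqP-> /orP[]/eqP->; rewrite ?cadjxx // cadj_sym.
Qed.

Lemma stable0 : stable (set0 : {set G}).
Proof. by apply/stableP => x y; rewrite inE. Qed.

Lemma stable1 x : stable [set x].
Proof. by apply/stableP=> y z /set1P-> /set1P->; rewrite adj_irrefl. Qed.

Lemma edge_or_stable A :
  (exists x y, [/\ x \in A, y \in A & adj x y]) \/ stable A.
Proof.
have [e|e] := boolP [exists x in A, exists y in A, adj x y].
  by case/exists_inP: e => x xA /exists_inP[y yA]; left; exists x, y.
right; apply/stableP => x y xA yA; apply: contra e => xy.
by apply/exists_inP; exists x => //; apply/exists_inP; exists y.
Qed.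

Lemma stableU S T : stable S -> stable T ->
  (forall x y, x \in S -> y \in T -> ~~ adj x y) -> stable (S :|: T).
Proof.
move=> /stableP hS /stableP hT h; apply/stableP=> x y; rewrite !inE.
by case/orP=> xS /orP[] yS; [exact: hS | exact: h | rewrite adj_sym; exact: h | exact: hT].
Qed.

(** The stability number of the induced subgraph on [A]; working with subsets avoids building
    induced subgraphs as new graphs. *)
Definition sal A := \max_(S : {set G} | stable S && (S \subset A)) #|S|.

Lemma sal_ge S A : stable S -> S \subset A -> #|S| <= sal A.
Proof. by move=> hS sSA; apply: leq_bigmax_cond; rewrite hS. Qed.

Lemma sal_leP A k :
  (forall S, stable S -> S \subset A -> #|S| <= k) -> sal A <= k.
Proof. by move=> h; apply/bigmax_leqP=> S /andP[]; apply: h. Qed.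

Lemma salP A : exists S, [/\ stable S, S \subset A & #|S| = sal A].
Proof.
have [|S /andP[hS sSA] e] := @eq_bigmax_cond _
  [pred S : {set G} | stable S && (S \subset A)] (fun S => #|S|).
  by apply/card_gt0P; exists set0; rewrite !inE stable0 sub0set.
by exists S; split=> //; rewrite /sal e.
Qed.

Lemma sal_sub A B : A \subset B -> sal A <= sal B.
Proof.
by move=> sAB; apply: sal_leP => S hS sSA; apply: sal_ge => //; apply: subset_trans sAB.
Qed.

Lemma sal_card A : sal A <= #|A|.
Proof. by apply: sal_leP => S _; apply: subset_leq_card. Qed.

Lemma sal0 A : sal A = 0 -> A = set0.
Proof.
move=> h; apply/setP=> x; rewrite inE; apply: contraTF isT => xA.
by have := @sal_ge [set x] A (stable1 x); rewrite sub1set xA cards1 h => /(_ isT).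
Qed.

Lemma sal1 A : sal A <= 1 -> clique A.
Proof.
move=> h; apply/cliqueP=> x y xA yA; rewrite /cadj; case: eqVneq => //= nxy.
apply: contraLR h => nadj; rewrite -ltnNge.
have -> : 1 < sal A = (#|[set x; y]| <= sal A) by rewrite cards2 nxy.
apply: sal_ge; last by rewrite subUset !sub1set xA.
apply: stableU (stable1 x) (stable1 y) _ => u v /set1P-> /set1P->.
by [].
Qed.

Lemma sal_add A B x : x \in B -> A \subset B -> x \notin A ->
  {in A, forall y, ~~ adj x y} -> sal A < sal B.
Proof.
move=> xB sAB xA h; have [S [hS sSA <-]] := salP A.
have xS : x \notin S by apply: contra xA; apply: (subsetP sSA).
have <- : #|x |: S| = #|S|.+1 by rewrite cardsU1 xS.
apply: sal_ge; last by rewrite subUset sub1set xB (subset_trans sSA).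
apply: stableU => // [|u y /set1P-> yS]; first exact: stable1.
exact: h (subsetP sSA y yS).
Qed.

Lemma sal_disjoint A B : [disjoint A & B] ->
  (forall x y, x \in A -> y \in B -> ~~ adj x y) ->
  sal A + sal B <= sal (A :|: B).
Proof.
move=> dAB h; have [S [hS sSA <-]] := salP A; have [T [hT sTB <-]] := salP B.
have dST : [disjoint S & T] by apply: disjointWl sSA _; apply: disjointWr sTB _.
have -> : #|S| + #|T| = #|S :|: T| by rewrite cardsU (disjoint_setI0 dST) cards0 subn0.
apply: sal_ge; last exact: setUSS.
by apply: stableU => // x y /(subsetP sSA) xA /(subsetP sTB); apply: h.
Qed.

(** The cliques may overlap and may leave [A], so the predicate is monotone in both arguments; an
    exact partition is recovered only in [cov_partition]. *)
Fixpoint cov j A : Prop :=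
  if j is j'.+1 then exists2 K, clique K & cov j' (A :\: K) else A = set0.

Lemma cov_sub j A B : A \subset B -> cov j B -> cov j A.
Proof.
elim: j A B => [|j IH] A B sAB /=; first by move=> B0; apply/eqP; rewrite -subset0 -B0.
by case=> K hK /(IH (A :\: K)) h; exists K => //; apply/h/setSD.
Qed.

Lemma cov_leq i j A : i <= j -> cov i A -> cov j A.
Proof.
move=> /subnK<-; elim: (j - i) => // n IH /IH h.
exists set0; last by rewrite setD0.
by apply/cliqueP => x y; rewrite inE.
Qed.

Lemma covU i j A B : cov i A -> cov j B -> cov (i + j) (A :|: B).
Proof.
elim: i A => [|i IH] A /=; first by move=> ->; rewrite set0U.
case=> K hK /IH h /h hAB; exists K => //; apply: cov_sub hAB.
by rewrite setDUl setUS // subsetDl.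
Qed.

Lemma cov_card j A : #|A| <= j -> cov j A.
Proof.
elim: j A => [|j IH] A /=; first by rewrite leqn0 cards_eq0 => /eqP.
have [->|[x xA]] := set_0Vmem A.
  by move=> _; apply: (@cov_leq 0 j.+1 set0).
rewrite (cardsD1 x) xA => /IH h; exists [set x] => //; exact: clique1.
Qed.

Lemma cov1 K : clique K -> cov 1 K.
Proof. by move=> hK; exists K => //; rewrite /= setDv. Qed.

Lemma covI K j A : clique K -> cov j (A :\: K) -> cov j.+1 A.
Proof. by exists K. Qed.

(** A stable set avoiding the closed neighbourhood of [w] can be enlarged by [w]. Removing that
    neighbourhood, here a clique, therefore lowers the stability number. *)
Lemma cov_simplicial j A w : w \in A -> clique [set x in A | cadj w x] ->
  (forall B, B \subset A -> sal B < sal A -> cov j B) -> cov j.+1 A.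
Proof.
move=> wA hK h; apply: (covI hK); apply: h; first exact: subsetDl.
apply: (sal_add wA (subsetDl _ _)); first by rewrite !inE wA cadjxx.
by move=> y; rewrite !inE negb_and => /andP[/orP[/negP//|]]; rewrite /cadj negb_or => /andP[].
Qed.

End Covers.

(** * Certified case analysis *)

(* A partially known symmetric relation on the labels 0, 1, 2, ... *)
Definition pgraph := seq (seq (option bool)).

Definition pget (p : pgraph) i j := nth None (nth [::] p i) j.

Definition pset1 (p : pgraph) i j b : pgraph :=
  set_nth [::] p i (set_nth None (nth [::] p i) j (Some b)).

Definition pset p i j b := pset1 (pset1 p i j b) j i b.

Definition pgraph_of (l : seq (nat * nat * bool)) : pgraph :=
  foldr (fun t p => pset p t.1.1 t.1.2 t.2) [::] l.

(** The diagonal is never known, so pairwise known labels are automatically distinct. *)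
Definition known b p : rel nat := fun i j =>
  if i == j then false else if pget p i j is Some c then c == b else false.

Fixpoint clqs (r : rel nat) m acc vs : seq (seq nat) :=
  match m, vs with
  | 0, _ => [:: acc]
  | m'.+1, [::] => [::]
  | m'.+1, v :: vs' =>
      (if all (r v) acc then clqs r m' (v :: acc) vs' else [::])
      ++ clqs r m acc vs'
  end.

Fixpoint insertions (r : rel nat) v (bs : seq (seq nat)) : seq (seq (seq nat)) :=
  if bs is b :: bs' then
    (if all (r v) b then [:: (v :: b) :: bs'] else [::])
    ++ map (cons b) (insertions r v bs')
  else [::].

(** Each vertex opens a new block, while [m] allows it, or joins an old one. The conditional, unlike
    a disjunction, leaves the insertions unevaluated once a new block succeeds. *)
Fixpoint coverable (r : rel nat) m bs vs : bool :=
  if vs is v :: vs' then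
    if (if m is m'.+1 then coverable r m' ([:: v] :: bs) vs' else false)
    then true
    else has (fun bs' => coverable r m bs' vs') (insertions r v bs)
  else true.

(* [c] lists in prefix order the pairs on which to branch; a branch ends when
   [leaf] accepts the partial relation obtained by deciding the pair. *)
Fixpoint run (leaf : pgraph -> nat -> nat -> bool -> bool) f p
    (c : seq (nat * nat)) : option (seq (nat * nat)) :=
  match f, c with
  | f'.+1, (i, j) :: c1 =>
    let branch b c := let q := pset p i j b in
      if leaf q i j b then Some c else run leaf f' q c in
    if branch true c1 is Some c2 then branch false c2 else None
  | _, _ => None
  end.

Definition decode n : seq nat -> seq (nat * nat) :=
  map (fun c => (c %/ n, c %% n)).

(** Every recursive call of [run] has consumed a pair, so the length of the list is enough fuel. *)
Definition checks leaf l c : bool :=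
  run leaf (size c).+1 (pgraph_of l) c.

Lemma pairwise_sym (T : eqType) (r : rel T) l : symmetric r -> pairwise r l ->
  {in l &, forall x y, x != y -> r x y}.
Proof.
move=> r_sym; elim: l => //= z l IH /andP[/allP rz /IH{}IH] x y.
rewrite !inE => /orP[/eqP->|xl] /orP[/eqP->|yl]; rewrite ?eqxx // => nxy.
- exact: rz.
- by rewrite r_sym rz.
- exact: IH.
Qed.

Section Soundness.
Variable e : rel nat.
Hypothesis e_sym : symmetric e.

Definition consistent (p : pgraph) :=
  forall i j b, pget p i j = Some b -> e i j = b.

Definition holds (t : nat * nat * bool) := e t.1.1 t.1.2 == t.2.

Lemma consistent_pset p i j b :
  e i j = b -> consistent p -> consistent (pset p i j b).
Proof.
have c1 q i1 j1 : e i1 j1 = b -> consistent q -> consistent (pset1 q i1 j1 b).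
  move=> eb cq i' j' b'; rewrite /pget /pset1 nth_set_nth /=.
  case: eqP => [->|_]; last exact: cq.
  rewrite nth_set_nth /=; case: eqP => [->|_]; last exact: cq.
  by case=> <-.
by move=> eb cp; apply: (c1 _ j i); rewrite 1?e_sym //; apply: c1.
Qed.

Lemma consistent_pgraph_of l : all holds l -> consistent (pgraph_of l).
Proof.
elim: l => [|t l IH] /=; first by move=> _ i j b; rewrite /pget /= !nth_nil.
by move=> /andP[/eqP et /IH]; apply: consistent_pset.
Qed.

Lemma knownP b p i j : consistent p -> known b p i j -> (i != j) && (e i j == b).
Proof.
move=> cp; rewrite /known; case: eqP => // _.
by case E: (pget p i j) => [c|//]; rewrite (cp _ _ _ E).
Qed.

(** The true relation [e] selects one of the two branches at each pair. Along this path the partial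
    relation stays consistent, and the leaf at its end yields [P]. *)
Lemma run_sound (leaf : pgraph -> nat -> nat -> bool -> bool) (P : Prop) :
  (forall p i j b, consistent p -> leaf p i j b -> P) ->
  forall l c, all holds l -> checks leaf l c -> P.
Proof.
move=> hleaf l c /consistent_pgraph_of; rewrite /checks.
move: (size c).+1 (pgraph_of l) => f p cp h.
suff: forall f p c c', consistent p -> run leaf f p c = Some c' -> P.
  by case E: (run _ _ _ _) h => [c'|//] _ /(_ _ _ _ _ cp E).
elim=> [|f' IH] q [|[i j] d] //= d' cq.
have br b d1 d2 : e i j = b ->
  (if leaf (pset q i j b) i j b then Some d1
   else run leaf f' (pset q i j b) d1) = Some d2 -> P.
  move=> eb; case: ifP => [/hleaf hl _ | _]; last apply: IH.
    by apply: hl; apply: consistent_pset.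
  exact: consistent_pset.
case E1: (if _ then _ else _) => [d1|//]; case E: (e i j).
  by move=> _; exact: (br true _ _ E E1).
exact: (br false _ _ E).
Qed.

Lemma clqsP (r : rel nat) m acc vs l : pairwise r acc -> l \in clqs r m acc vs ->
  [/\ pairwise r l, size l = m + size acc & {subset l <= vs ++ acc}].
Proof.
elim: vs m acc => [|v vs IH] [|m] acc //= racc.
- by rewrite inE => /eqP->; split.
- by rewrite inE => /eqP->; split=> // x; rewrite inE mem_cat => ->; rewrite !orbT.
rewrite mem_cat; case/orP.
  case: ifP => // rv /IH[|-> -> sl] /=; first by rewrite rv.
  split=> //; first by rewrite addnS.
  by move=> x /sl; rewrite !(mem_cat, inE) orbCA orbA.
case/(IH m.+1 _ racc) => -> -> sl; split=> // x /sl.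
by rewrite inE => ->; rewrite orbT.
Qed.

Lemma insertionsP (r : rel nat) v bs bs' : bs' \in insertions r v bs ->
  all (pairwise r) bs -> [/\ size bs' = size bs, all (pairwise r) bs'
    & {subset v :: flatten bs <= flatten bs'}].
Proof.
elim: bs bs' => //= b bs IH bs'; rewrite mem_cat => /orP[|/mapP[bs1 /IH h ->]].
  case: ifP => // rv; rewrite inE => /eqP-> /andP[rb rbs] /=.
  by rewrite rv rb rbs; split.
move=> /andP[rb /h[sz rbs1 sub]]; rewrite /= rb rbs1 sz; split=> //.
move=> x; rewrite !(inE, mem_cat) orbCA => /orP[->//|xv].
by rewrite sub ?orbT // inE.
Qed.

Lemma coverableP (r : rel nat) m bs vs : coverable r m bs vs ->
  all (pairwise r) bs -> exists bs', [/\ size bs' <= m + size bs,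
    all (pairwise r) bs' & {subset vs ++ flatten bs <= flatten bs'}].
Proof.
elim: vs m bs => [|v vs IH] m bs /=.
  by move=> _ rbs; exists bs; split=> //; rewrite leq_addl.
have old : has (fun bs' => coverable r m bs' vs) (insertions r v bs) ->
  all (pairwise r) bs -> exists bs', [/\ size bs' <= m + size bs,
    all (pairwise r) bs' & {subset v :: vs ++ flatten bs <= flatten bs'}].
  case/hasP=> bs1 /insertionsP h cv /h[sz rbs1 sub].
  have [bs2 [sz2 rbs2 sub2]] := IH _ _ cv rbs1.
  exists bs2; rewrite -sz; split=> // x; rewrite !(inE, mem_cat) => xv.
  apply: sub2; rewrite mem_cat; case/or3P: xv => [xv|->//|xv].
    by rewrite sub ?orbT // inE xv.
  by rewrite sub ?orbT // inE xv orbT.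
case: m old => [|m] old /=; first exact: old.
case: ifP => [cv _ rbs|_]; last exact: old.
have [|bs2 [sz2 rbs2 sub2]] := IH _ _ cv; first by rewrite /= rbs.
exists bs2; split=> //; first by rewrite addSnnS.
by move=> x xv; apply: sub2; move: xv; rewrite /= !(inE, mem_cat) orbCA.
Qed.

End Soundness.

Section GraphLeaves.
Variables (G : sgraph) (x0 : G) (s : seq G) (A : {set G}).
Hypothesis sA : {subset s <= A}.
Hypothesis x0A : x0 \in A.

(** Labels beyond the end of [s] denote the default [x0], which lies in [A]. As [cadj] is reflexive
    such repeated labels are harmless, so one tree on n labels serves all sets of at most n
    vertices. *)
Definition lab : rel nat := fun i j => cadj (nth x0 s i) (nth x0 s j).

Lemma lab_sym : symmetric lab.
Proof. by move=> i j; rewrite /lab cadj_sym. Qed.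

Lemma lab_in i : nth x0 s i \in A.
Proof.
by have [h|h] := ltnP i (size s); [apply/sA/mem_nth | rewrite nth_default].
Qed.

(** The list [s] may have repetitions, but labels not related by the reflexive [cadj] denote
    distinct vertices, so the stable set really has [size l] elements. *)
Lemma known_false_stable p l : consistent lab p -> pairwise (known false p) l ->
  size l <= sal A.
Proof.
move=> cp /(sub_pairwise (fun i j => @knownP _ _ _ i j cp)) pl.
have pl' : pairwise (fun x y : G => ~~ cadj x y) (map (nth x0 s) l).
  by rewrite pairwise_map; apply: sub_pairwise pl => i j /andP[_ /eqP /negbT].
have un : uniq (map (nth x0 s) l).
  rewrite uniq_pairwise; apply: sub_pairwise pl' => x y.
  by rewrite /cadj negb_or => /andP[].
rewrite -(size_map (nth x0 s)) -(card_uniqP un) -cardsE; apply: sal_ge.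
  apply/stableP => x y; rewrite !inE => xl yl; apply/negP => xy.
  have ncadj_sym : symmetric (fun x y : G => ~~ cadj x y) by move=> u v; rewrite cadj_sym.
  by have := pairwise_sym ncadj_sym pl' xl yl (adj_neq xy); rewrite adj_cadj.
by apply/subsetP => x; rewrite inE => /mapP[i _ ->]; apply: lab_in.
Qed.

Lemma known_true_cover p m n : consistent lab p -> {subset A <= s} ->
  size s <= n -> coverable (known true p) m [::] (iota 0 n) -> cov m A.
Proof.
move=> cp As szn /coverableP[//|bs [szb rbs sub]].
suff h : forall bs (B : {set G}), all (pairwise (known true p)) bs ->
   (forall x, x \in B -> exists2 i, i \in flatten bs & x = nth x0 s i) ->
   cov (size bs) B.
  apply: (cov_leq (i := size bs)); first by rewrite addn0 in szb.
  apply: h => // x /As xs; exists (index x s); last by rewrite nth_index.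
  by apply: sub; rewrite mem_cat mem_iota /= add0n (leq_trans _ szn) ?index_mem.
elim=> [|b bs1 IH] B /=.
  move=> _ h; apply/eqP; rewrite -subset0; apply/subsetP => x /h[i].
  by rewrite in_nil.
case/andP=> pb /IH h sB; exists [set x in map (nth x0 s) b].
  have pb' : pairwise (@cadj G) (map (nth x0 s) b).
    rewrite pairwise_map; apply: sub_pairwise pb => i j.
    by case/(knownP cp)/andP=> _ /eqP.
  apply/cliqueP => x y; rewrite !inE => xl yl.
  have [->|nxy] := eqVneq x y; first exact: cadjxx.
  exact: (pairwise_sym (@cadj_sym G) pb' xl yl nxy).
apply: h => x; rewrite !inE => /andP[xb /sB[i]].
rewrite mem_cat => /orP[ib ex|ib ex]; last by exists i.
by case/negP: xb; apply/mapP; exists i.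
Qed.

End GraphLeaves.

(** For [b] false this looks for a stable set. Only sets of [m] + 2 labels through the pair just
    decided are searched; any other set was present before the decision. *)
Definition clique_at b p n m i j :=
  if [&& i < n, j < n & known b p i j]
  then ~~ nilp (clqs (known b p) m [:: i; j] (iota 0 n)) else false.

(* [has], but without evaluating the tail when the head succeeds. *)
Fixpoint has_lazy (a : pred nat) (s : seq nat) : bool :=
  if s is x :: s' then if a x then true else has_lazy a s' else false.

(** Finds an induced copy of the pattern [P]: its non-edges must be known as well as its edges. *)
Fixpoint embeds p n (P : rel nat) k m acc : bool :=
  if m is m'.+1 then
    has_lazy (fun v => if all (fun u => known (P k u) p v (nth 0 acc u)) (iota 0 k)
                  then embeds p n P k.+1 m' (rcons acc v) else false) (iota 0 n)
  else true.

Definition c5 : rel nat := fun i j => ((i + 1) %% 5 == j) || ((j + 1) %% 5 == i).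

(** [k] bounds the stability number, so a stable set of [k.-1] + 2 = [k] + 1 labels is absurd. A new
    adjacency can only help a cover, a new non-adjacency only a stable set, hence the split on
    [b]. *)
Definition leaf_cover n k m p i j b :=
  if b then coverable (known true p) m [::] (iota 0 n)
  else clique_at false p n k.-1 i j.

Definition leaf_c5 p i j b :=
  if leaf_cover 6 2 2 p i j b then true else embeds p 6 c5 0 5 [::].

Definition leaf_K4free_cover p i j b :=
  if b && clique_at true p 10 2 i j then true else leaf_cover 10 3 4 p i j b.

Definition disjoint_triangles p n i j :=
  if [&& i < n, j < n & known true p i j] then
    has (fun t => ~~ nilp (clqs (known true p) 3 [::] (filter (predC (mem t)) (iota 0 n))))
      (clqs (known true p) 1 [:: i; j] (iota 0 n))
  else false.

Definition leaf_intersecting p i j b :=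
  if b then if clique_at true p 10 2 i j then true else disjoint_triangles p 10 i j
  else clique_at false p 10 2 i j.

Definition r13 : rel nat := fun i j =>
  [|| (i + 1) %% 13 == j, (j + 1) %% 13 == i, (i + 5) %% 13 == j | (j + 5) %% 13 == i].

(** The bounds express no triangle, no stable set of size 5, degree 4 and 8 non-neighbours (see
    [deg_nonnbh_13]). The search for a copy of the target is tried only once every label has its
    four neighbours. *)
Definition leaf_r13 p i j b :=
  if ~~ ((i < 13) && (j < 13)) then false else
  if (if b then clique_at true p 13 1 i j || (4 < count (known true p i) (iota 0 13))
      || (4 < count (known true p j) (iota 0 13))
      else clique_at false p 13 3 i j || (8 < count (known false p i) (iota 0 13))
      || (8 < count (known false p j) (iota 0 13))) then true
  else if all (fun i => count (known true p i) (iota 0 13) == 4) (iota 0 13)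
  then embeds p 13 r13 0 13 [::] else false.


Section LeafSoundness.
Variable p : pgraph.

Lemma clique_atP b n m i j : clique_at b p n m i j ->
  exists l, [/\ pairwise (known b p) l, size l = m + 2 & {in l, forall k, k < n}].
Proof.
rewrite /clique_at; case: ifP => // /and3P[i_n j_n kij].
case E: (clqs _ _ _ _) => [//|l ls] _; exists l.
have [||pl sl sub] := @clqsP (known b p) m [:: i; j] (iota 0 n) l.
- by rewrite /= kij.
- by rewrite E mem_head.
split=> // k /sub; rewrite mem_cat mem_iota !inE /= add0n.
by case/or3P=> [//|/eqP->|/eqP->].
Qed.

Lemma disjoint_trianglesP n i j : disjoint_triangles p n i j ->
  exists l1 l2, [/\ pairwise (known true p) l1, pairwise (known true p) l2,
    size l1 = 3 /\ size l2 = 3, {in l1 ++ l2, forall k, k < n} &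
    {in l2, forall k, k \notin l1}].
Proof.
rewrite /disjoint_triangles; case: ifP => // /and3P[i_n j_n kij] /hasP[l1 l1C].
case E: (clqs _ _ _ _) => [//|l2 ls] _; exists l1, l2.
have [||pl1 sl1 sub1] := @clqsP (known true p) 1 [:: i; j] (iota 0 n) l1.
- by rewrite /= kij.
- by [].
have [||pl2 sl2 sub2] := @clqsP (known true p) 3 [::]
  (filter (predC (mem l1)) (iota 0 n)) l2.
- by [].
- by rewrite E mem_head.
split=> // [k|k /sub2]; last by rewrite cats0 mem_filter => /andP[].
rewrite mem_cat => /orP[/sub1|/sub2]; rewrite mem_cat ?cats0 ?mem_filter ?mem_iota ?inE /= ?add0n.
  by case/or3P=> [//|/eqP->|/eqP->].
by rewrite ?orbF => /andP[].
Qed.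

Lemma has_lazyE a s : has_lazy a s = has a s.
Proof. by elim: s => //= x s ->; case: (a x). Qed.

Lemma embedsP n P k m acc : size acc = k ->
  (forall i j, i < j < k -> known (P j i) p (nth 0 acc j) (nth 0 acc i)) ->
  {in acc, forall v, v < n} -> embeds p n P k m acc ->
  exists f, [/\ size f = k + m, {in f, forall v, v < n} &
    forall i j, i < j < k + m -> known (P j i) p (nth 0 f j) (nth 0 f i)].
Proof.
elim: m k acc => [|m IH] k acc sz h hn /=; first by exists acc; rewrite addn0.
rewrite has_lazyE => /hasP[v]; rewrite mem_iota => v_n; case: ifP => // /allP hv /IH.
rewrite addSnnS; apply; first by rewrite size_rcons sz.
  move=> i j ijk; rewrite !nth_rcons sz.
  have -> : i < k by lia.
  case: ltngtP => jk; first by apply: h; rewrite jk andbT; case/andP: ijk.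
    lia.
  by rewrite jk; apply: hv; rewrite mem_iota; lia.
by move=> w; rewrite mem_rcons inE => /orP[/eqP->//|/hn].
Qed.

End LeafSoundness.

(** * Case trees *)

(* The trees below were found by a backtracking search with unit propagation;
   only their replay by [run] is part of the proof. The pair (i, j) is written
   as the number 10 i + j, or 13 i + j in [tree_r13]. *)

Definition start_c5 : seq (nat * nat * bool) := [::
  (0, 1, true); (0, 2, true); (1, 2, false)].

Definition tree_c5 : seq (nat * nat) := decode 10 [::
  13; 24; 15; 35; 4; 3; 5; 45; 25; 14; 34; 23; 34; 5; 23; 14; 45; 25; 45; 14;
  23; 25; 34; 5; 23; 25; 14; 45; 3; 4; 3; 25; 45; 4; 14; 23; 23; 4; 45; 14; 45;
  3; 25; 23; 14; 5; 4; 25; 23; 14; 25; 45; 3; 5; 4; 34; 14; 23; 35; 35; 23; 34;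
  4; 14; 14; 34; 5; 4; 3; 35; 23; 35; 23; 4; 5; 3; 14; 25; 34; 5; 4; 3; 35; 23;
  15; 45; 45; 15; 35; 3; 23; 23; 35; 4; 3; 5; 45; 15; 45; 15; 3; 5; 4; 45; 15;
  34; 35; 23; 3; 5; 4; 23; 3; 4; 5; 35; 23; 14; 15; 45; 3; 4; 5; 35; 25; 34; 24;
  5; 35; 25; 34; 24; 5; 4; 3; 35; 25; 25; 35; 4; 3; 5; 35; 25; 4; 5; 3; 24; 35;
  25; 4; 3; 5; 45; 24; 34; 34; 24; 45; 5; 24; 34; 15; 5; 3; 4; 45; 25; 35; 35;
  25; 45; 4; 35; 25; 45].

Lemma check_c5 : checks leaf_c5 start_c5 tree_c5.
Proof. by vm_compute. Qed.

Definition tree_sal3_5 : seq (nat * nat) := decode 10 [::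
  1; 23; 34; 24; 2; 14; 13; 12; 3; 14; 12; 13; 4; 12; 14; 13; 2; 14; 13; 34; 3;
  24; 12; 23; 4; 12; 24; 23; 3; 24; 14; 12; 4; 13; 34; 23; 4; 12; 13; 23; 12;
  34; 13; 24; 23; 14; 24; 23; 13; 24; 14; 23; 34; 23; 14; 34; 24].

Lemma check_sal3_5 : checks (leaf_cover 5 3 3) [::] tree_sal3_5.
Proof. by vm_compute. Qed.

(* A 5-cycle on 0, ..., 4, one more vertex 5, and a clique on 6, ..., 9. *)
Definition start_sal2 : seq (nat * nat * bool) := [::
  (6, 7, true); (6, 8, true); (6, 9, true); (7, 8, true); (7, 9, true); (8, 9, true);
  (0, 1, true); (1, 2, true); (2, 3, true); (3, 4, true); (4, 0, true); (0, 2, false);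
  (1, 3, false); (2, 4, false); (3, 0, false); (4, 1, false)].

Definition tree_sal2 : seq (nat * nat) := decode 10 [::
  5; 15; 26; 27; 28; 29; 49; 9; 39; 19; 59; 35; 25; 45; 36; 47; 38; 48; 18; 8;
  58; 57; 17; 38; 18; 8; 56; 46; 6; 16; 17; 18; 38; 48; 57; 47; 37; 47; 48; 58;
  8; 48; 29; 38; 18; 58; 35; 25; 45; 36; 47; 49; 39; 19; 59; 9; 57; 17; 39; 9;
  19; 46; 16; 6; 16; 17; 19; 49; 39; 47; 57; 37; 47; 59; 49; 49; 9; 36; 37; 47;
  7; 17; 57; 45; 35; 16; 46; 25; 59; 58; 6; 16; 25; 7; 37; 56; 47; 35; 17; 45;
  59; 58; 37; 17; 7; 47; 48; 29; 16; 36; 49; 39; 19; 9; 59; 35; 45; 8; 28; 17;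
  37; 6; 38; 37; 17; 57; 35; 25; 49; 59; 19; 45; 8; 28; 18; 8; 39; 46; 56; 45;
  35; 57; 19; 25; 49; 9; 19; 25; 45; 57; 46; 36; 39; 49; 9; 19; 59; 35; 45; 25;
  57; 38; 18; 49; 9; 46; 36; 16; 6; 56; 45; 35; 8; 25; 38; 59; 57; 18; 28; 37;
  29; 49; 9; 39; 19; 59; 35; 25; 16; 46; 38; 8; 17; 57; 29; 49; 9; 39; 19; 59;
  35; 16; 45; 36; 58; 35; 25; 19; 16; 46; 36; 45; 58; 9; 39; 49; 39; 16; 9; 29;
  45; 58; 36; 6; 46; 38; 8; 46; 6; 47; 28; 29; 18; 38; 49; 39; 19; 9; 59; 35;
  45; 7; 27; 16; 36; 8; 37; 36; 16; 56; 25; 35; 59; 49; 19; 45; 7; 27; 7; 17;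
  39; 58; 48; 35; 45; 19; 56; 49; 25; 9; 19; 25; 45; 56; 38; 48; 49; 39; 19; 9;
  59; 35; 45; 25; 56; 17; 37; 49; 9; 38; 48; 18; 8; 58; 45; 35; 7; 25; 27; 37;
  59; 56; 8; 48; 49; 19; 29; 39; 9; 59; 35; 45; 25; 7; 56; 58; 27; 37; 27; 17;
  38; 25; 57; 39; 9; 19; 48; 18; 28; 35; 59; 45; 37; 39; 9; 19; 49; 29; 56; 36;
  35; 16; 8; 28; 35; 7; 9; 8; 48; 28; 18; 39; 29; 36; 16; 28; 8; 49; 19; 45; 56;
  39; 19; 28; 8; 48; 58; 18; 8; 25; 9; 7; 57; 37; 45; 35; 58; 49; 19; 29; 59;
  39; 39; 29; 37; 58; 48; 45; 28; 16; 36; 7; 49; 19; 35; 57; 58; 45; 56; 19; 49;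
  39; 28; 58; 45; 35; 16; 17; 18; 19; 49; 59; 39; 9; 29; 38; 48; 58; 8; 19; 49;
  59; 39; 9; 29; 28; 19; 49; 59; 39; 9; 29; 57; 37; 47; 18; 7; 19; 49; 59; 39;
  9; 29; 27; 19; 49; 59; 39; 9; 29; 38; 48; 58; 26; 39; 9; 6; 9; 29; 46; 56; 36;
  17; 18; 6; 19; 49; 59; 39; 9; 29; 26; 19; 49; 59; 39; 9; 29; 38; 48; 58; 27;
  39; 9; 7; 29; 9; 57; 37; 47; 28; 29; 49; 9; 19; 59; 39; 8; 9; 39; 29; 38; 18;
  25; 35; 6; 7; 8; 15; 9; 39; 29; 59; 49; 19; 45; 9; 39; 29; 59; 19; 49; 28; 58;
  38; 9; 15; 18; 48; 45; 18; 48; 39; 29; 59; 16; 17; 47; 46; 17; 47; 27; 37; 57;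
  8; 9; 15; 47; 17; 45; 17; 47; 39; 29; 59; 16; 48; 18; 46; 48; 18; 28; 58; 38;
  16; 19; 49; 46; 19; 49; 36; 56; 26; 7; 8; 9; 15; 46; 16; 45; 16; 46; 39; 29;
  59; 17; 48; 18; 47; 18; 48; 28; 58; 38; 17; 49; 19; 47; 19; 49; 27; 37; 57;
  18; 19; 49; 39; 48; 8; 28; 58; 38; 48; 49; 19; 29; 8; 58].

Lemma check_sal2 : checks (leaf_cover 10 2 3) start_sal2 tree_sal2.
Proof. by vm_compute. Qed.

(* Triangles 012 and 345, a stable set 678, and a vertex 9 adjacent to 6. *)
Definition start_disjoint b7 b8 : seq (nat * nat * bool) := [::
  (0, 1, true); (0, 2, true); (1, 2, true); (3, 4, true); (3, 5, true); (4, 5, true);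
  (9, 6, true); (6, 7, false); (6, 8, false); (7, 8, false); (9, 7, b7); (9, 8, b8)].

Definition tree_disjoint00 : seq (nat * nat) := decode 10 [::
  7; 17; 28; 27; 29; 26; 18; 27; 28; 29; 26; 19; 16; 27; 28; 29; 26; 8; 18; 27;
  28; 29; 26; 17; 28; 27; 29; 26; 19; 16; 27; 28; 29; 26; 6; 9; 17; 27; 28; 29;
  26; 18; 28; 27; 29; 26; 19; 16].

Lemma check_disjoint00 :
  checks leaf_K4free_cover (start_disjoint false false) tree_disjoint00.
Proof. by vm_compute. Qed.

Definition tree_disjoint10 : seq (nat * nat) := decode 10 [::
  8; 18; 27; 28; 26; 28; 17; 16; 16; 26; 27; 19; 29; 17; 38; 48; 56; 58; 57; 46;
  58; 56; 57; 25; 49; 59; 14; 24; 15; 24; 47; 58; 57; 15; 56; 49; 59; 14; 25;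
  39; 36; 48; 58; 57; 56; 47; 58; 57; 15; 56; 14; 49; 14; 46; 15; 59; 58; 37;
  23; 48; 58; 57; 56; 49; 47; 14; 46; 15; 57; 58; 14; 24; 47; 25; 56; 46; 58;
  23; 13; 14; 24; 15; 58; 48; 36; 37; 46; 49; 36; 37; 57; 59; 25; 56; 48; 36;
  58; 56; 57; 25; 59; 15; 37; 58; 57; 15; 56; 25; 59; 47; 49; 57; 56; 58; 37;
  36; 17; 27; 26; 19; 29; 38; 48; 56; 58; 57; 46; 58; 56; 57; 15; 49; 59; 14;
  24; 25; 14; 47; 57; 58; 25; 56; 49; 59; 24; 15; 39; 36; 48; 58; 57; 56; 47;
  58; 57; 25; 56; 14; 49; 46; 24; 58; 59; 25; 37; 13; 48; 58; 57; 56; 49; 47;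
  46; 57; 25; 58; 14; 24; 15; 47; 56; 46; 58; 23; 13; 14; 24; 15; 58; 48; 37;
  36; 49; 47; 37; 36; 59; 56; 57; 25; 48; 37; 58; 57; 25; 56; 15; 59; 36; 58;
  56; 57; 15; 59; 25; 46; 49; 56; 57; 58; 37; 36; 6; 18; 28; 26; 27; 9; 7; 29;
  38; 48; 56; 58; 57; 46; 58; 56; 57; 25; 49; 59; 4; 24; 5; 24; 47; 58; 57; 56;
  5; 59; 49; 25; 4; 39; 36; 48; 58; 57; 56; 47; 58; 57; 56; 5; 59; 25; 4; 46; 5;
  59; 58; 37; 23; 48; 58; 57; 56; 49; 47; 46; 56; 57; 58; 4; 24; 5; 57; 47; 58;
  46; 23; 3; 4; 5; 24; 58; 48; 37; 36; 46; 49; 36; 37; 59; 57; 56; 25; 48; 36;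
  58; 56; 57; 25; 59; 5; 37; 58; 57; 56; 5; 59; 25; 49; 47; 56; 25; 58; 37; 36;
  16; 26; 28; 27; 29; 38; 48; 59; 58; 25; 24; 58; 25; 59; 56; 47; 46; 46; 49;
  58; 56; 57; 23; 48; 58; 25; 59; 56; 37; 36; 58; 24; 46; 49; 36; 37; 24; 25;
  59; 56; 57; 7; 19; 17; 15; 9; 13; 14; 3; 49; 39; 37; 39; 47; 46; 5; 15; 9; 17;
  19; 3; 13; 4; 39; 49; 37; 39; 47; 46; 46; 49; 59; 37; 56; 36; 57; 25; 47; 7;
  19; 17; 15; 14; 5; 9; 4; 9; 14; 5; 17; 15; 19; 39; 36; 48; 58; 57; 56; 49; 58;
  59; 46; 25; 47; 57; 56; 24; 58; 47; 46; 59; 47; 56; 46; 57; 25; 37; 9; 3; 17;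
  7; 13; 4; 5; 17; 28; 9; 7; 19; 38; 48; 56; 58; 57; 46; 58; 56; 57; 15; 49; 59;
  4; 14; 5; 14; 47; 57; 58; 56; 5; 59; 49; 15; 4; 39; 36; 48; 58; 57; 56; 47;
  58; 57; 56; 5; 49; 4; 4; 46; 5; 59; 58; 37; 13; 48; 58; 57; 56; 49; 47; 46;
  56; 57; 58; 4; 14; 5; 57; 47; 58; 46; 13; 3; 4; 5; 14; 58; 48; 37; 36; 46; 49;
  36; 37; 59; 57; 56; 15; 48; 36; 58; 56; 57; 15; 59; 5; 37; 58; 57; 56; 5; 59;
  15; 49; 47; 15; 56; 58; 37; 36; 27; 9; 7; 38; 48; 58; 59; 5; 46; 58; 56; 57;
  49; 59; 4; 5; 14; 47; 57; 58; 24; 56; 5; 49; 29; 36; 48; 58; 56; 57; 39; 59;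
  3; 5; 46; 56; 58; 57; 15; 59; 25; 5; 29; 14; 47; 24; 26; 19; 39; 58; 59; 57;
  15; 5; 56; 4; 49; 13; 3; 58; 15; 4; 56; 49; 37; 13; 23; 26; 19; 48; 59; 15;
  58; 49; 58; 59; 15; 5; 57; 14; 47; 56; 46; 4; 4; 14; 58; 15; 47; 3; 56; 46;
  39; 26; 19; 38; 48; 15; 56; 58; 47; 57; 58; 56; 46; 59; 14; 15; 46; 58; 56;
  57; 15; 49; 14; 37; 48; 58; 57; 25; 56; 59; 5; 15; 9; 47; 58; 57; 25; 56; 5;
  59; 15; 9; 46; 24; 4; 7; 29; 39; 56; 58; 57; 15; 49; 14; 23; 13; 25; 58; 14;
  59; 49; 36; 23; 3; 7; 29; 48; 25; 58; 59; 49; 58; 59; 25; 15; 24; 46; 56; 47;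
  14; 57; 14; 24; 13; 25; 46; 58; 39; 47; 57; 7; 38; 48; 56; 58; 57; 58; 46; 47;
  46; 56; 57; 5; 49; 47; 59; 18; 27; 28; 26; 24; 29; 9; 25; 4; 17; 15; 28; 27;
  19; 16; 24; 14; 16; 25; 29; 28; 19; 9; 15; 4; 47; 4; 57; 56; 59; 49; 18; 27;
  28; 25; 26; 29; 9; 24; 5; 17; 28; 27; 14; 25; 26; 19; 15; 16; 25; 29; 28; 19;
  9; 14; 5; 18; 27; 28; 26; 29; 9; 39; 36; 48; 58; 57; 56; 47; 58; 57; 25; 56;
  4; 49; 46; 24; 58; 59; 25; 3; 37; 48; 58; 57; 56; 49; 47; 46; 25; 57; 58; 4;
  24; 47; 25; 57; 46; 58; 23; 3; 4; 5; 24; 58; 48; 37; 36; 49; 47; 37; 36; 59;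
  56; 57; 25; 48; 37; 58; 57; 25; 56; 5; 59; 36; 58; 56; 57; 5; 59; 25; 49; 46;
  25; 57; 58; 37; 36; 17; 28; 27; 26; 29; 36; 48; 58; 56; 57; 39; 59; 23; 25;
  46; 56; 58; 57; 5; 59; 15; 25; 19; 47; 4; 14; 16; 9; 39; 58; 57; 25; 56; 24;
  49; 23; 3; 5; 58; 24; 56; 49; 3; 37; 13; 16; 9; 48; 58; 5; 59; 49; 58; 59; 25;
  5; 23; 57; 39; 56; 4; 24; 47; 5; 58; 23; 46; 56; 39; 16; 36; 48; 58; 56; 57;
  5; 39; 37; 59; 13; 29; 25; 28; 9; 19; 3; 15; 58; 46; 47; 4; 39; 37; 49; 13;
  29; 24; 28; 9; 19; 3; 14; 46; 56; 57; 5; 59; 28; 19; 15; 27; 19; 25; 15; 29;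
  26; 37; 47; 14; 24; 13; 23; 47; 4; 5; 57; 15; 56; 25; 14; 49; 19; 27; 28; 56;
  49; 19; 29; 27; 28; 24; 26; 9; 59; 15; 37; 57; 13; 14; 24; 28; 26; 29; 9; 27;
  59; 25; 37; 57; 23; 3; 37; 48; 58; 57; 15; 56; 25; 59; 29; 39; 28; 19; 9; 13;
  5; 46; 58; 47; 49; 39; 14; 23; 29; 28; 19; 9; 13; 4; 5; 57; 15; 56; 25; 13;
  39; 19; 27; 28; 56; 39; 19; 27; 28; 26; 9; 59; 15; 49; 57; 4; 13; 23; 28; 29;
  26; 27; 9; 59; 25; 49; 57; 4; 47; 4].

Lemma check_disjoint10 :
  checks leaf_K4free_cover (start_disjoint true false) tree_disjoint10.
Proof. by vm_compute. Qed.

Definition tree_disjoint11 : seq (nat * nat) := decode 10 [::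
  6; 16; 26; 27; 28; 26; 17; 18; 17; 27; 28; 8; 7; 18; 36; 46; 56; 57; 58; 47;
  57; 56; 58; 25; 37; 48; 38; 14; 3; 24; 48; 58; 56; 57; 15; 37; 38; 3; 37; 47;
  58; 56; 57; 48; 58; 57; 56; 5; 38; 46; 13; 24; 4; 46; 57; 56; 58; 25; 38; 13;
  38; 23; 46; 58; 56; 57; 15; 47; 48; 4; 47; 57; 58; 56; 5; 48; 14; 24; 48; 18;
  28; 27; 7; 8; 36; 46; 56; 57; 58; 47; 57; 56; 15; 58; 37; 48; 38; 24; 3; 14;
  48; 58; 56; 57; 25; 37; 38; 3; 37; 47; 58; 56; 57; 48; 58; 57; 56; 5; 38; 46;
  23; 14; 4; 46; 57; 56; 15; 58; 23; 38; 38; 13; 46; 58; 56; 57; 25; 47; 48; 4;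
  47; 57; 58; 56; 5; 48; 24; 14; 48; 7; 17; 26; 28; 27; 27; 18; 16; 18; 28; 26;
  16; 8; 36; 46; 56; 57; 58; 47; 57; 56; 15; 58; 37; 48; 38; 4; 23; 14; 48; 58;
  56; 57; 5; 37; 38; 23; 37; 47; 58; 56; 57; 48; 58; 57; 25; 56; 38; 46; 3; 14;
  46; 24; 57; 56; 15; 58; 3; 38; 38; 13; 46; 58; 56; 57; 5; 47; 48; 24; 47; 57;
  58; 25; 56; 4; 48; 14; 48; 16; 26; 28; 8; 36; 46; 56; 57; 58; 47; 57; 56; 58;
  25; 37; 48; 38; 4; 13; 24; 48; 58; 56; 57; 5; 37; 38; 13; 37; 47; 58; 56; 57;
  48; 58; 57; 15; 56; 38; 46; 3; 24; 14; 46; 57; 56; 58; 25; 38; 3; 38; 23; 46;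
  58; 56; 57; 5; 47; 48; 14; 47; 57; 58; 15; 56; 4; 48; 24; 48; 8; 18; 27; 28;
  26; 28; 17; 16; 16; 26; 27; 17; 36; 46; 56; 57; 58; 47; 57; 56; 58; 5; 37; 48;
  38; 24; 13; 48; 4; 58; 56; 57; 25; 37; 38; 13; 37; 47; 58; 56; 57; 48; 58; 57;
  15; 56; 38; 46; 23; 4; 14; 46; 57; 56; 58; 5; 38; 23; 38; 3; 46; 58; 56; 57;
  25; 47; 48; 14; 47; 57; 58; 15; 56; 24; 48; 48; 4; 17; 27; 26; 36; 46; 56; 57;
  58; 47; 57; 56; 58; 5; 37; 48; 38; 14; 23; 48; 4; 58; 56; 57; 15; 37; 38; 23;
  37; 47; 58; 56; 57; 48; 58; 57; 25; 56; 38; 46; 13; 4; 46; 24; 57; 56; 58; 5;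
  38; 13; 38; 3; 46; 58; 56; 57; 15; 47; 48; 24; 47; 57; 58; 25; 56; 14; 48; 48;
  4].

Lemma check_disjoint11 :
  checks leaf_K4free_cover (start_disjoint true true) tree_disjoint11.
Proof. by vm_compute. Qed.

(* A triangle 012, three edges 34, 56, 78, and a vertex 9 not adjacent to 4, 6, 8. *)
Definition start_intersecting b3 b5 b7 : seq (nat * nat * bool) := [::
  (0, 1, true); (0, 2, true); (1, 2, true); (3, 4, true); (5, 6, true); (7, 8, true);
  (9, 4, false); (9, 6, false); (9, 8, false); (9, 3, b3); (9, 5, b5); (9, 7, b7)].

Definition tree_intersecting0 : seq (nat * nat) := decode 10 [::
  35; 36; 45; 37; 57; 47; 67; 68; 38; 48; 58; 37; 47; 38; 58; 68; 36; 46; 67;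
  57; 67; 58; 36; 38; 46; 48; 68].

Lemma check_intersecting0 :
  checks leaf_intersecting (start_intersecting false false false) tree_intersecting0.
Proof. by vm_compute. Qed.

Definition tree_intersecting1 : seq (nat * nat) := decode 10 [::
  45; 35; 46; 57; 67; 47; 48; 38; 58; 47; 67; 68; 9; 19; 29; 24; 23; 25; 28; 27;
  26; 14; 29; 15; 18; 24; 15; 25; 27; 28; 18; 17; 28; 23; 25; 27; 26; 18; 15;
  17; 16; 29; 24; 25; 28; 27; 26; 4; 5; 19; 29; 27; 26; 28; 24; 25; 17; 16; 18;
  14; 15; 8; 7; 15; 25; 16; 14; 19; 29; 27; 28; 18; 28; 17; 19; 29; 25; 26; 19;
  13; 7; 6; 19; 29; 24; 23; 28; 25; 27; 26; 14; 18; 15; 17; 16; 68; 67; 58; 47;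
  37; 9; 19; 29; 24; 23; 27; 25; 28; 26; 14; 29; 15; 17; 24; 15; 25; 27; 28; 18;
  17; 23; 27; 25; 28; 26; 17; 15; 16; 18; 29; 24; 25; 27; 28; 26; 4; 5; 19; 29;
  28; 26; 27; 24; 25; 18; 16; 17; 15; 14; 8; 7; 15; 25; 14; 16; 19; 29; 27; 28;
  17; 18; 27; 19; 29; 25; 26; 19; 13; 8; 6; 19; 29; 24; 25; 23; 27; 28; 26; 14;
  17; 15; 16; 18; 67; 68; 57; 47; 48; 46; 46; 36; 48; 38; 68; 47; 57; 58; 9; 19;
  29; 24; 26; 28; 25; 27; 14; 29; 13; 16; 18; 24; 16; 26; 27; 28; 17; 18; 28;
  26; 25; 27; 13; 18; 16; 17; 15; 29; 24; 28; 26; 25; 27; 4; 6; 19; 29; 27; 25;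
  28; 24; 26; 17; 18; 15; 16; 14; 8; 7; 16; 15; 26; 14; 19; 29; 27; 28; 18; 28;
  17; 19; 29; 25; 26; 13; 19; 5; 7; 19; 29; 24; 26; 28; 25; 27; 14; 18; 13; 16;
  17; 15; 58; 68; 57; 47; 37; 9; 19; 29; 24; 23; 26; 27; 28; 25; 14; 29; 16; 17;
  24; 16; 26; 27; 28; 17; 18; 27; 23; 26; 28; 25; 16; 17; 15; 18; 29; 24; 27;
  26; 28; 25; 4; 6; 19; 29; 28; 25; 27; 24; 26; 18; 15; 17; 16; 14; 8; 7; 16;
  26; 14; 15; 19; 29; 27; 28; 17; 18; 27; 19; 29; 25; 26; 19; 13; 8; 5; 19; 29;
  24; 27; 23; 26; 28; 25; 14; 17; 16; 15; 18; 47; 48; 68; 58].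

Lemma check_intersecting1 :
  checks leaf_intersecting (start_intersecting true false false) tree_intersecting1.
Proof. by vm_compute. Qed.

Definition tree_intersecting2 : seq (nat * nat) := decode 10 [::
  35; 46; 45; 36; 47; 37; 48; 67; 9; 19; 29; 26; 24; 25; 28; 27; 68; 3; 13; 18;
  16; 38; 17; 23; 14; 57; 58; 15; 6; 13; 15; 16; 17; 14; 18; 38; 58; 23; 57; 7;
  8; 13; 18; 16; 15; 38; 17; 23; 14; 57; 58; 38; 23; 57; 58; 5; 13; 18; 15; 16;
  14; 17; 4; 13; 15; 18; 16; 14; 17; 27; 24; 28; 16; 3; 26; 15; 14; 18; 28; 68;
  17; 29; 23; 27; 38; 24; 13; 57; 25; 58; 5; 14; 26; 18; 68; 17; 28; 29; 25; 15;
  23; 13; 6; 57; 7; 27; 38; 24; 13; 58; 57; 29; 14; 15; 18; 17; 68; 6; 26; 23;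
  25; 27; 24; 28; 58; 38; 57; 13; 7; 8; 25; 23; 28; 26; 27; 38; 24; 13; 58; 57;
  38; 13; 57; 58; 4; 28; 26; 25; 23; 24; 27; 7; 26; 6; 8; 4; 58; 68; 57; 38; 14;
  27; 24; 28; 25; 23; 18; 24; 15; 13; 17; 28; 15; 23; 25; 27; 17; 25; 23; 27;
  13; 25; 27; 23; 27; 14; 15; 17; 18; 68; 28; 8; 4; 6; 58; 38; 57; 13; 6; 26;
  27; 24; 28; 17; 27; 3; 5; 7; 6; 57; 4; 58; 8; 68; 18; 28; 29; 24; 18; 29; 5;
  3; 26; 25; 24; 6; 28; 7; 8; 68; 4; 38; 58; 23; 57; 68; 14; 3; 29; 26; 6; 28;
  7; 24; 58; 68; 57; 6; 4; 19; 29; 15; 13; 17; 27; 18; 26; 24; 16; 28; 38; 25;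
  23; 18; 15; 28; 17; 16; 13; 26; 23; 38; 16; 14; 8; 16; 26; 27; 24; 28; 29; 23;
  38; 5; 19; 17; 15; 14; 13; 18; 7; 14; 19; 15; 17; 18; 13; 3; 19; 14; 17; 15;
  18; 13; 23; 29; 17; 18; 28; 7; 26; 5; 29; 3; 23; 27; 38; 19; 13; 5; 26; 28; 7;
  29; 3; 23; 38; 38; 29; 5; 3; 7; 27; 5; 3; 7; 26; 24; 7; 5; 3; 28; 25; 3; 5; 7;
  23; 5; 7; 3; 19; 13; 5; 26; 28; 7; 29; 3; 23; 38; 8; 7; 19; 29; 13; 15; 17;
  18; 27; 26; 24; 16; 25; 28; 38; 23; 16; 26; 14; 15; 18; 28; 17; 29; 13; 25;
  23; 27; 38; 17; 18; 6; 4; 19; 29; 15; 13; 17; 27; 18; 26; 14; 16; 26; 27; 24;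
  28; 16; 26; 14; 18; 28; 29; 23; 25; 27; 24; 24; 27; 17; 27; 18; 14; 26; 23;
  29; 8; 16; 26; 27; 24; 28; 29; 25; 23; 29; 17; 14; 28; 26; 68; 29; 25; 23; 24;
  27; 18; 28; 26; 29; 23; 25; 27; 24; 24; 27; 15; 19; 26; 28; 68; 29; 25; 24;
  23; 27; 19; 13; 5; 26; 28; 68; 7; 29; 23; 27; 38; 24; 3; 25; 57; 7; 8; 14; 16;
  24; 13; 17; 28; 29; 25; 19; 29; 15; 18; 28; 24; 23; 26; 27; 18; 28; 17; 16;
  26; 29; 25; 23; 24; 27; 24; 27; 4; 68; 16; 18; 15; 26; 14; 27; 23; 29; 19; 13;
  15; 29; 17; 14; 18; 24; 28; 17; 14; 18; 24; 28; 29; 25; 68; 67; 48; 58; 4; 14;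
  24; 29; 25; 23; 28; 26; 27; 57; 37; 38; 3; 13; 18; 19; 15; 16; 17; 8; 18; 16;
  13; 15; 19; 17; 5; 6; 13; 18; 19; 16; 15; 17; 9; 19; 13; 16; 18; 17; 15; 7;
  18; 19; 13; 16; 15; 17; 28; 27; 19; 6; 29; 15; 13; 18; 28; 17; 24; 57; 16; 26;
  37; 27; 38; 25; 23; 24; 13; 15; 18; 16; 17; 37; 57; 38; 9; 23; 26; 29; 27; 25;
  28; 7; 3; 26; 23; 28; 29; 25; 27; 8; 23; 26; 28; 29; 25; 27; 5; 28; 29; 23;
  26; 25; 27; 29; 9; 3; 7; 8; 15; 27; 25; 57; 28; 5; 26; 38; 37; 23; 18; 17; 23;
  25; 27; 28; 57; 26; 5; 37; 38; 57; 5; 38; 37; 13; 27; 25; 23; 28; 26; 16; 23;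
  25; 27; 28; 26; 28; 27; 15; 13; 9; 3; 18; 7; 8; 17; 16; 57; 37; 5; 38; 17; 18;
  24; 3; 6; 29; 25; 9; 23; 28; 7; 8; 27; 26; 57; 37; 5; 38; 28; 27; 9; 5; 18;
  16; 17; 28; 19; 29; 15; 24; 23; 26; 14; 27; 57; 25; 38; 13; 37; 19; 29; 15;
  14; 24; 28; 27; 14; 16; 13; 24; 17; 27; 29; 25; 57; 28; 15; 26; 38; 37; 23; 8;
  7; 19; 29; 13; 15; 24; 23; 26; 14; 27; 18; 28; 17; 16; 57; 37; 25; 38; 28; 27;
  14; 16; 24; 13; 17; 18; 27; 29; 23; 25; 57; 28; 15; 26; 38; 37; 17; 18; 57;
  19; 29; 28; 27; 26; 24; 23; 26; 27; 25; 38; 37; 3; 13; 14; 17; 15; 16; 18; 6;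
  14; 17; 13; 15; 16; 18; 17; 18; 28; 29; 3; 24; 23; 26; 27; 25; 6; 38; 37; 14;
  3; 27; 15; 24; 29; 13; 23; 38; 37; 25; 26; 28; 6; 15; 24; 13; 27; 38; 29; 37;
  25; 23; 28; 26; 37; 38; 13; 29; 28; 24; 26; 23; 27; 25; 15; 29; 28; 24; 23;
  26; 25; 27; 16; 14; 28; 29; 3; 24; 6; 26; 37; 27; 38; 23; 25; 8; 7; 14; 16;
  24; 13; 29; 25; 19; 23; 28; 17; 18; 27; 26; 57; 37; 15; 38; 28; 27; 19; 29;
  13; 15; 18; 28; 17; 24; 57; 23; 26; 27; 25; 16; 38; 37; 17; 18; 38; 48; 37;
  57; 67; 58; 9; 19; 29; 24; 23; 26; 27; 28; 28; 27; 14; 29; 16; 17; 18; 24; 4;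
  5; 3; 8; 7; 6; 16; 26; 28; 18; 28; 26; 28; 27; 16; 17; 18; 17; 18; 29; 26; 24;
  28; 27; 27; 28; 4; 6; 17; 27; 18; 15; 14; 24; 16; 29; 19; 19; 29; 13; 16; 26;
  27; 28; 16; 14; 8; 7; 14; 24; 16; 13; 17; 18; 27; 19; 29; 19; 29; 15; 18; 28;
  24; 26; 17; 18; 8; 7; 16; 26; 14; 15; 18; 28; 17; 29; 19; 19; 29; 13; 15; 17;
  18; 27; 14; 24; 17; 18; 4; 14; 24; 29; 25; 27; 28; 58; 6; 17; 16; 19; 18; 15;
  13; 9; 19; 13; 16; 18; 17; 15; 8; 7; 16; 19; 13; 17; 18; 15; 3; 19; 16; 17;
  13; 18; 15; 5; 19; 17; 16; 13; 18; 15; 28; 27; 19; 6; 29; 15; 17; 27; 18; 24;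
  58; 26; 28; 25; 23; 3; 15; 29; 17; 18; 27; 58; 24; 23; 25; 26; 28; 24; 13; 15;
  17; 18; 58; 7; 26; 23; 27; 25; 28; 29; 5; 9; 23; 26; 29; 27; 28; 25; 8; 29;
  27; 23; 26; 25; 28; 29; 9; 8; 7; 5; 58; 15; 28; 25; 18; 25; 28; 28; 27; 15; 9;
  17; 8; 18; 7; 58; 5; 17; 18; 24; 3; 6; 29; 25; 9; 27; 8; 28; 7; 58; 5; 28; 27;
  9; 5; 14; 16; 13; 24; 27; 28; 17; 29; 15; 19; 25; 18; 58; 25; 29; 19; 29; 15;
  17; 27; 18; 24; 58; 23; 26; 25; 28; 17; 18; 7; 8; 19; 29; 13; 15; 17; 18; 27;
  24; 23; 26; 14; 25; 28; 58; 14; 16; 24; 13; 18; 28; 17; 29; 15; 25; 58; 17;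
  18; 58; 17; 27; 29; 23; 25; 24; 26; 23; 28; 25; 15; 19; 29; 27; 24; 23; 26;
  25; 28; 14; 16; 27; 29; 24; 23; 26; 25; 28; 18; 29; 27; 24; 26; 23; 28; 25;
  13; 14; 29; 27; 24; 23; 25; 28; 26; 8; 7; 19; 29; 13; 15; 17; 18; 27; 24; 26;
  14; 23; 28; 58; 25; 14; 16; 24; 13; 18; 28; 17; 29; 15; 25; 27; 58; 17; 18; 9;
  19; 29; 26; 24; 25; 27; 28; 67; 48; 3; 13; 16; 17; 18; 37; 14; 23; 58; 57; 15;
  6; 13; 15; 16; 18; 14; 17; 37; 57; 23; 58; 8; 7; 13; 16; 15; 17; 18; 37; 14;
  23; 57; 58; 37; 23; 58; 57; 5; 13; 15; 16; 17; 18; 14; 4; 15; 17; 16; 13; 14;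
  18; 28; 27; 24; 67; 23; 48; 57; 5; 15; 14; 18; 17; 58; 16; 25; 13; 37; 4; 14;
  13; 15; 17; 18; 16; 7; 8; 13; 18; 14; 15; 16; 17; 58; 25; 37; 3; 13; 18; 15;
  14; 16; 17; 6; 18; 14; 15; 13; 17; 16; 16; 3; 26; 15; 14; 17; 67; 27; 18; 29;
  48; 23; 37; 28; 13; 24; 58; 57; 25; 5; 14; 26; 17; 67; 27; 18; 29; 48; 25; 15;
  23; 13; 6; 58; 8; 37; 28; 13; 24; 58; 57; 29; 14; 15; 17; 67; 18; 48; 6; 26;
  23; 25; 28; 27; 24; 37; 57; 13; 58; 8; 7; 23; 25; 26; 27; 28; 37; 24; 13; 57;
  58; 37; 13; 58; 57; 4; 25; 27; 23; 26; 24; 28; 8; 26; 6; 7; 14; 28; 24; 48;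
  27; 4; 57; 67; 58; 25; 37; 23; 17; 18; 25; 28; 24; 48; 27; 4; 67; 57; 37; 58;
  23; 48; 4; 57; 67; 58; 37; 15; 28; 24; 25; 27; 23; 13; 24; 25; 28; 27; 23; 28;
  18; 14; 15; 17; 48; 67; 27; 4; 6; 7; 37; 57; 13; 58; 6; 58; 26; 57; 28; 25;
  27; 24; 67; 14; 4; 7; 17; 4; 7; 18; 28; 3; 8; 5; 6; 58; 4; 57; 7; 67; 17; 29;
  26; 27; 17; 29; 5; 3; 26; 25; 24; 6; 48; 27; 8; 7; 67; 4; 37; 57; 23; 58; 67;
  14; 57; 26; 24; 4; 3; 5; 8; 7; 6; 27; 5; 8; 4; 3; 7; 6; 25; 29; 4; 3; 8; 5; 6;
  7; 29; 23; 8; 4; 3; 6; 7; 5; 57; 67; 58; 6; 4; 19; 29; 15; 13; 18; 28; 17; 26;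
  24; 16; 27; 37; 25; 23; 17; 27; 18; 15; 16; 13; 26; 37; 23; 16; 14; 7; 8; 19;
  29; 13; 15; 18; 28; 17; 26; 24; 16; 25; 27; 37; 23; 16; 26; 14; 15; 17; 18;
  27; 13; 23; 37; 28; 17; 18; 48; 5; 18; 14; 28; 17; 19; 13; 29; 26; 25; 16; 24;
  23; 37; 27; 13; 19; 14; 23; 16; 17; 26; 37; 27; 16; 15; 3; 16; 26; 23; 24; 29;
  27; 28; 28; 27; 37; 29; 14; 18; 15; 19; 13; 17; 18; 17; 23; 26; 27; 28; 37;
  19; 13; 27; 26; 23; 29; 37; 37; 28; 29; 26; 24; 25; 27; 23; 13; 19; 23; 27;
  26; 37; 29; 8; 7; 19; 29; 13; 15; 18; 28; 17; 26; 24; 16; 25; 27; 37; 23; 16;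
  26; 14; 15; 17; 18; 27; 13; 23; 37; 28; 17; 18; 4; 6; 19; 29; 15; 13; 17; 27;
  18; 24; 16; 26; 67; 14; 24; 16; 27; 18; 28; 48; 26; 27; 17; 28; 14; 16; 67;
  26; 29; 23; 24; 14; 26; 17; 18; 16; 48; 23; 28; 25; 29; 8; 7; 14; 24; 16; 13;
  18; 28; 17; 48; 29; 25; 23; 19; 27; 26; 67; 19; 29; 13; 15; 17; 18; 27; 16;
  24; 26; 67; 17; 18; 27; 16; 48; 26; 67; 29; 23; 25; 28; 24; 67; 18; 28; 26;
  27; 24; 25; 29; 23; 16; 15; 48; 28; 24; 29; 23; 26; 25; 27; 19; 14; 17; 24;
  28; 48; 29; 25; 23; 27; 26; 14; 24; 28; 29; 25; 23; 27; 26; 27; 26; 13; 19;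
  28; 24; 48; 29; 23; 26; 27; 25; 7; 8; 16; 26; 14; 15; 17; 18; 27; 29; 23; 25;
  19; 28; 24; 48; 67; 28; 19; 29; 13; 15; 18; 28; 17; 26; 14; 24; 48; 27; 18;
  28; 17; 67; 14; 24; 29; 25; 23; 27; 26; 48; 27; 48; 6; 17; 27; 24; 28; 26; 23;
  25; 29; 14; 13; 67; 26; 27; 29; 25; 24; 23; 28; 19; 16; 18; 27; 67; 26; 29;
  25; 23; 24; 28; 16; 27; 26; 29; 23; 25; 28; 24; 24; 67; 19; 15; 67; 26; 27;
  29; 25; 24; 28; 23; 47; 37; 48; 68; 67; 58; 9; 19; 29; 24; 23; 27; 26; 25; 28;
  57; 38; 45; 36; 3; 13; 16; 14; 17; 15; 18; 6; 13; 15; 16; 17; 14; 18; 7; 4;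
  13; 14; 15; 16; 18; 17; 5; 14; 13; 15; 16; 18; 17; 8; 16; 14; 13; 15; 17; 18;
  28; 26; 14; 29; 13; 17; 16; 18; 15; 57; 38; 45; 36; 3; 26; 23; 24; 27; 28; 25;
  6; 26; 23; 25; 27; 24; 28; 7; 4; 24; 25; 26; 23; 28; 27; 5; 24; 23; 26; 25;
  27; 28; 8; 25; 26; 23; 24; 27; 28; 24; 4; 5; 3; 8; 6; 7; 36; 38; 17; 28; 27;
  26; 23; 25; 16; 27; 18; 15; 13; 26; 13; 23; 28; 25; 18; 23; 28; 25; 15; 23;
  28; 25; 45; 38; 57; 36; 7; 17; 27; 25; 23; 16; 15; 23; 27; 25; 13; 23; 27; 25;
  26; 28; 26; 3; 4; 13; 17; 5; 16; 6; 18; 15; 45; 8; 57; 38; 45; 36; 8; 7; 16;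
  18; 3; 29; 5; 24; 4; 27; 23; 26; 6; 28; 25; 45; 8; 38; 57; 36; 45; 7; 8; 28;
  26; 4; 7; 19; 13; 15; 29; 26; 25; 28; 16; 24; 14; 27; 23; 36; 17; 38; 57; 36;
  45; 17; 18; 27; 24; 16; 18; 15; 26; 14; 24; 17; 29; 25; 23; 13; 27; 36; 57;
  38; 45; 36; 28; 27; 17; 14; 6; 14; 24; 26; 13; 17; 16; 25; 28; 36; 38; 23; 29;
  25; 23; 28; 27; 36; 38; 3; 17; 19; 18; 13; 16; 15; 8; 17; 13; 18; 19; 15; 16;
  5; 13; 18; 19; 17; 15; 16; 38; 45; 36; 57; 27; 5; 13; 15; 17; 3; 13; 17; 16;
  15; 19; 15; 3; 26; 8; 24; 29; 5; 25; 57; 38; 45; 36; 28; 27; 23; 13; 5; 26; 8;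
  24; 29; 23; 3; 57; 38; 45; 36; 18; 27; 25; 28; 29; 5; 8; 3; 57; 38; 45; 36;
  18; 16; 24; 26; 23; 25; 27; 28; 17; 24; 25; 26; 23; 28; 27; 26; 16; 18; 17;
  36; 38; 28; 8; 3; 5; 24; 23; 8; 3; 5; 25; 3; 5; 8; 38; 45; 36; 57; 17; 5; 25;
  27; 28; 23; 24; 3; 25; 28; 27; 24; 23; 27; 24; 16; 8; 5; 3; 36; 17; 57; 38;
  45; 36; 18; 17; 16; 18; 26; 24; 3; 8; 29; 23; 25; 5; 45; 28; 57; 38; 45; 36;
  28; 27; 8; 6; 19; 13; 29; 15; 24; 14; 23; 27; 26; 16; 28; 25; 45; 18; 38; 57;
  36; 45; 17; 18; 28; 26; 14; 24; 13; 17; 16; 26; 18; 29; 25; 23; 15; 28; 45;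
  57; 38; 45; 36; 28; 27; 16; 18; 67; 68; 57; 48; 38; 9; 19; 29; 24; 23; 28; 26;
  27; 25; 58; 37; 45; 36; 3; 13; 16; 14; 18; 15; 17; 6; 13; 15; 16; 18; 14; 17;
  8; 4; 15; 14; 16; 13; 17; 18; 5; 13; 15; 14; 16; 17; 18; 7; 16; 14; 13; 15;
  18; 17; 27; 26; 14; 29; 13; 18; 16; 17; 15; 37; 58; 36; 45; 3; 26; 23; 24; 28;
  27; 25; 6; 26; 23; 25; 28; 27; 24; 8; 4; 25; 24; 23; 26; 27; 28; 5; 24; 26;
  23; 25; 28; 27; 7; 25; 26; 23; 24; 28; 27; 24; 4; 5; 3; 7; 6; 8; 36; 37; 18;
  27; 28; 26; 25; 23; 16; 28; 17; 15; 13; 26; 13; 23; 27; 25; 17; 25; 27; 23;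
  15; 23; 27; 25; 45; 58; 8; 18; 23; 28; 25; 16; 15; 28; 23; 25; 13; 23; 28; 25;
  26; 27; 26; 5; 18; 13; 4; 3; 16; 6; 17; 15; 45; 7; 37; 58; 36; 45; 8; 7; 17;
  16; 3; 29; 5; 24; 4; 28; 23; 26; 6; 27; 25; 45; 7; 58; 37; 45; 36; 7; 8; 27;
  26; 4; 8; 19; 15; 29; 13; 26; 25; 16; 27; 24; 14; 28; 23; 18; 36; 58; 37; 45;
  36; 17; 18; 28; 24; 16; 15; 26; 17; 14; 24; 18; 29; 25; 23; 13; 36; 28; 37;
  58; 36; 45; 28; 27; 18; 14; 6; 14; 24; 26; 13; 25; 27; 18; 45; 15; 58; 29; 25;
  23; 27; 28; 36; 37; 3; 19; 18; 17; 13; 16; 15; 7; 13; 18; 19; 17; 16; 15; 5;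
  13; 18; 17; 19; 15; 16; 37; 45; 36; 58; 28; 5; 18; 13; 15; 3; 13; 18; 16; 15;
  19; 15; 3; 7; 26; 24; 29; 5; 25; 37; 58; 36; 45; 27; 28; 23; 13; 5; 26; 7; 24;
  29; 23; 3; 37; 58; 36; 45; 28; 25; 27; 29; 5; 7; 3; 37; 58; 36; 45; 17; 16;
  24; 26; 23; 25; 28; 27; 18; 24; 25; 26; 23; 27; 28; 26; 16; 17; 18; 36; 37;
  27; 3; 7; 5; 24; 23; 7; 3; 5; 25; 3; 5; 7; 37; 45; 36; 58; 18; 5; 28; 25; 27;
  23; 24; 3; 25; 27; 28; 24; 23; 28; 24; 7; 5; 16; 3; 18; 36; 37; 58; 36; 45;
  18; 17; 17; 16; 24; 7; 26; 3; 29; 23; 25; 5; 27; 45; 37; 58; 36; 45; 28; 27;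
  7; 6; 19; 15; 13; 29; 24; 14; 23; 28; 26; 27; 16; 25; 45; 17; 58; 37; 45; 36;
  17; 18; 27; 26; 14; 13; 24; 18; 16; 17; 26; 29; 23; 25; 15; 27; 45; 37; 58;
  36; 45; 28; 27; 17; 16].

Lemma check_intersecting2 :
  checks leaf_intersecting (start_intersecting true true false) tree_intersecting2.
Proof. by vm_compute. Qed.

Definition tree_intersecting3 : seq (nat * nat) := decode 10 [::
  35; 37; 57; 46; 45; 36; 48; 38; 68; 47; 3; 13; 23; 25; 29; 26; 28; 27; 67; 4;
  15; 14; 18; 17; 19; 16; 5; 19; 14; 15; 17; 16; 18; 7; 8; 15; 19; 18; 14; 16;
  17; 9; 19; 18; 15; 14; 16; 17; 6; 14; 18; 19; 15; 16; 17; 27; 29; 28; 58; 26;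
  4; 16; 14; 17; 15; 19; 18; 7; 19; 14; 17; 15; 16; 18; 5; 6; 19; 14; 16; 17;
  18; 15; 9; 19; 16; 14; 17; 18; 15; 8; 19; 16; 17; 14; 18; 15; 15; 23; 16; 18;
  17; 67; 4; 25; 24; 28; 27; 26; 29; 5; 24; 29; 25; 27; 26; 28; 7; 8; 24; 25;
  29; 28; 27; 26; 9; 28; 24; 25; 29; 27; 26; 6; 29; 28; 24; 25; 26; 27; 27; 16;
  29; 9; 7; 28; 4; 26; 5; 6; 25; 8; 58; 18; 28; 9; 8; 5; 4; 17; 6; 7; 67; 26;
  17; 25; 4; 9; 6; 7; 58; 8; 5; 67; 8; 4; 5; 9; 7; 6; 25; 4; 9; 5; 7; 8; 6; 67;
  26; 16; 17; 17; 27; 9; 4; 7; 5; 6; 8; 58; 18; 28; 23; 25; 18; 4; 23; 9; 25;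
  26; 5; 67; 28; 7; 8; 6; 16; 58; 25; 26; 4; 9; 6; 7; 8; 5; 28; 6; 9; 4; 7; 8;
  5; 29; 23; 4; 6; 7; 9; 5; 8; 23; 24; 6; 4; 7; 5; 8; 9; 5; 6; 17; 19; 27; 18;
  16; 26; 15; 23; 24; 29; 13; 25; 28; 58; 25; 67; 13; 19; 14; 23; 15; 16; 25;
  18; 28; 58; 26; 15; 16; 25; 18; 67; 28; 23; 24; 29; 27; 26; 27; 26; 8; 7; 15;
  25; 19; 16; 18; 28; 17; 58; 23; 24; 29; 13; 27; 26; 67; 13; 23; 14; 19; 17;
  18; 27; 16; 25; 26; 67; 17; 18; 27; 16; 58; 26; 67; 23; 29; 24; 28; 25; 67;
  15; 25; 27; 26; 28; 29; 23; 24; 17; 16; 28; 25; 58; 23; 29; 24; 26; 27; 19;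
  25; 28; 58; 23; 24; 27; 29; 26; 18; 13; 18; 28; 25; 23; 24; 29; 27; 26; 58;
  27; 13; 14; 28; 25; 58; 23; 24; 27; 26; 29; 7; 8; 16; 26; 14; 15; 17; 18; 27;
  23; 29; 13; 24; 28; 58; 25; 67; 28; 13; 23; 14; 19; 18; 28; 17; 26; 15; 25;
  58; 27; 18; 28; 17; 67; 15; 25; 23; 24; 29; 27; 26; 58; 27; 6; 58; 16; 26; 28;
  25; 27; 24; 29; 23; 18; 15; 67; 26; 27; 23; 24; 29; 25; 28; 14; 27; 67; 26;
  23; 29; 28; 24; 25; 13; 17; 17; 26; 27; 23; 29; 24; 28; 25; 67; 28; 13; 19;
  27; 26; 67; 23; 29; 28; 25; 24; 68; 67; 58; 5; 15; 25; 23; 24; 28; 27; 47; 3;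
  16; 19; 13; 17; 18; 14; 6; 16; 18; 13; 17; 19; 14; 7; 8; 13; 18; 16; 19; 17;
  14; 9; 13; 19; 18; 16; 14; 17; 4; 13; 19; 18; 16; 14; 17; 27; 28; 38; 24; 4;
  14; 16; 19; 18; 17; 13; 9; 19; 17; 14; 18; 13; 16; 8; 6; 14; 17; 16; 19; 13;
  18; 7; 16; 14; 19; 17; 18; 13; 3; 14; 17; 19; 16; 18; 13; 13; 25; 14; 18; 17;
  47; 3; 29; 23; 26; 27; 24; 28; 6; 26; 28; 23; 27; 24; 29; 7; 8; 29; 23; 28;
  26; 24; 27; 9; 23; 26; 28; 29; 27; 24; 4; 23; 26; 28; 29; 27; 24; 27; 14; 29;
  6; 9; 7; 28; 3; 24; 23; 4; 38; 8; 18; 28; 9; 8; 6; 3; 17; 4; 7; 47; 24; 17; 4;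
  23; 6; 9; 7; 38; 8; 3; 47; 3; 38; 8; 9; 6; 23; 4; 7; 23; 3; 9; 6; 7; 8; 4; 47;
  24; 14; 17; 17; 27; 6; 9; 7; 3; 4; 8; 38; 18; 28; 23; 25; 18; 9; 25; 6; 23;
  24; 3; 47; 28; 7; 8; 4; 38; 14; 23; 24; 6; 4; 9; 7; 8; 3; 28; 4; 6; 7; 9; 3;
  8; 29; 25; 7; 6; 4; 9; 3; 8; 25; 26; 6; 4; 7; 3; 8; 9; 3; 4; 17; 19; 18; 27;
  14; 24; 13; 25; 15; 26; 29; 38; 23; 28; 23; 47; 15; 25; 19; 16; 13; 23; 14;
  27; 18; 29; 28; 24; 38; 13; 23; 14; 18; 47; 28; 25; 26; 29; 27; 24; 27; 24; 8;
  7; 13; 23; 14; 19; 18; 28; 38; 17; 25; 29; 15; 26; 24; 47; 27; 15; 25; 19; 16;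
  17; 18; 27; 14; 23; 24; 47; 17; 18; 27; 38; 14; 24; 47; 25; 26; 29; 23; 28;
  47; 13; 23; 27; 24; 29; 28; 25; 26; 17; 14; 28; 23; 38; 25; 29; 26; 24; 27;
  19; 28; 23; 38; 25; 26; 27; 29; 24; 18; 15; 18; 28; 23; 25; 26; 29; 27; 24;
  38; 27; 16; 15; 23; 28; 38; 25; 26; 27; 29; 24; 7; 8; 14; 16; 24; 13; 17; 18;
  27; 25; 15; 29; 26; 38; 28; 23; 47; 28; 15; 25; 19; 16; 18; 28; 17; 24; 13;
  23; 38; 27; 18; 28; 17; 13; 47; 23; 25; 29; 26; 24; 27; 38; 27; 4; 38; 14; 24;
  28; 23; 26; 27; 29; 25; 18; 13; 24; 47; 27; 25; 26; 29; 23; 28; 16; 24; 47;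
  27; 25; 29; 28; 26; 23; 15; 17; 17; 24; 27; 25; 26; 29; 23; 28; 23; 28; 15;
  19; 47; 27; 24; 25; 29; 28; 23; 26; 9; 19; 29; 28; 27; 23; 38; 3; 13; 15; 17;
  5; 13; 15; 17; 6; 8; 7; 17; 18; 13; 16; 15; 25; 58; 26; 67; 47; 5; 15; 17; 13;
  7; 17; 18; 15; 13; 14; 3; 4; 13; 15; 17; 24; 26; 18; 28; 3; 7; 5; 29; 17; 13;
  38; 23; 3; 5; 7; 26; 25; 3; 7; 5; 27; 3; 8; 7; 6; 5; 15; 58; 25; 3; 5; 7; 24;
  23; 5; 7; 3; 27; 8; 7; 5; 3; 4; 24; 26; 7; 3; 5; 16; 14; 7; 5; 3; 8; 18; 28;
  29; 23; 25; 27; 24; 26; 19; 28; 13; 15; 17; 29; 7; 3; 38; 13; 25; 23; 27; 16;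
  15; 23; 27; 25; 17; 27; 23; 25; 26; 5; 58; 6; 67; 47; 15; 23; 25; 27; 14; 13;
  27; 25; 23; 17; 27; 25; 23; 24; 24; 26; 13; 17; 15; 16; 14; 28; 29; 23; 27;
  25; 24; 26; 4; 6; 19; 17; 15; 13; 14; 24; 16; 18; 28; 29; 23; 25; 27; 18; 28;
  29; 23; 25; 27; 24; 26; 48; 38; 47; 68; 67; 58; 7; 17; 27; 23; 24; 26; 25; 45;
  3; 13; 18; 19; 15; 16; 14; 8; 13; 16; 18; 15; 14; 19; 5; 6; 19; 16; 18; 13;
  14; 15; 9; 19; 13; 16; 18; 14; 15; 4; 19; 13; 16; 18; 14; 15; 25; 26; 24; 36;
  4; 18; 19; 14; 16; 13; 15; 9; 19; 14; 15; 16; 13; 18; 6; 5; 14; 19; 15; 18;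
  16; 13; 8; 15; 14; 19; 18; 16; 13; 3; 19; 14; 18; 15; 16; 13; 13; 27; 14; 16;
  15; 45; 3; 23; 29; 28; 25; 24; 26; 8; 23; 26; 28; 25; 24; 29; 5; 6; 29; 26;
  28; 23; 24; 25; 9; 23; 28; 29; 26; 25; 24; 4; 23; 26; 29; 28; 24; 25; 25; 14;
  9; 8; 5; 26; 3; 24; 23; 4; 36; 6; 16; 26; 6; 8; 9; 15; 3; 4; 45; 5; 24; 15;
  23; 8; 5; 4; 9; 36; 3; 6; 45; 8; 9; 3; 6; 5; 4; 23; 3; 8; 9; 5; 6; 4; 45; 24;
  14; 15; 15; 25; 8; 5; 9; 3; 4; 6; 36; 16; 23; 26; 27; 16; 27; 9; 8; 23; 24; 3;
  45; 26; 5; 6; 4; 14; 36; 23; 24; 4; 5; 9; 8; 6; 3; 26; 9; 4; 8; 5; 6; 3; 27;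
  29; 5; 9; 8; 4; 3; 6; 28; 27; 5; 4; 8; 3; 9; 6; 3; 4; 15; 25; 19; 16; 14; 24;
  13; 27; 28; 17; 29; 23; 36; 26; 23; 45; 17; 19; 18; 27; 13; 23; 14; 25; 16;
  26; 24; 36; 13; 23; 14; 16; 45; 26; 27; 29; 28; 24; 25; 25; 24; 6; 5; 13; 19;
  23; 14; 16; 36; 26; 15; 27; 29; 17; 28; 24; 45; 25; 17; 19; 27; 18; 15; 16;
  25; 14; 23; 24; 45; 15; 16; 25; 14; 36; 24; 45; 27; 28; 29; 23; 26; 45; 13;
  23; 25; 29; 24; 26; 28; 27; 15; 14; 26; 36; 23; 27; 29; 28; 24; 25; 19; 23;
  26; 36; 27; 28; 25; 29; 24; 17; 16; 16; 23; 26; 27; 29; 28; 24; 25; 25; 24;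
  17; 18; 36; 23; 26; 27; 28; 25; 29; 24; 5; 6; 14; 24; 13; 18; 15; 16; 25; 27;
  28; 17; 29; 23; 36; 26; 45; 26; 17; 19; 27; 18; 16; 26; 15; 24; 13; 23; 25;
  36; 16; 26; 15; 13; 45; 23; 27; 29; 28; 24; 25; 25; 24; 36; 4; 14; 24; 26; 25;
  28; 23; 27; 29; 16; 13; 25; 45; 24; 27; 28; 29; 23; 26; 18; 24; 45; 25; 27;
  29; 26; 28; 23; 17; 15; 15; 25; 24; 27; 29; 28; 26; 23; 23; 45; 26; 17; 19;
  24; 45; 25; 27; 29; 26; 23; 28; 9; 19; 29; 26; 25; 23; 36; 3; 13; 15; 17; 7;
  17; 16; 13; 67; 15; 6; 8; 5; 13; 15; 16; 17; 18; 27; 28; 58; 45; 7; 13; 17;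
  15; 5; 15; 17; 13; 14; 3; 4; 13; 17; 15; 28; 24; 16; 26; 3; 7; 5; 29; 15; 13;
  36; 23; 3; 5; 7; 28; 27; 3; 5; 7; 25; 3; 6; 5; 8; 7; 17; 67; 18; 58; 45; 27;
  3; 7; 5; 24; 23; 7; 3; 5; 25; 5; 7; 3; 4; 28; 24; 7; 3; 5; 18; 14; 5; 3; 7; 6;
  16; 26; 29; 27; 23; 25; 28; 24; 19; 26; 13; 15; 17; 29; 5; 3; 36; 13; 25; 23;
  27; 18; 17; 27; 25; 23; 15; 23; 25; 28; 27; 7; 67; 17; 27; 23; 25; 14; 13; 27;
  23; 25; 15; 27; 25; 24; 23; 28; 24; 13; 15; 17; 18; 14; 26; 29; 27; 25; 23;
  28; 24; 8; 4; 19; 15; 17; 13; 14; 24; 18; 16; 26; 29; 25; 23; 27; 16; 26; 29;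
  25; 23; 27; 28; 24; 68; 67; 58; 9; 19; 29; 24; 23; 25; 45; 5; 15; 17; 13; 7;
  17; 15; 13; 8; 4; 3; 13; 15; 14; 17; 18; 27; 28; 38; 36; 7; 13; 17; 15; 3; 13;
  17; 16; 15; 6; 5; 13; 17; 15; 28; 26; 14; 24; 7; 5; 3; 29; 13; 15; 45; 25; 3;
  5; 7; 28; 27; 3; 5; 7; 23; 5; 4; 3; 8; 7; 17; 47; 27; 3; 7; 5; 26; 25; 7; 3;
  5; 23; 7; 4; 3; 6; 5; 28; 26; 3; 7; 5; 16; 18; 3; 5; 7; 4; 14; 24; 29; 25; 27;
  23; 28; 26; 19; 24; 17; 13; 15; 29; 3; 5; 45; 15; 23; 25; 27; 18; 17; 27; 25;
  23; 13; 25; 23; 28; 27; 7; 47; 17; 27; 23; 25; 16; 15; 27; 23; 25; 13; 27; 23;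
  26; 25; 28; 26; 17; 15; 13; 16; 18; 24; 29; 27; 23; 25; 28; 26; 8; 6; 19; 17;
  13; 15; 16; 26; 18; 14; 24; 29; 27; 25; 23; 14; 24; 29; 27; 25; 23; 28; 26].

Lemma check_intersecting3 :
  checks leaf_intersecting (start_intersecting true true true) tree_intersecting3.
Proof. by vm_compute. Qed.

(* Vertices 0 and 1 are not adjacent, their common neighbours are 2 and 3, the
   other neighbours of 0 and of 1 are 4, 5 and 6, 7, and the vertices adjacent
   to neither form a 5-cycle on 8, ..., 12. *)
Definition start_r13 : seq (nat * nat * bool) := [::
  (0, 1, false); (0, 2, true); (0, 3, true); (0, 4, true); (0, 5, true); (0, 6, false);
  (0, 7, false); (0, 8, false); (0, 9, false); (0, 10, false); (0, 11, false);
  (0, 12, false); (1, 2, true); (1, 3, true); (1, 4, false); (1, 5, false); (1, 6, true);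
  (1, 7, true); (1, 8, false); (1, 9, false); (1, 10, false); (1, 11, false);
  (1, 12, false); (9, 8, true); (10, 8, false); (10, 9, true); (11, 8, false);
  (11, 9, false); (11, 10, true); (12, 8, true); (12, 9, false); (12, 10, false);
  (12, 11, true); (2, 8, true); (2, 9, false); (2, 10, true); (2, 11, false); (2, 12, false)].

Definition tree_r13 : seq (nat * nat) := decode 13 [::
  29; 30; 43; 57; 31; 44; 45; 32; 85; 33; 46; 60; 47; 99; 61; 73; 86; 64; 77;
  76; 48; 49; 75; 88; 101; 62; 88; 101; 88; 87; 101; 89; 72; 102; 103; 58; 50;
  63; 51; 59; 74; 90; 100; 71; 63; 71; 51; 59; 90; 74; 100; 59; 63; 101; 71;
  100; 102; 90; 89; 59; 50; 63; 51; 58; 74; 103; 87; 72; 63; 72; 51; 58; 103;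
  74; 87; 58; 63; 51; 103; 90; 50; 49; 88; 101; 74; 75; 62; 88; 101; 49; 62; 75;
  88; 101; 73; 86; 99; 88; 87; 101; 75; 62; 89; 73; 74; 86; 99; 47; 77; 102; 59;
  64; 103; 63; 48; 71; 50; 76; 51; 72; 61; 90; 100; 58; 76; 58; 51; 72; 61; 90;
  100; 76; 72; 61; 100; 47; 86; 73; 99; 101; 62; 75; 48; 73; 74; 86; 99; 77;
  101; 100; 102; 62; 75; 89; 58; 64; 90; 63; 72; 50; 76; 51; 71; 61; 103; 87;
  59; 76; 59; 51; 71; 103; 61; 87; 76; 71; 101; 62; 75; 62; 61; 63; 75; 76; 77;
  86; 99; 87; 90; 72; 103; 102; 58; 50; 89; 51; 100; 71; 64; 74; 59; 59; 89; 51;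
  64; 100; 71; 74; 59; 64; 99; 71; 103; 100; 89; 90; 59; 50; 102; 51; 87; 72;
  64; 58; 74; 102; 58; 51; 72; 64; 87; 74; 102; 72; 75; 76; 74; 63; 64; 86; 99;
  87; 90; 59; 103; 102; 71; 50; 89; 51; 100; 58; 77; 61; 72; 89; 72; 51; 58; 77;
  100; 61; 77; 72; 58; 99; 89; 103; 100; 90; 72; 50; 102; 51; 87; 59; 77; 61;
  71; 102; 71; 51; 59; 87; 77; 61; 77; 71; 51; 50].

Lemma check_r13 : checks leaf_r13 start_r13 tree_r13.
Proof. by vm_compute. Qed.

(** * Ramsey numbers *)

Section Ramsey.
Variable G : sgraph.
Implicit Types (A B K S T : {set G}) (x y z : G).

Definition tfree A := forall x y z, x \in A -> y \in A -> z \in A ->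
  adj x y -> adj y z -> ~~ adj x z.

Definition nbh A x := [set y in A | adj x y].
Definition nonnbh A x := [set y in A | ~~ cadj x y].

Lemma tfree_sub A B : A \subset B -> tfree B -> tfree A.
Proof. by move=> /subsetP s h x y z /s xB /s yB /s; apply: h. Qed.

Lemma tfree_clique A K : tfree A -> K \subset A -> clique K -> #|K| <= 2.
Proof.
move=> tA /subsetP sKA /cliqueP hK; rewrite leqNgt; apply/negP.
case/card_gt2P=> x [y [z [[xK yK zK] [xy yz zx]]]].
have a u v : u \in K -> v \in K -> u != v -> adj u v.
  by move=> uK vK uv; have := hK u v uK vK; rewrite /cadj (negbTE uv).
have := tA x y z (sKA _ xK) (sKA _ yK) (sKA _ zK) (a _ _ xK yK xy) (a _ _ yK zK yz).
by rewrite a // eq_sym.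
Qed.

Lemma tfree_or_triangle A :
  tfree A \/ exists T, [/\ T \subset A, clique T & #|T| = 3].
Proof.
case: (boolP [exists t : G * G * G, [&& t.1.1 \in A, t.1.2 \in A, t.2 \in A,
   adj t.1.1 t.1.2, adj t.1.2 t.2 & adj t.1.1 t.2]]).
  case/existsP=> [[[x y] z]] /= /and5P[xA yA zA xy /andP[yz xz]]; right.
  exists [set x; y; z]; split.
  - by rewrite !subUset !sub1set xA yA zA.
  - apply/cliqueP => u v; rewrite !inE -!orbA.
    by case/or3P=> /eqP-> /or3P[]/eqP->; rewrite ?cadjxx ?adj_cadj // adj_sym.
  - by rewrite -setUA cardsU1 cards2 !inE (adj_neq yz) negb_or (adj_neq xy) (adj_neq xz).
move/existsPn=> h; left=> x y z xA yA zA xy yz; apply/negP=> xz.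
by have := h (x, y, z); rewrite /= xA yA zA xy yz xz.
Qed.

Lemma nbh_sub A x : nbh A x \subset A.
Proof. by apply/subsetP => y; rewrite inE => /andP[]. Qed.

Lemma nonnbh_sub A x : nonnbh A x \subset A.
Proof. by apply/subsetP => y; rewrite inE => /andP[]. Qed.

Lemma card_nbh A x : x \in A -> #|A| = (#|nbh A x| + #|nonnbh A x|).+1.
Proof.
move=> xA; rewrite (cardsD1 x A) xA add1n; congr _.+1.
rewrite -(cardsID (nbh A x)) setIC; congr (_ + _); apply: eq_card => y; rewrite !inE.
  case: (boolP (adj x y)) => [xy|_]; rewrite ?andbF //.
  by rewrite eq_sym (adj_neq xy) !andbT andbb.
by rewrite /cadj negb_or negb_and eq_sym; case: (y \in A); rewrite ?andbF //= andbT andbC.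
Qed.

Lemma nbh_stable A x : tfree A -> x \in A -> stable (nbh A x).
Proof.
move=> tA xA; apply/stableP=> y z; rewrite !inE => /andP[yA xy] /andP[zA xz].
by apply: contraL xz => yz; apply: tA xy yz.
Qed.

Lemma nbh_sal A x : tfree A -> x \in A -> #|nbh A x| <= sal A.
Proof. by move=> tA xA; apply: sal_ge (nbh_stable tA xA) (nbh_sub A x). Qed.

Lemma nonnbh_sal A x : x \in A -> sal (nonnbh A x) < sal A.
Proof.
move=> xA; apply: (sal_add xA (nonnbh_sub A x)); first by rewrite inE cadjxx andbF.
by move=> y; rewrite inE /cadj negb_or => /and3P[].
Qed.

(** With stability number at most 2, a vertex has at most two neighbours, as they form a stable set,
    and its non-neighbours form a clique, hence are at most two: 1 + 2 + 2 = 5. *)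
Lemma ramsey33 A : tfree A -> 6 <= #|A| -> 3 <= sal A.
Proof.
move=> tA hA; rewrite ltnNge; apply/negP => hs.
have /card_gt0P[x xA] : 0 < #|A| by lia.
have := nonnbh_sal xA; have := nbh_sal tA xA; have := card_nbh xA.
have := @tfree_clique A (nonnbh A x) tA (nonnbh_sub A x).
case: (leqP (sal (nonnbh A x)) 1) => [/sal1 -> /(_ isT)|]; lia.
Qed.

(** The handshake lemma, needed to exclude a 3-regular graph on nine vertices. *)
Lemma even_sum_deg (s : seq G) :
  ~~ odd (\sum_(x <- s) \sum_(y <- s) adj x y).
Proof.
elim: s => [|x s IH]; first by rewrite big_nil.
have E : \sum_(z <- s) \sum_(y <- x :: s) adj z y =
    \sum_(z <- s) adj x z + \sum_(z <- s) \sum_(y <- s) adj z y.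
  by rewrite -big_split; apply: eq_bigr => z _; rewrite big_cons adj_sym.
by rewrite big_cons E big_cons adj_irrefl add0n addnA addnn oddD odd_double.
Qed.

Lemma sum_deg A : \sum_(x in A) #|nbh A x| = \sum_(x <- enum A) \sum_(y <- enum A) adj x y.
Proof.
rewrite big_enum; apply: eq_bigr => x _; rewrite big_enum /= -sum1_card.
rewrite [RHS]big_mkcond [LHS]big_mkcond; apply: eq_bigr => y _.
by rewrite inE; case: (y \in A); case: (adj x y).
Qed.

(** With stability number at most 3, each vertex has at most 3 neighbours and, by R(3,3) = 6, at
    most 5 non-neighbours. Nine vertices would then form a 3-regular graph, whose degree sum 27 is
    odd. *)
Lemma ramsey34 A : tfree A -> 9 <= #|A| -> 4 <= sal A.
Proof.
move=> tA hA; rewrite ltnNge; apply/negP => hs.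
have d x : x \in A -> (#|nbh A x| <= 3) && (#|nonnbh A x| <= 5).
  move=> xA; rewrite (leq_trans (nbh_sal tA xA) hs) /= leqNgt; apply/negP.
  move/(ramsey33 (tfree_sub (nonnbh_sub A x) tA)); have := nonnbh_sal xA; lia.
have d3 x : x \in A -> #|nbh A x| = 3.
  by move=> xA; have /andP := d x xA; have := card_nbh xA; lia.
have /card_gt0P[x0 x0A] : 0 < #|A| by lia.
have A9 : #|A| = 9 by have /andP := d x0 x0A; have := card_nbh x0A; lia.
have := even_sum_deg (enum A).
by rewrite -sum_deg (eq_bigr (fun=> 3)) // sum_nat_const A9.
Qed.

End Ramsey.

(** * Complements, to obtain cliques of size four from R(3,4) = 9 *)

Section Complement.
Variable G : sgraph.

Definition compl_adj : rel G := fun x y => ~~ cadj x y.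

Lemma compl_sym : symmetric compl_adj.
Proof. by move=> x y; rewrite /compl_adj cadj_sym. Qed.

Lemma compl_irrefl : irreflexive compl_adj.
Proof. by move=> x; rewrite /compl_adj cadjxx. Qed.

Definition compl := SGraph compl_sym compl_irrefl.

(** Stability number at most 2 says that the complement is triangle-free, and stable sets of the
    complement are cliques of [G]. *)
Lemma ramsey34_compl (A : {set G}) : sal A <= 2 -> 9 <= #|A| ->
  exists K : {set G}, [/\ K \subset A, clique K & #|K| = 4].
Proof.
move=> hA A9.
have tA : @tfree compl A.
  move=> x y z xA yA zA; rewrite /= /compl_adj /cadj !negb_or.
  move=> /andP[nxy axy] /andP[nyz ayz]; rewrite negb_and; apply: contraTT hA => /norP[].
  rewrite !negbK => nxz axz; rewrite -ltnNge.
  suff: #|[set x; y; z]| <= sal A.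
    by rewrite -setUA cardsU1 cards2 !inE nyz negb_or nxy nxz.
  apply: sal_ge; last by rewrite !subUset !sub1set xA yA zA.
  apply/stableP => u v; rewrite !inE -!orbA.
  by case/or3P=> /eqP-> /or3P[]/eqP->; rewrite ?adj_irrefl // adj_sym.
have [S [hK sSA S4]] : exists S : {set G}, [/\ clique S, S \subset A & 4 <= #|S|].
  have [S [hS sSA eS]] := @salP compl A; exists S; split=> //.
    apply/cliqueP => x y xS yS; move/stableP: hS => /(_ x y xS yS).
    by rewrite /= /compl_adj negbK.
  by have := @ramsey34 compl A tA A9; rewrite -eS.
have [s4 s4P] : exists s : seq G, [/\ uniq s, size s = 4 & {subset s <= S}].
  exists (take 4 (enum S)); rewrite take_uniq ?enum_uniq // size_take -cardE.
  split=> //; first by case: ifP => //; move: S4; lia.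
  by move=> x /mem_take; rewrite mem_enum.
case: s4P => us ss sS; exists [set x in s4]; split.
- by apply/subsetP => x; rewrite inE => /sS /(subsetP sSA).
- by apply: clique_sub hK; apply/subsetP => x; rewrite inE => /sS.
- by rewrite cardsE (card_uniqP us).
Qed.

End Complement.

(** * Covers of small graphs *)

Section SmallCovers.
Variable G : sgraph.
Implicit Types (A B K S T : {set G}) (x y z : G).

Lemma leaf_cover_sound x0 s A n k m p i j b :
  x0 \in A -> {subset s <= A} -> {subset A <= s} -> size s <= n ->
  0 < k -> sal A <= k -> consistent (lab x0 s) p ->
  leaf_cover n k m p i j b -> cov m A.
Proof.
move=> x0A sA As szn k0 hA cp; rewrite /leaf_cover; case: b.
  by move=> h; apply: known_true_cover cp As szn h.
case/clique_atP=> l [pl szl _]; have := known_false_stable sA x0A cp pl; lia.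
Qed.

Lemma cover_by_cases x0 s A n k m start c :
  x0 \in A -> {subset s <= A} -> {subset A <= s} -> size s <= n ->
  0 < k -> sal A <= k -> all (holds (lab x0 s)) start ->
  checks (leaf_cover n k m) start c -> cov m A.
Proof.
move=> x0A sA As szn k0 hA; apply: run_sound; first exact: lab_sym.
by move=> p i j b; apply: leaf_cover_sound.
Qed.

Definition is_c5 x0 (s : seq G) := [/\ size s = 5, uniq s &
  forall i j, i < 5 -> j < 5 -> adj (nth x0 s i) (nth x0 s j) = c5 i j].

Lemma c5_irrefl i : i < 5 -> c5 i i = false.
Proof. by do 5?[case: i => //= i]. Qed.

(** Two vertices of a 5-cycle are told apart by a third one. A map that respects the cycle for
    [cadj] is therefore injective, which [c5_of_cadj] uses to pass from [cadj] to [adj]. *)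
Lemma c5_distinct i j : i < 5 -> j < 5 -> i != j ->
  exists k, [/\ k < 5, k != i, k != j & c5 i k != c5 j k].
Proof.
move=> i5 j5 nij; have : has (fun k => [&& k != i, k != j & c5 i k != c5 j k]) (iota 0 5).
  by move: i j i5 j5 nij; do 5?[case=> [|] //=]; move=> + + + + //; do 6?[case=> //].
by case/hasP=> k; rewrite mem_iota => k5 /and3P[]; exists k.
Qed.

Lemma c5_of_cadj x0 s : size s = 5 ->
  (forall i j, i < j < 5 -> cadj (nth x0 s j) (nth x0 s i) = c5 j i) -> is_c5 x0 s.
Proof.
move=> sz h.
have h' i j : i < 5 -> j < 5 -> i != j -> cadj (nth x0 s i) (nth x0 s j) = c5 i j.
  move=> i5 j5; case: ltngtP => // [ij|ji] _; last by rewrite h ?ji.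
  by rewrite cadj_sym h ?ij // /c5 orbC.
have inj i j : i < 5 -> j < 5 -> i != j -> nth x0 s i != nth x0 s j.
  move=> i5 j5 nij; apply/eqP=> e; have [k [k5 ki kj]] := c5_distinct i5 j5 nij.
  by rewrite -!h' ?e ?eqxx // eq_sym.
have us : uniq s.
  by apply/(uniqP x0) => i j; rewrite !inE sz => i5 j5 /eqP; apply: contraTeq; apply: inj.
split=> // i j i5 j5; have [<-|nij] := eqVneq i j; first by rewrite adj_irrefl c5_irrefl.
by rewrite -h' // /cadj (negbTE (inj _ _ _ _ nij)).
Qed.

(** If the closed neighbourhood of [v] is a clique, the non-neighbours have stability number at most
    1 and form the second clique. Otherwise [v] has two non-adjacent neighbours, the start of the
    tree. *)
Lemma c5_or_cover A : #|A| <= 6 -> sal A <= 2 ->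
  cov 2 A \/ forall x0, exists2 s, is_c5 x0 s & {subset s <= A}.
Proof.
move=> A6 A2; have [->|[v vA]] := set_0Vmem A; first by left; apply: cov_card; rewrite cards0.
have [hK|hK] := boolP (clique (A :\: nonnbh A v)).
  left; apply: (covI hK); apply/cov1/clique_sub/sal1.
    by apply/subsetP => x; rewrite setDDr setDv set0U inE => /andP[_]; apply: id.
  have := nonnbh_sal vA; lia.
have [x [y [xA yA [vx vy nxy]]]] : exists x y,
    [/\ x \in A, y \in A & [/\ cadj v x, cadj v y & ~~ cadj x y]].
  move/cliqueP: hK => hK; have [//|e] := boolP [exists x in A, exists y in A, [&& cadj v x, cadj v y & ~~ cadj x y]].
    by case/exists_inP=> x xA /exists_inP[y yA /and3P[]]; exists x, y.
  case: hK => x y; rewrite !inE !negb_and !negbK => /andP[/orP[/negP //|vx] xA] /andP[/orP[/negP //|vy] yA].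
  apply: contraNT e => nxy; apply/exists_inP; exists x => //; apply/exists_inP; exists y => //.
  by rewrite vx vy.
set s := [:: v; x; y] ++ enum (A :\: [set v; x; y]).
have sA : {subset s <= A}.
  move=> z; rewrite mem_cat !inE mem_enum inE.
  by case/orP=> [/or3P[]/eqP->//|/andP[]].
have As : {subset A <= s}.
  move=> z zA; rewrite mem_cat mem_enum !inE zA andbT -!orbA.
  by case: (z == v); case: (z == x); case: (z == y).
have nvx : v != x by apply: contraNneq nxy => <-.
have nvy : v != y by apply: contraNneq nxy => <-; rewrite cadj_sym.
have nxy' : x != y by apply: contraNneq nxy => <-; rewrite cadjxx.
have szs : size s <= 6.
  rewrite size_cat /= -cardE cardsD (setIidPr _).
    by rewrite -setUA cardsU1 cards2 !inE nxy' negb_or nvx nvy; move: A6; lia.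
  by rewrite !subUset !sub1set vA xA yA.
apply: (@run_sound (lab v s) (lab_sym v s) leaf_c5 _ _ start_c5 tree_c5 _ check_c5); last first.
  by rewrite /holds /lab /= vx vy (negbTE nxy).
move=> p i j b cp; rewrite /leaf_c5; case: ifP => [h _|_ h].
  by left; apply: leaf_cover_sound cp h.
have [//|||f [szf _ hf]] := embedsP (acc := [::]) _ _ _ h; first by move=> k l; rewrite ltn0 andbF.
  by [].
right=> x0; exists [seq nth v s k | k <- f]; last first.
  by move=> z /mapP[k _ ->]; apply: (lab_in sA vA).
apply: c5_of_cadj => [|k l klt]; first by rewrite size_map.
have /andP[kl l5] := klt; have k5 := ltn_trans kl l5.
have := hf k l klt; rewrite !(nth_map 0) ?szf //.
by case/(knownP cp)/andP=> _ /eqP.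
Qed.

(** The 5-cycle, with stability number 2, is the only graph on at most five vertices with positive
    gap; the hypothesis excludes it by its parameters. *)
Lemma cover_small A : #|A| <= 5 -> #|A| < 5 \/ sal A <> 2 -> cov (sal A) A.
Proof.
move=> A5 h; have [/sal0->|s0] := eqVneq (sal A) 0; first by apply: cov_card; rewrite cards0.
have [/eqP s1|s1] := eqVneq (sal A) 1.
  by apply/(cov_leq (i := 1))/cov1/sal1; rewrite ?(eqP s1).
have [s2|s2] := eqVneq (sal A) 2.
  have [||cA|] := @c5_or_cover A; rewrite ?s2 //; first lia.
  have /card_gt0P[x0 _] : 0 < #|A| by have := sal_card A; lia.
  case/(_ x0)=> s [sz us _] sA; exfalso.
  suff: 5 <= #|A| by case: h => [|//]; lia.
  by rewrite -sz -(card_uniqP us); apply/subset_leq_card/subsetP.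
have [/eqP s3|s3] := eqVneq (sal A) 3.
  have /card_gt0P[x0 x0A] : 0 < #|A| by have := sal_card A; lia.
  have sA : {subset enum A <= A} by move=> x; rewrite mem_enum.
  have As : {subset A <= enum A} by move=> x; rewrite mem_enum.
  rewrite (eqP s3); apply: (cover_by_cases x0A sA As _ _ _ _ check_sal3_5) => //.
    by rewrite -cardE.
  by rewrite (eqP s3).
have [A4|A4] := leqP #|A| (sal A); first exact: cov_card.
have [[x [y [xA yA xy]]]|/sal_ge/(_ (subxx A))] := edge_or_stable A; last lia.
(* The values 0 to 3 are done and the stability number is less than the size, so [A] has five
   vertices; one edge and three singletons cover it. *)
have -> : sal A = 4 by lia.
apply: (covI (clique2 (adj_cadj xy))); apply: cov_card.
have := cardsD A [set x; y]; rewrite (setIidPr _) ?cards2 ?(adj_neq xy); first lia.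
by rewrite subUset !sub1set xA.
Qed.

Lemma c5_cadj x0 s i j : is_c5 x0 s -> i < 5 -> j < 5 ->
  cadj (nth x0 s i) (nth x0 s j) = (i == j) || c5 i j.
Proof. by case=> sz us h i5 j5; rewrite /cadj h // nth_uniq ?sz. Qed.

(** Remove a 4-clique if there are at least nine vertices, an edge if there are four to eight. At
    most six vertices remain, which two cliques cover unless they contain a 5-cycle; the 5-cycle,
    one extra vertex and the removed clique start the tree. *)
Lemma cover_sal2 A : #|A| <= 10 -> sal A <= 2 -> cov 3 A.
Proof.
move=> A10 A2.
have [[a [b [c [d [sQ pQ cQ]]]]]|A2'] : (exists a b c d : G, let Q := [:: a; b; c; d] in
    [/\ {subset Q <= A}, pairwise (@cadj G) Q & #|A :\: [set x in Q]| <= 6]) \/ #|A| <= 3.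
- have [A9|A9] := leqP 9 #|A|.
    have [K [sKA hK K4]] := ramsey34_compl A2 A9; left.
    have uK := enum_uniq K; have sK := K4; rewrite cardE in sK.
    have mK x : x \in enum K = (x \in K) by rewrite mem_enum.
    case: (enum K) uK sK mK => [|a [|b [|c [|d []]]]] //= uK _ mK.
    have inK x : x \in [:: a; b; c; d] -> x \in K by rewrite mK.
    exists a, b, c, d; split.
    + by move=> x /inK /(subsetP sKA).
    + by move/cliqueP: hK => hK; rewrite /= !hK // inK // !inE eqxx ?orbT.
    + have -> : [set x in [:: a; b; c; d]] = K by apply/setP=> x; rewrite inE mK.
      by rewrite cardsD (setIidPr sKA) K4; lia.
  have [[x [y [xA yA xy]]]|/sal_ge/(_ (subxx A)) ?] := edge_or_stable A; last by right; lia.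
  (* An edge is written as a 4-clique with repeated entries, so that both cases share one tree. *)
  left; exists x, x, x, y; split.
    + by move=> z; rewrite !inE => /or4P[]/eqP->.
    + by rewrite /= !cadjxx adj_cadj.
    + have -> : [set z in [:: x; x; x; y]] = [set x; y].
        by apply/setP=> z; rewrite !inE; case: (z == x); rewrite ?orbT.
      rewrite cardsD (setIidPr _) ?cards2 ?(adj_neq xy) ?subUset ?sub1set ?xA //; lia.
- set Q := [set x in [:: a; b; c; d]] in cQ.
  have hQ : clique Q.
    apply/cliqueP => x y; rewrite !inE => xQ yQ.
    have [->|nxy] := eqVneq x y; first exact: cadjxx.
    by apply: (pairwise_sym (@cadj_sym G) pQ _ _ nxy); rewrite !inE.
  have sR := subsetDl A Q; have R2 := leq_trans (sal_sub sR) A2.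
  have [cR|/(_ a)[s hs sRs]] := c5_or_cover cQ R2; first exact: covI hQ cR.
  have [sz us _] := hs.
  have [u [uA hu]] : exists u, u \in A /\ {subset A :\: Q <= u :: s}.
    have cD : #|(A :\: Q) :\: [set x in s]| <= 1.
      rewrite cardsD (setIidPr _); last by apply/subsetP => x; rewrite inE => /sRs.
      by rewrite [X in _ - X]cardsE (card_uniqP us) sz leq_subLR.
    have [D0|[u uD]] := set_0Vmem ((A :\: Q) :\: [set x in s]).
      (* When the 5-cycle exhausts the remainder, the extra label is filled with a vertex of the
         removed clique. *)
      exists a; split; first by apply: sQ; rewrite mem_head.
      move=> x xR; rewrite inE; apply/orP; right; move/setP: D0 => /(_ x).
      by rewrite in_setD xR andbT in_set0 in_set => /negbFE.
    exists u; split; first by move: uD; rewrite !inE => /and3P[].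
    move=> x xR; rewrite inE; case: (boolP (x \in s)) => [|xs]; rewrite ?orbT ?orbF //.
    apply: contraTT cD => nxu; rewrite -ltnNge; apply/card_gt1P; exists x, u.
    by rewrite uD in_setD xR inE xs.
  apply: (@cover_by_cases a (s ++ u :: [:: a; b; c; d]) A 10 2 3 start_sal2 tree_sal2 _ _ _ _ _ _ _ check_sal2) => //.
  + by apply: sQ; rewrite mem_head.
  + by move=> x; rewrite mem_cat in_cons => /or3P[/sRs/(subsetP sR)//|/eqP->//|/sQ].
  + move=> x xA; rewrite mem_cat in_cons; case: (boolP (x \in Q)); rewrite inE => xQ.
      by rewrite xQ !orbT.
    have := hu x; rewrite in_setD xA inE xQ => /(_ isT).
    by rewrite in_cons orbA orbC => /orP[->|->]; rewrite ?orbT.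
  + by rewrite size_cat sz.
  + have h := fun i j i5 j5 => c5_cadj (i := i) (j := j) hs i5 j5.
    case: s sz us sRs hs hu h => [|x0 [|x1 [|x2 [|x3 [|x4 []]]]]] //= _ _ _ _ _ h.
    move: pQ; rewrite /= !andbT -!andbA => /and5P[ab ac ad bc /andP[bd cd]].
    rewrite /holds /lab /= ab ac ad bc bd cd.
    have /= -> := h 0 1 isT isT; have /= -> := h 1 2 isT isT; have /= -> := h 2 3 isT isT.
    have /= -> := h 3 4 isT isT; have /= -> := h 4 0 isT isT; have /= -> := h 0 2 isT isT.
    have /= -> := h 1 3 isT isT; have /= -> := h 2 4 isT isT; have /= -> := h 3 0 isT isT.
    by have /= -> := h 4 1 isT isT.
- exact: cov_card.
Qed.

End SmallCovers.

(** * Distinct representatives for two and three sets *)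

Section DistinctRepresentatives.
Variable T : finType.
Implicit Types P Q R : {set T}.

Lemma sdr2 P Q : P != set0 -> Q != set0 ->
  (exists s, P = [set s] /\ Q = [set s]) \/
  (exists p q, [/\ p \in P, q \in Q & p != q]).
Proof.
case/set0Pn=> p pP /set0Pn[q qQ].
have [e|npq] := eqVneq p q; last by right; exists p, q.
have [hP|/subsetPn[p' p'P]] := boolP (P \subset [set p]); last first.
  by rewrite inE => np'; right; exists p', q; split=> //; rewrite -e.
have [hQ|/subsetPn[q' q'Q]] := boolP (Q \subset [set p]); last first.
  by rewrite inE => nq'; right; exists p, q'; split=> //; rewrite eq_sym.
by left; exists p; split; apply/eqP; rewrite eqEsubset ?hP ?hQ sub1set ?pP // e.
Qed.

(** Take distinct [q] and [r] representing [Q] and [R], and a third element [s] of the union. If [s]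
    lies in [P] it completes them; otherwise it is a spare representative of [Q] or [R], which frees
    [q] or [r] when [P] needs it. *)
Lemma sdr3 P Q R : 3 <= #|P :|: Q :|: R| ->
  (exists p q, [/\ p \in P, q \in Q & p != q]) ->
  (exists p r, [/\ p \in P, r \in R & p != r]) ->
  (exists q r, [/\ q \in Q, r \in R & q != r]) ->
  exists p q r, [/\ p \in P, q \in Q, r \in R & [/\ p != q, p != r & q != r]].
Proof.
have main P1 Q1 R1 q r s :
    (exists p r, [/\ p \in P1, r \in R1 & p != r]) ->
    q \in Q1 -> r \in R1 -> s \in Q1 -> q != r -> s != q -> s != r ->
    exists p q r, [/\ p \in P1, q \in Q1, r \in R1 & [/\ p != q, p != r & q != r]].
  case=> p [t [pP tR npt]] qQ rR sQ nqr nsq nsr.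
  have [epr|npr] := eqVneq p r.
    have [eqt|nqt] := eqVneq q t.
      by exists p, s, t; split=> //; split=> //; [rewrite epr eq_sym | rewrite -eqt].
    by exists p, q, t; split=> //; split=> //; rewrite epr eq_sym.
  have [epq|npq] := eqVneq p q.
    by exists p, s, r; split=> //; split=> //; rewrite epq eq_sym.
  by exists p, q, r.
move=> c3 hPQ hPR [q [r [qQ rR nqr]]].
have /subsetPn[s] : ~~ (P :|: Q :|: R \subset [set q; r]).
  by apply/negP => /subset_leq_card; rewrite cards2 nqr; lia.
rewrite !inE negb_or => sPQR /andP[nsq nsr].
case/orP: sPQR => [/orP[sP|sQ]|sR].
- by exists s, q, r.
- exact: (main P Q R q r s).
have nrq : r != q by rewrite eq_sym.
have [p [r' [q' [pP rR' qQ' [h1 h2 h3]]]]] := main P R Q r q s hPQ rR qQ sR nrq nsr nsq.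
by exists p, q', r'; split=> //; split=> //; rewrite eq_sym.
Qed.

End DistinctRepresentatives.

(** * Clique covers from a maximum stable set *)

Section Hall.
Variable G : sgraph.
Implicit Types (A B K S T : {set G}) (x y z : G).

Lemma nbh_max_stable B S x : stable S -> S \subset B -> #|S| = sal B ->
  x \in B :\: S -> nbh S x != set0.
Proof.
move=> hS sSB eS; rewrite inE => /andP[xS xB]; apply/eqP => n0.
have : sal S < sal B.
  apply: (sal_add xB sSB xS) => y yS; apply/negP => xy.
  by move/setP: n0 => /(_ y); rewrite !inE yS xy.
by rewrite -eS ltnNge sal_ge.
Qed.

(** If [x] and [y] were not adjacent, exchanging [s] for both of them would enlarge the maximum
    stable set [S]. *)
Lemma common_private_nbr B S x y s : stable S -> S \subset B -> #|S| = sal B ->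
  x \in B :\: S -> y \in B :\: S -> x != y ->
  nbh S x = [set s] -> nbh S y = [set s] -> clique [set x; y; s].
Proof.
move=> hS sSB eS; rewrite !inE => /andP[xS xB] /andP[yS yB] nxy nx ny.
have inx z : z \in S -> adj x z = (z == s).
  by move=> zS; move/setP: nx => /(_ z); rewrite !inE zS.
have iny z : z \in S -> adj y z = (z == s).
  by move=> zS; move/setP: ny => /(_ z); rewrite !inE zS.
have sS : s \in S by move/setP: nx => /(_ s); rewrite !inE eqxx => /andP[].
have xy : adj x y.
  apply: contraTT isT => nadj.
  have : #|[set x; y] :|: S :\ s| <= sal B.
    apply: sal_ge; last first.
      by rewrite !subUset !sub1set xB yB (subset_trans (subsetDl _ _)).
    apply: stableU; last first.
    - move=> u v; rewrite !inE => /orP[]/eqP-> /andP[nvs vS]; first by rewrite inx.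
      by rewrite iny.
    - exact: stable_sub (subsetDl _ _) hS.
    - apply/stableP=> u v; rewrite !inE => /orP[]/eqP-> /orP[]/eqP->; rewrite ?adj_irrefl //.
      by rewrite adj_sym.
  rewrite cardsU disjoint_setI0 ?cards0 ?cards2 ?nxy -?eS ?(cardsD1 s S) ?sS; last first.
    rewrite -setI_eq0; apply/eqP/setP=> u; rewrite !inE; apply: contraNF xS => /and3P[].
    by case/orP=> /eqP-> // _ yS'; rewrite yS' in yS.
  by lia.
apply/cliqueP => u v; rewrite !inE -!orbA.
have [xs ys] : adj x s /\ adj y s by rewrite inx // iny // eqxx.
by case/or3P=> /eqP-> /or3P[]/eqP->; rewrite ?cadjxx ?adj_cadj // adj_sym.
Qed.

(** Each element of [S] gives one clique: together with its partner if it is matched, alone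
    otherwise. The partners account for all of [B] outside [S]. *)
Lemma cover_matching B S (l : seq (G * G)) :
  uniq (unzip2 l) -> {subset unzip2 l <= S} -> all (fun t => adj t.1 t.2) l ->
  {subset B <= S :|: [set x in unzip1 l]} -> cov #|S| B.
Proof.
elim: l B S => [|[x s] l IH] B S /=.
  move=> _ _ _ sX; apply: cov_card; apply/subset_leq_card/subsetP => u /sX.
  by rewrite !inE orbF.
move=> /andP[sl ul] lS /andP[xs al] sX; rewrite (cardsD1 s S) lS ?mem_head //.
apply: (covI (clique2 (adj_cadj xs))); apply: IH => //.
  move=> u ul'; rewrite !inE lS ?in_cons ?ul' ?orbT // andbT.
  by apply: contraNneq sl => <-.
move=> u; rewrite !inE negb_or => /andP[/andP[nux nus] /sX].
by rewrite !inE nus (negbTE nux).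
Qed.

(* Hall's theorem for at most three vertices outside a maximum stable set;
   the only obstruction, two adjacent vertices with the same single neighbour,
   is a triangle. *)
Lemma cover_max_stable B S : stable S -> S \subset B -> #|S| = sal B ->
  #|B :\: S| <= 3 -> 3 <= #|S| ->
  (forall s, s \in S -> exists2 x, x \in B :\: S & adj s x) -> cov #|S| B.
Proof.
move=> hS sSB eS X3 S3 nbr.
have n0 x : x \in B :\: S -> nbh S x != set0 := @nbh_max_stable B S x hS sSB eS.
have mX x : x \in enum (B :\: S) = (x \in B :\: S) by rewrite mem_enum.
have uX := enum_uniq (B :\: S); rewrite cardE in X3.
have inB (l : seq G) : {subset enum (B :\: S) <= l} -> {subset B <= S :|: [set x in l]}.
  move=> h u uB; rewrite !inE; case: (boolP (u \in S)) => //= uS.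
  by apply: h; rewrite mX inE uS.
have nS u s : s \in nbh S u -> s \in S /\ adj u s by rewrite inE => /andP[].
have private x y s : x \in B :\: S -> y \in B :\: S -> x != y ->
    nbh S x = [set s] -> nbh S y = [set s] ->
    cov #|S :\ s| (B :\: [set x; y; s]) -> cov #|S| B.
  move=> xB yB nxy nx ny; rewrite (cardsD1 s S).
  have [|-> _] := nS x s; first by rewrite nx inE.
  exact: covI (common_private_nbr hS sSB eS xB yB nxy nx ny).
case E: (enum (B :\: S)) mX uX X3 inB => [|x [|y [|z []]]] //= mX uX _ inB.
- by apply: (@cover_matching _ _ [::]) => //; apply: inB.
- have /set0Pn[s /nS[sS xs]] : nbh S x != set0 by rewrite n0 // -mX mem_head.
  apply: (@cover_matching _ _ [:: (x, s)]) => //=; rewrite ?xs //; last exact: inB.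
  by move=> u; rewrite inE => /eqP->.
- have xB : x \in B :\: S by rewrite -mX mem_head.
  have yB : y \in B :\: S by rewrite -mX !inE eqxx orbT.
  have nxy : x != y by move: uX; rewrite inE andbT.
  have [[s [nx ny]]|[s [t [/nS[sS xs] /nS[tS yt] nst]]]] := sdr2 (n0 _ xB) (n0 _ yB).
    apply: (private x y s) => //; apply: cov_card; apply/subset_leq_card/subsetP => u.
    rewrite !inE !negb_or => /andP[/andP[/andP[nux nuy] nus] uB]; rewrite nus.
    by have := inB [:: x; y] (fun _ h => h) u uB; rewrite !inE (negbTE nux) (negbTE nuy) /= orbF.
  apply: (@cover_matching _ _ [:: (x, s); (y, t)]) => /=; rewrite ?inE ?andbT ?xs ?yt //.
  + by move=> u; rewrite !inE => /orP[]/eqP->.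
  + exact: inB.
have xB : x \in B :\: S by rewrite -mX mem_head.
have yB : y \in B :\: S by rewrite -mX !inE eqxx orbT.
have zB : z \in B :\: S by rewrite -mX !inE eqxx !orbT.
have [nxy nxz nyz] : [/\ x != y, x != z & y != z].
  by move: uX; rewrite !inE negb_or andbT => /andP[/andP[]].
(* If [a] and [b] share their single neighbour [s], every other element of [S] must have [c] as its
   outside neighbour. The triangle on [a], [b], [s] and an edge from [c] to any such element then
   complete the cover. *)
have private3 a b c s : a \in B :\: S -> b \in B :\: S -> a != b ->
    {subset enum (B :\: S) <= [:: a; b; c]} ->
    nbh S a = [set s] -> nbh S b = [set s] -> cov #|S| B.
  move=> aB bB nab sub na nb; apply: (private a b s) => //.
  have [s' s'S ns] : exists2 s', s' \in S & s' != s.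
    have /card_gt1P[u [v [uS vS nuv]]] : 1 < #|S| := ltnW S3.
    have [eus|] := eqVneq u s; last by exists u.
    by exists v => //; rewrite -eus eq_sym.
  have adjc : adj c s'.
    have [w wX aw] := nbr s' s'S; have := sub w; rewrite mem_enum wX !inE => /(_ isT).
    have nadj v : nbh S v = [set s] -> adj s' v = false.
      by move=> nv; apply: contraNF ns => av; rewrite -in_set1 -nv inE s'S adj_sym.
    by case/or3P=> /eqP ew; move: aw; rewrite ew ?(nadj _ na) ?(nadj _ nb) // adj_sym.
  apply: (@cover_matching _ _ [:: (c, s')]) => //=; rewrite ?adjc //.
    by move=> u; rewrite !inE => /eqP->; rewrite ns.
  move=> u; rewrite !inE !negb_or => /andP[/andP[/andP[nua nub] nus] uB]; rewrite nus /=.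
  case: (boolP (u \in S)) => //= uS; have := sub u.
  by rewrite mem_enum !inE uS uB (negbTE nua) (negbTE nub) => /(_ isT).
have sxyz : {subset enum (B :\: S) <= [:: x; y; z]} by rewrite E.
have [[s [nx ny]]|hxy] := sdr2 (n0 _ xB) (n0 _ yB); first exact: (private3 x y z s).
have [[s [nx nz]]|hxz] := sdr2 (n0 _ xB) (n0 _ zB).
  apply: (private3 x z y s) => // u /sxyz; rewrite !inE.
  by case/or3P=> ->; rewrite ?orbT.
have [[s [ny nz]]|hyz] := sdr2 (n0 _ yB) (n0 _ zB).
  apply: (private3 y z x s) => // u /sxyz; rewrite !inE.
  by case/or3P=> ->; rewrite ?orbT.
(* Every element of [S] has a neighbour outside, so the three neighbourhoods have union [S], which
   has at least three elements. *)
have [|s [t [r [/nS[sS xs] /nS[tS yt] /nS[rS zr] [nst nsr ntr]]]]] := sdr3 _ hxy hxz hyz.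
  apply: leq_trans S3 _; apply/subset_leq_card/subsetP => s sS.
  have [w wX sw] := nbr s sS; have := sxyz w; rewrite mem_enum wX !inE sS => /(_ isT).
  by case/or3P=> /eqP<-; rewrite ?(adj_sym _ s) sw ?orbT.
apply: (@cover_matching _ _ [:: (x, s); (y, t); (z, r)]) => /=.
- by rewrite !inE negb_or nst nsr ntr.
- by move=> u; rewrite !inE => /or3P[]/eqP->.
- by rewrite xs yt zr.
- exact: inB.
Qed.

(** If removing [T] lowers the stability number, the induction hypothesis applies. Otherwise a
    maximum stable set [S] of the rest leaves at most three vertices outside, and Hall's theorem
    covers the rest unless some [w] in [S] has no neighbour there. Then all neighbours of [w] lie in
    the clique [T], so [w] is simplicial and its closed neighbourhood is removed instead. *)
Lemma cover_remove_clique A T : clique T -> T \subset A -> T != set0 ->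
  #|A :\: T| <= sal A + 3 -> 3 <= sal A ->
  (forall B, B \proper A -> sal B < sal A -> cov (sal A) B) ->
  cov (sal A).+1 A.
Proof.
move=> hT sTA T0 cA k3 IH.
have pA : A :\: T \proper A.
  rewrite properEneq subsetDl andbT; apply: contra_neq T0 => e.
  by apply/eqP; rewrite -subset0; apply/subsetP => x xT; have := subsetP sTA x xT; rewrite -e inE xT.
have := sal_sub (subsetDl A T); rewrite leq_eqVlt => /orP[/eqP e|lt]; last first.
  exact: covI hT (IH _ pA lt).
have [S [hS sSB eS]] := salP (A :\: T).
have [h|] := boolP [forall s in S, [exists x in (A :\: T) :\: S, adj s x]].
  apply: (covI hT); rewrite -e -eS; apply: cover_max_stable => //.
  - by rewrite cardsD (setIidPr sSB) eS e leq_subLR.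
  - by rewrite eS e.
  - by move=> s sS; apply/exists_inP; apply: (forall_inP h).
case/forall_inPn=> w wS /exists_inPn nw.
have wA : w \in A by have := subsetP sSB w wS; rewrite inE => /andP[].
apply: (cov_simplicial wA) => [|B sBA lt]; last first.
  by apply: IH => //; rewrite properEneq sBA andbT; apply: contraTneq lt => ->; rewrite ltnn.
have inT x : x \in A -> cadj w x -> x = w \/ x \in T.
  move=> xA; rewrite /cadj => /orP[/eqP->|wx]; [by left | right].
  apply: contraT => xT; have xS : x \notin S.
    by apply: contraL wx => xS; move/stableP: hS; apply.
  by have := nw x; rewrite !inE xS xT xA wx => /(_ isT).
apply/cliqueP => x y; rewrite !inE => /andP[xA wx] /andP[yA wy].
have [ex|xT] := inT x xA wx; first by rewrite ex.
have [ey|yT] := inT y yA wy; first by rewrite ey cadj_sym.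
by move/cliqueP: hT; apply.
Qed.

End Hall.

(** * Gallai's lemma *)

Section Gallai.
Variable G : sgraph.
Implicit Types (A B K S T : {set G}) (x y z t u v : G) (m : {ffun G -> G}).

(* A matching of the subgraph induced by A, as an involution. *)
Definition matching A m :=
  [forall x, (m (m x) == x) && ((m x != x) ==> adj x (m x) && (x \in A))].

Definition unmatched A m := [set x in A | m x == x].

Lemma matchingP A m : reflect ((forall x, m (m x) = x) /\
  (forall x, m x != x -> adj x (m x) /\ x \in A)) (matching A m).
Proof.
apply: (iffP forallP) => [h|[h1 h2] x].
  by split=> x; have /andP[/eqP h1 /implyP h2] := h x => // /h2 /andP.
by rewrite h1 eqxx; apply/implyP => /h2[-> ->].
Qed.

(** The left-hand side is twice the number of edges and unmatched vertices together. Being even, it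
    may be bounded by 2j + 1 instead of 2j. *)
Lemma matching_cov A m j : matching A m ->
  #|A| + #|unmatched A m| <= (2 * j).+1 -> cov j A.
Proof.
elim: j A m => [|j IH] A m mA hA.
  have [//|[x xA]] := set_0Vmem A; exfalso.
  have [mm mad] := matchingP _ _ mA.
  have [e|ne] := eqVneq (m x) x.
    have : 0 < #|unmatched A m| by apply/card_gt0P; exists x; rewrite inE xA e eqxx.
    have : 0 < #|A| by apply/card_gt0P; exists x.
    lia.
  suff : 1 < #|A| by lia.
  apply/card_gt1P; exists x, (m x); rewrite xA eq_sym ne; split=> //.
  by have [] := mad (m x); rewrite // mm eq_sym.
have [mm mad] := matchingP _ _ mA.
have [/existsP[x ne]|h] := boolP [exists x, m x != x]; last first.
  apply: cov_card; suff e : unmatched A m = A by move: hA; rewrite e; lia.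
  apply/setP => x; rewrite inE andb_idr // => _.
  by move/existsPn: h => /(_ x); rewrite negbK.
have [xy xA] := mad x ne.
have yA : m x \in A by have [] := mad (m x); rewrite // mm eq_sym.
set y := m x in ne xy yA.
have my : m y = x by rewrite /y mm.
apply: (covI (clique2 (adj_cadj xy))).
pose m' := [ffun w => if (w == x) || (w == y) then w else m w].
apply: (IH _ m').
  apply/matchingP; split=> w; rewrite !ffunE.
    have [->|nx] := eqVneq w x; first by rewrite /= eqxx.
    have [->|ny] := eqVneq w y; first by rewrite /= eqxx orbT.
    by rewrite /= (can2_eq mm mm) -/y (negbTE ny) (can2_eq mm mm) my (negbTE nx) /=.
  case: ifP => [|/norP[nx ny] /mad[-> wA]]; first by rewrite eqxx.
  by rewrite !inE wA negb_or nx ny.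
have eu : unmatched (A :\: [set x; y]) m' = unmatched A m.
  apply/setP => w; rewrite !inE ffunE negb_or.
  have [->|nx] := eqVneq w x; first by rewrite /= -/y (negbTE ne) andbF.
  have [->|ny] := eqVneq w y; first by rewrite /= my eq_sym (negbTE ne) andbF.
  by rewrite /=.
rewrite eu cardsD (setIidPr _) ?cards2; last by rewrite subUset !sub1set xA.
have : 1 < #|A| by apply/card_gt1P; exists y, x.
by rewrite eq_sym ne; move: hA; rewrite mulnS; lia.
Qed.

(** Cliques have at most two vertices in [A]. One that has exactly two among those still uncovered
    becomes an edge; any other adds at most one unmatched vertex. *)
Lemma cov_matching A j : tfree A -> cov j A ->
  exists2 m, matching A m & #|A| + #|unmatched A m| <= 2 * j.
Proof.
elim: j A => [|j IH] A tA /=.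
  move=> ->; exists [ffun x => x]; last first.
    by rewrite (_ : unmatched _ _ = set0) ?cards0 //; apply/setP => x; rewrite !inE.
  by apply/matchingP; split=> x; rewrite !ffunE ?eqxx.
case=> K hK cA; have [m mA hm] := IH _ (tfree_sub (subsetDl A K) tA) cA.
have [mm mad] := matchingP _ _ mA.
have fixK x : x \in K -> m x = x.
  by move=> xK; apply: contraTeq isT => /mad[_]; rewrite inE xK.
have K2 : #|A :&: K| <= 2.
  by apply: tfree_clique tA (subsetIl _ _) (clique_sub (subsetIr _ _) hK).
have eA := cardsID K A.
have [c2|c1] := eqVneq #|A :&: K| 2; last first.
  exists m; first by apply/matchingP; split=> // x /mad[-> ]; rewrite inE => /andP[].
  suff: #|unmatched A m| <= #|A :&: K| + #|unmatched (A :\: K) m| by lia.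
  apply: leq_trans (leq_card_setU _ _); apply/subset_leq_card/subsetP => x.
  by rewrite !inE => /andP[-> ->]; rewrite !andbT orbN.
have /cards2P[x [y [nxy eK]]] : #|A :&: K| == 2 by apply/eqP.
have [xA xK] : x \in A /\ x \in K.
  by apply/andP; rewrite -in_setI eK !inE eqxx.
have [yA yK] : y \in A /\ y \in K.
  by apply/andP; rewrite -in_setI eK !inE eqxx orbT.
have xy : adj x y by move/cliqueP: hK => /(_ x y xK yK); rewrite /cadj (negbTE nxy).
have nyx : y != x by rewrite eq_sym.
pose m' := [ffun w => if w == x then y else if w == y then x else m w].
exists m'.
  apply/matchingP; split=> w; rewrite !ffunE.
    have [->|nwx] := eqVneq w x; first by rewrite eqxx (negbTE nyx).
    have [->|nwy] := eqVneq w y; first by rewrite eqxx.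
    by rewrite !(can2_eq mm mm) (fixK x xK) (fixK y yK) (negbTE nwx) (negbTE nwy).
  have [->|nwx] := eqVneq w x; first by rewrite xy xA.
  have [->|nwy] := eqVneq w y; first by rewrite adj_sym xy yA.
  by case/mad=> ->; rewrite inE => /andP[].
have eu : unmatched A m' \subset unmatched (A :\: K) m.
  apply/subsetP => w; rewrite !inE ffunE => /andP[wA].
  have [->|nwx] := eqVneq w x; first by rewrite (negbTE nyx).
  have [->|nwy] := eqVneq w y; first by rewrite (negbTE nxy).
  move=> ->; rewrite wA !andbT; apply/negP => wK.
  have : w \in A :&: K by rewrite inE wA.
  by rewrite eK !inE (negbTE nwx) (negbTE nwy).
by have := subset_leq_card eu; move: hm; rewrite -eA c2; clear; lia.
Qed.

Section Exchange.
Variables (A : {set G}) (c : nat).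
Hypothesis min_unmatched : forall m, matching A m -> c <= #|unmatched A m|.

(** The edge from [x] to [y] replaces the edge at [y], whose other end is released. If [y] was
    unmatched, the edge is simply added. *)
Definition rematch m x y :=
  [ffun w => if w == x then y else if w == y then x else
             if w == m y then m y else m w].

Lemma rematch_matching m x y : matching A m -> x \in unmatched A m -> y \in A ->
  adj x y -> matching A (rematch m x y).
Proof.
move=> mA; rewrite inE => /andP[xA /eqP mx] yA xy.
have [mm mad] := matchingP _ _ mA.
have nxy := adj_neq xy; have nyx : y != x by rewrite eq_sym.
have nzx : m y != x by rewrite (can2_eq mm mm) mx.
apply/matchingP; split=> w; rewrite !ffunE.
  have [->|nwx] := eqVneq w x; first by rewrite eqxx (negbTE nyx).
  have [->|nwy] := eqVneq w y; first by rewrite eqxx.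
  have [e|nwz] := eqVneq w (m y).
    by rewrite -e (negbTE nwx) (negbTE nwy) eqxx.
  rewrite (can2_eq mm mm) mx (negbTE nwx) (can2_eq mm mm) (negbTE nwz).
  by rewrite (inj_eq (can_inj mm)) (negbTE nwy).
have [->|nwx] := eqVneq w x; first by rewrite xy xA.
have [->|nwy] := eqVneq w y; first by rewrite adj_sym xy yA.
by have [->|nwz] := eqVneq w (m y); [rewrite eqxx | exact: mad].
Qed.

(** Since no matching leaves fewer than [c] vertices unmatched, the matching here is a maximum
    one. *)
Definition miss2 u v := [exists m, [&& matching A m, #|unmatched A m| <= c,
  u \in unmatched A m & v \in unmatched A m]].

Lemma adj_miss2 u v : adj u v -> ~~ miss2 u v.
Proof.
move=> uv; apply/existsPn=> m; apply/negP => /and4P[mA hc uF vF].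
have vA : v \in A by move: vF; rewrite inE => /andP[].
have mv : m v = v by move: vF; rewrite inE => /andP[_ /eqP].
have := min_unmatched (rematch_matching mA uF vA uv).
apply/negP; rewrite -ltnNge; apply: leq_trans hc; apply: proper_card.
apply/properP; split; last first.
  by exists u => //; rewrite inE ffunE eqxx eq_sym (negbTE (adj_neq uv)) andbF.
apply/subsetP => w; rewrite !inE !ffunE mv => /andP[->] /=.
have [->|nwx] := eqVneq w u; first by rewrite eq_sym (negbTE (adj_neq uv)).
by have [->|nwy] := eqVneq w v; first by rewrite (negbTE (adj_neq uv)).
Qed.

(** This makes the relation of not being missed together transitive, by induction on the number of
    vertices where [M] and [N] differ. Some [x] other than [t] is missed by [N] but matched by [M],
    to [y] say, and [N] must match [y]. Putting the edge from [x] to [y] into [N] keeps it maximum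
    and missing [t], and brings it closer to [M]. *)
Lemma exchange n M N u v t : matching A M -> matching A N ->
  #|unmatched A M| <= c -> #|unmatched A N| <= c ->
  u \in unmatched A M -> v \in unmatched A M -> u != v -> t \in unmatched A N ->
  ~~ miss2 u t -> ~~ miss2 t v -> #|[set w | M w != N w]| <= n -> False.
Proof.
elim: n N => [|n IH] N mM mN hM hN uM vM nuv tN nut ntv.
all: have uN : u \notin unmatched A N by
  apply: contra nut => uN; apply/existsP; exists N; rewrite mN hN uN tN.
all: have vN : v \notin unmatched A N by
  apply: contra ntv => vN; apply/existsP; exists N; rewrite mN hN vN tN.
  rewrite leqn0 cards_eq0 => /eqP/setP/(_ u); rewrite !inE => /negbFE/eqP e.
  by move: uM uN; rewrite !inE e => ->.
move=> hn; have [mm mad] := matchingP _ _ mM; have [nn nad] := matchingP _ _ mN.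
(* Both matchings miss exactly [c] vertices, and [u] and [v] are missed by [M] only. Hence [N] alone
   misses at least two vertices, one of which differs from [t]. *)
have [x xN ntx] : exists2 x, x \in unmatched A N :\: unmatched A M & x != t.
  have : 2 <= #|unmatched A N :\: unmatched A M|.
    have e1 := cardsID (unmatched A M) (unmatched A N).
    have e2 := cardsID (unmatched A N) (unmatched A M).
    have : 2 <= #|unmatched A M :\: unmatched A N|.
      by apply/card_gt1P; exists u, v; rewrite 2!in_setD uM vM uN vN.
    rewrite setIC in e2; move: (min_unmatched mM) (min_unmatched mN) hM hN e1 e2.
    by clear; lia.
  case/card_gt1P=> x [y [xD yD nxy]]; have [e|] := eqVneq x t; last by exists x.
  by exists y => //; rewrite -e eq_sym.
move: xN; rewrite inE => /andP[xM xN].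
have [xA Nx] : x \in A /\ N x = x by move: xN; rewrite inE => /andP[? /eqP].
have Mx : M x != x by apply: contra xM => Mx; rewrite inE xA.
have [xy _] := mad x Mx; set y := M x in xy Mx.
have My : M y = x by rewrite /y mm.
have yA : y \in A by have [] := mad y; rewrite // My eq_sym.
have yN : y \notin unmatched A N.
  apply/negP=> yN; have /negP := adj_miss2 xy; apply.
  by apply/existsP; exists N; rewrite mN hN xN yN.
have Ny : N y != y by apply: contra yN => Ny; rewrite inE yA.
have mN' := rematch_matching mN xN yA xy.
set N' := rematch N x y in mN'.
have zA : N y \in A by have [] := nad (N y); rewrite // nn eq_sym.
have nzx : N y != x by rewrite (can2_eq nn nn) Nx.
apply: (IH N') => //.
- apply: leq_trans hN; rewrite (cardsD1 x (unmatched A N)) xN.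
  apply: (@leq_trans #|N y |: (unmatched A N :\ x)|); last first.
    by rewrite cardsU1; case: (_ \notin _).
  apply/subset_leq_card/subsetP => w; rewrite !inE ffunE => /andP[wA].
  have [->|nwx] := eqVneq w x; first by rewrite (negbTE Mx).
  have [->|nwy] := eqVneq w y; first by rewrite eq_sym (negbTE Mx).
  by have [//|nwz] := eqVneq w (N y); rewrite wA.
- have nty : t != y by apply: contraNneq yN => <-.
  have ntz : t != N y.
    by apply: contraTneq tN => ->; rewrite inE nn eq_sym (negbTE Ny) andbF.
  have ntx' : t != x by rewrite eq_sym.
  by move: tN; rewrite !inE ffunE (negbTE ntx') (negbTE nty) (negbTE ntz).
rewrite -ltnS; apply: leq_trans hn; apply: proper_card; apply/properP; split; last first.
  by exists x; rewrite !inE ?ffunE ?Nx // eqxx negbK.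
apply/subsetP => w; rewrite !inE ffunE.
have [->|nwx] := eqVneq w x; first by rewrite eqxx.
have [->|nwy] := eqVneq w y; first by rewrite My eqxx.
have [->|//] := eqVneq w (N y).
by rewrite nn => _; rewrite (can2_eq mm mm) My.
Qed.

End Exchange.

(** Suppose some maximum matching misses both [u] and a further vertex [v]. Not being missed
    together contains adjacency and, by [exchange], is transitive, because every vertex is missed by
    a maximum matching. The class of [u] is then a union of components that avoids [v]. *)
Lemma gallai A j : tfree A -> ~ cov j A ->
  (forall v, v \in A -> cov j (A :\ v)) ->
  2 * j < #|A| \/ exists B, [/\ B != set0, B \proper A &
    forall x y, x \in B -> y \in A :\: B -> ~~ adj x y].
Proof.
move=> tA ncov crit; pose c := (2 * j).+2 - #|A|.
have hmin m : matching A m -> c <= #|unmatched A m|.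
  by move=> mA; rewrite /c leq_subLR ltnNge; apply/negP => /(matching_cov mA).
have hcrit v : v \in A -> exists m, [/\ matching A m, #|unmatched A m| <= c & v \in unmatched A m].
  move=> vA; have [m mA hm] := cov_matching (tfree_sub (subsetDl A _) tA) (crit v vA).
  have [mm mad] := matchingP _ _ mA.
  have mv : m v = v by apply: contraTeq isT => /mad[_]; rewrite !inE eqxx.
  exists m; split.
  - by apply/matchingP; split=> // x /mad[-> ]; rewrite inE => /andP[].
  - have e : unmatched A m = v |: unmatched (A :\ v) m.
      apply/setP => x; rewrite !inE; have [->|//] := eqVneq x v.
      by rewrite vA mv eqxx.
    have := cardsD1 v A; rewrite vA /c e cardsU1 !inE eqxx /=; lia.
  - by rewrite inE vA mv eqxx.
have [c1|c2] := leqP c 1; first by left; rewrite /c in c1; lia.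
right.
have [A0|[u uA]] := set_0Vmem A.
  by case: ncov; rewrite A0; apply: cov_card; rewrite cards0.
have [m0 [mA0 h0 u0]] := hcrit u uA.
have [v vu0 nvu] : exists2 v, v \in unmatched A m0 & v != u.
  have /card_gt1P[x [y [xF yF nxy]]] : 1 < #|unmatched A m0|.
    exact: leq_trans c2 (hmin _ mA0).
  have [e|] := eqVneq x u; last by exists x.
  by exists y => //; rewrite -e eq_sym.
have muv : miss2 A c u v by apply/existsP; exists m0; rewrite mA0 h0 u0 vu0.
exists [set w in A | (w == u) || ~~ miss2 A c u w]; split.
- by apply/set0Pn; exists u; rewrite inE uA eqxx.
- apply/properP; split; first by apply/subsetP => w; rewrite inE => /andP[].
  exists v; first by move: vu0; rewrite inE => /andP[].
  by rewrite inE (negbTE nvu) muv andbF.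
move=> x y; rewrite !inE => /andP[xA hx] /andP[]; rewrite negb_and negb_or negbK.
move=> /orP[/negP//|/andP[nyu muy]] yA; apply/negP => xy.
have [e|nxu] := eqVneq x u.
  by have /negP := adj_miss2 hmin xy; rewrite e.
rewrite (negbTE nxu) /= in hx.
case/existsP: muy => M /and4P[mM hM uM yM].
have [N [mN hN xN]] := hcrit x xA.
apply: (exchange hmin mM mN hM hN uM yM _ xN hx (adj_miss2 hmin xy) (leqnn _)).
by rewrite eq_sym.
Qed.

End Gallai.

(** * Gap at most one, two, three *)

Section Gap1.
Variable G : sgraph.
Implicit Types (A B K S T : {set G}) (x y z : G).

(** [cov] only quantifies over subsets of a finite type, so a boolean reflects it and case
    distinction is constructive. *)
Lemma cov_em j A : cov j A \/ ~ cov j A.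
Proof.
suff [b hb] : exists b : {set G} -> bool, forall B, b B <-> cov j B.
  by case E: (b A); [left; apply/hb | right=> /hb; rewrite E].
elim: j => [|j [b hb]]; first by exists (fun B => B == set0) => B; split=> /eqP.
exists (fun B => [exists K, clique K && b (B :\: K)]) => B.
split=> [/existsP[K /andP[hK /hb]]|[K hK cB]]; first by exists K.
by apply/existsP; exists K; rewrite hK; apply/hb.
Qed.

Lemma cov_clique A : sal A <= 1 -> cov (sal A).+1 A.
Proof. by move/sal1/cov1; apply: cov_leq. Qed.

Lemma cov_split i j A B : B \subset A -> cov i B -> cov j (A :\: B) -> cov (i + j) A.
Proof.
move=> sBA cB cA; apply: cov_sub (covU cB cA).
by apply/subsetP => x xA; rewrite !inE xA andbT orbN.
Qed.

Lemma sal_split A B : B \subset A ->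
  (forall x y, x \in B -> y \in A :\: B -> ~~ adj x y) ->
  sal B + sal (A :\: B) <= sal A.
Proof.
move=> sBA h; apply: leq_trans (sal_disjoint _ h) (sal_sub _).
  by rewrite -setI_eq0 setIDA setDIl setDv set0I.
by rewrite subUset sBA subsetDl.
Qed.

(** A part with at most four vertices has gap 0, so the excess [j] is spent on the other part only,
    and the stability numbers add up. *)
Lemma cov_split_small j A B : B \subset A ->
  (forall x y, x \in B -> y \in A :\: B -> ~~ adj x y) ->
  #|B| <= 4 \/ #|A :\: B| <= 4 ->
  cov (sal B + j) B -> cov (sal (A :\: B) + j) (A :\: B) -> cov (sal A + j) A.
Proof.
move=> sBA h small cB cA; have hs := sal_split sBA h.
case: small => c4.
  have cB' : cov (sal B) B by apply: cover_small; [lia | left; lia].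
  by apply: cov_leq (cov_split sBA cB' cA); lia.
have cA' : cov (sal (A :\: B)) (A :\: B) by apply: cover_small; [lia | left; lia].
by apply: cov_leq (cov_split sBA cB cA'); lia.
Qed.

Lemma proper_split A B : B != set0 -> B \proper A -> A :\: B \proper A.
Proof.
move=> B0 pB; rewrite properEneq subsetDl andbT; apply: contraNneq B0 => e.
apply/eqP/setP => x; rewrite inE; apply/negP => xB.
by have := subsetP (proper_sub pB) x xB; rewrite -e inE xB.
Qed.

(** With stability number at least 3, removing a triangle leaves at most 6 vertices, within the
    reach of [cover_remove_clique]. In a split of at most 9 vertices, one part has at most 4. *)
Lemma cover_9 A : #|A| <= 9 -> cov (sal A).+1 A.
Proof.
have [n] := ubnP #|A|; elim: n A => // n IH A An A9.
have IHp B : B \proper A -> cov (sal B).+1 B.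
  by move=> /proper_card pB; apply: IH; lia.
have [|k1] := leqP (sal A) 1; first exact: cov_clique.
have [k2|k2] := eqVneq (sal A) 2; first by rewrite k2; apply: cover_sal2; lia.
have [tA|[T [sTA hT T3]]] := tfree_or_triangle A; last first.
  apply: (cover_remove_clique hT sTA); first by rewrite -card_gt0 T3.
  - by rewrite cardsD (setIidPr sTA) T3; lia.
  - lia.
  - by move=> B pB lt; apply: cov_leq (IHp B pB).
have [//|nc] := cov_em (sal A).+1 A.
have [v vA|big|[B [B0 pB hB]]] := gallai tA nc.
- apply: cov_leq (IHp _ (properD1 vA)); rewrite ltnS; exact: sal_sub (subsetDl _ _).
(* From 2([sal] + 1) < |A| <= 9 the stability number is at most 3, so R(3,4) gives |A| <= 8, and
   then it is at most 2, a case already settled. *)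
- have A8 : 9 <= #|A| -> 4 <= sal A by apply: ramsey34.
  by exfalso; lia.
have sBA := proper_sub pB.
rewrite -addn1; apply: (@cov_split_small 1 A B sBA hB); rewrite ?addn1.
- by have := cardsID B A; rewrite (setIidPr sBA); lia.
- exact: IHp.
- exact/IHp/proper_split.
Qed.

Definition K4free A := forall K, K \subset A -> clique K -> #|K| <= 3.

Definition intersecting_triangles A := forall T1 T2, T1 \subset A -> T2 \subset A ->
  clique T1 -> clique T2 -> #|T1| = 3 -> #|T2| = 3 -> ~~ [disjoint T1 & T2].

Section Labels.
Variables (x0 : G) (s : seq G) (A : {set G}).
Hypothesis us : uniq s.
Hypothesis sA : {subset s <= A}.

Lemma known_true_clique p l : consistent (lab x0 s) p ->
  pairwise (known true p) l -> {in l, forall k, k < size s} ->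
  let K := [set x in map (nth x0 s) l] in [/\ K \subset A, clique K & #|K| = size l].
Proof.
move=> cp pl ls; split.
- by apply/subsetP => x; rewrite inE => /mapP[i /ls il ->]; apply/sA/mem_nth.
- have pl' : pairwise (@cadj G) (map (nth x0 s) l).
    rewrite pairwise_map; apply: sub_pairwise pl => i j.
    by case/(knownP cp)/andP=> _ /eqP.
  apply/cliqueP => x y; rewrite !inE => xl yl.
  have [->|nxy] := eqVneq x y; first exact: cadjxx.
  exact: (pairwise_sym (@cadj_sym G) pl' xl yl nxy).
- have ul : uniq l.
    rewrite uniq_pairwise; apply: sub_pairwise pl => i j.
    by case/(knownP cp)/andP.
  rewrite cardsE; have /card_uniqP -> : uniq (map (nth x0 s) l); last by rewrite size_map.
  by rewrite map_inj_in_uniq // => i j /ls il /ls jl /eqP; rewrite nth_uniq // => /eqP.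
Qed.

Lemma cover_by_cases_K4free start c : x0 \in A -> {subset A <= s} -> size s = 10 ->
  sal A <= 3 -> K4free A -> all (holds (lab x0 s)) start ->
  checks leaf_K4free_cover start c -> cov 4 A.
Proof.
move=> x0A As szs A3 k4; apply: run_sound; first exact: lab_sym.
move=> p i j b cp; rewrite /leaf_K4free_cover; case: ifP => [/andP[_]|_ h]; last first.
  by apply: (leaf_cover_sound _ _ _ _ _ _ cp h); rewrite ?szs.
case/clique_atP=> l [pl szl ll]; exfalso.
have [|sK hK cK] := known_true_clique cp pl; first by move=> k /ll; rewrite szs.
by have := k4 _ sK hK; rewrite cK szl.
Qed.

Lemma absurd_by_cases start c : x0 \in A -> size s = 10 -> sal A <= 3 -> K4free A ->
  intersecting_triangles A -> all (holds (lab x0 s)) start ->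
  checks leaf_intersecting start c -> False.
Proof.
move=> x0A szs A3 k4 it; apply: run_sound; first exact: lab_sym.
move=> p i j b cp; rewrite /leaf_intersecting; case: b; last first.
  by case/clique_atP=> l [pl szl _]; have := known_false_stable sA x0A cp pl; rewrite szl; lia.
case: ifP => [|_] h.
  case/clique_atP: h => l [pl szl ll] _.
  have [|sK hK cK] := known_true_clique cp pl; first by move=> k /ll; rewrite szs.
  by have := k4 _ sK hK; rewrite cK szl.
case/disjoint_trianglesP: h => l1 [l2 [pl1 pl2 [sz1 sz2] ll dl]].
have [|sK1 hK1 cK1] := known_true_clique cp pl1.
  by move=> k kl; rewrite szs; apply: ll; rewrite mem_cat kl.
have [|sK2 hK2 cK2] := known_true_clique cp pl2.
  by move=> k kl; rewrite szs; apply: ll; rewrite mem_cat kl orbT.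
have := it _ _ sK1 sK2 hK1 hK2; rewrite cK1 cK2 => /(_ sz1 sz2) /negP; apply.
rewrite -setI_eq0; apply/eqP/setP => x; rewrite !inE; apply/negP.
case/andP=> /mapP[k1 k1l ->] /mapP[k2 k2l] /eqP.
rewrite nth_uniq // ?szs ?ll ?mem_cat ?k1l ?k2l ?orbT // => /eqP e.
by have := dl k2 k2l; rewrite -e k1l.
Qed.

End Labels.

End Gap1.

(** * Ten vertices with stability number three: two configurations of triangles *)

Section Sal3.
Variable G : sgraph.
Implicit Types (A B E F K S T : {set G}) (x y z : G).

Lemma card3_seq T : #|T| = 3 -> exists a b c, T =i [:: a; b; c].
Proof.
rewrite cardE; have mT x : (x \in enum T) = (x \in T) by rewrite mem_enum.
case: (enum T) mT => [|a [|b [|c []]]] // mT _; exists a, b, c => x.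
by rewrite -mT.
Qed.

Lemma card_seq_uniq A s : {subset A <= s} -> #|A| = size s -> uniq s.
Proof.
move=> /subsetP/subset_leq_card As e; apply/card_uniqP/eqP.
by rewrite eqn_leq card_size -e.
Qed.

Lemma clique3_cadj T a b c : clique T -> T =i [:: a; b; c] ->
  [/\ cadj a b, cadj a c & cadj b c].
Proof.
move=> /cliqueP hT eT; split; apply: hT; by rewrite eT !inE eqxx ?orbT.
Qed.

(** Four vertices remain after the triangles. If their stability number is at most 2, two cliques
    cover them. Otherwise three of them are stable and the fourth is adjacent to at least one of
    these, which leaves the trees. *)
Lemma cover_disjoint_triangles A T1 T2 : #|A| = 10 -> sal A <= 3 -> K4free A ->
  T1 \subset A -> T2 \subset A -> clique T1 -> clique T2 -> #|T1| = 3 -> #|T2| = 3 ->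
  [disjoint T1 & T2] -> cov 4 A.
Proof.
move=> A10 A3 k4 s1 s2 h1 h2 c1 c2 d12; set Q := A :\: T1 :\: T2.
have sQA : Q \subset A by apply: subset_trans (subsetDl _ _) (subsetDl _ _).
have cQ : #|Q| = 4.
  rewrite cardsD (setIidPr _); last by rewrite subsetD s2 disjoint_sym.
  by rewrite cardsD (setIidPr s1) A10 c1 c2.
have [Q2|Q3] := leqP (sal Q) 2.
  apply: (covI h1); apply: (covI h2); apply: (cov_leq Q2).
  by apply: cover_small; rewrite cQ; [|left].
have [S [hS sSQ cS]] := salP Q.
have S3 : #|S| = 3 by have := sal_sub sQA; lia.
have /cards1P[u eu] : #|Q :\: S| == 1 by rewrite cardsD (setIidPr sSQ) cQ S3.
have inQ w : w \in Q -> w = u \/ w \in S.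
  move=> wQ; have [|wS] := boolP (w \in S); [by right | left].
  by apply/set1P; rewrite -eu inE wS.
have [uQ uS] : u \in Q /\ u \notin S.
  by apply/andP; rewrite andbC -in_setD eu set11.
(* The stable triple is ordered so that the neighbours of [u] come first; three adjacency patterns
   remain. *)
have [x [y [z [eS ux hzy]]]] : exists x y z,
    [/\ S =i [:: x; y; z], adj u x & adj u z ==> adj u y].
  have [a [b [c eS]]] := card3_seq S3.
  have un : [|| adj u a, adj u b | adj u c].
    apply: contraLR A3 => /norP[ua /norP[ub uc]]; rewrite -ltnNge.
    have := sal_ge hS (subxx S); rewrite S3 => S3'; apply: leq_ltn_trans S3' _.
    apply: (sal_add (subsetP sQA u uQ) (subset_trans sSQ sQA) uS) => w.
    by rewrite eS !inE => /or3P[]/eqP->.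
  have perm x y z : [:: a; b; c] =i [:: x; y; z] -> S =i [:: x; y; z].
    by move=> e w; rewrite eS.
  case ua: (adj u a) un; case ub: (adj u b); case uc: (adj u c) => // _;
    [exists a, b, c | exists a, b, c | exists a, c, b | exists a, b, c
    | exists b, c, a | exists b, a, c | exists c, a, b];
    rewrite ?ua ?ub ?uc; split=> //; apply: perm => w; rewrite !inE;
    by case: (w == a); case: (w == b); case: (w == c).
have [t0 [t1 [t2 e1]]] := card3_seq c1.
have [t3 [t4 [t5 e2]]] := card3_seq c2.
set s := [:: t0; t1; t2; t3; t4; t5; x; y; z; u].
have sE w : (w \in s) = [|| w \in T1, w \in T2, w \in S | w == u].
  by rewrite e1 e2 eS !inE -!orbA.
have sA : {subset s <= A}.
  move=> w; rewrite sE => /or4P[/(subsetP s1)//|/(subsetP s2)//|/(subsetP sSQ)/(subsetP sQA)//|].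
  by move/eqP->; apply: (subsetP sQA).
have As : {subset A <= s}.
  move=> w wA; rewrite sE; have [//|w1] := boolP (w \in T1).
  have [//|w2] := boolP (w \in T2).
  have wQ : w \in Q by rewrite !inE wA w1 w2.
  by case: (inQ w wQ) => [->|->]; rewrite ?eqxx ?orbT.
have us : uniq s by apply: card_seq_uniq As _; rewrite A10.
have t0A : t0 \in A by apply: sA; rewrite mem_head.
have [a01 a02 a12] := clique3_cadj h1 e1.
have [a34 a35 a45] := clique3_cadj h2 e2.
have nS p q : p \in S -> q \in S -> p != q -> cadj p q = false.
  by move=> pS qS npq; rewrite /cadj (negbTE npq); apply/negbTE; move/stableP: hS; apply.
have [nxy nxz nyz] : [/\ x != y, x != z & y != z].
  have := drop_uniq 6 us; rewrite /= !inE !negb_or -!andbA.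
  by case/and4P=> -> -> _ /andP[->].
have [xS yS zS] : [/\ x \in S, y \in S & z \in S] by rewrite !eS !inE !eqxx ?orbT.
have e6 : cadj u x by apply: adj_cadj.
have nu w : w \in S -> cadj u w = adj u w.
  by move=> wS; rewrite /cadj; case: eqP => // ew; rewrite ew wS in uS.
have base b c : cadj u y = b -> cadj u z = c ->
    all (holds (lab t0 s)) (start_disjoint b c).
  move=> uy uz; rewrite /holds /lab /= a01 a02 a12 a34 a35 a45 e6.
  by rewrite (nS x y) // (nS x z) // (nS y z) // uy uz !eqxx.
have go b c code : cadj u y = b -> cadj u z = c -> checks leaf_K4free_cover (start_disjoint b c) code ->
  cov 4 A := fun uy uz => cover_by_cases_K4free us sA t0A As erefl A3 k4 (base b c uy uz).
rewrite -!nu // in hzy.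
case uy: (cadj u y) hzy; case uz: (cadj u z) => // _.
- exact: go uy uz check_disjoint11.
- exact: go uy uz check_disjoint10.
- exact: go uy uz check_disjoint00.
Qed.

(** If [v] were adjacent to both ends of one of the edges, they would form a triangle disjoint from
    [T]. So each edge has an end not adjacent to [v], and the other ends distinguish the cases. *)
Lemma no_intersecting_triangles A v T (E1 E2 E3 : {set G}) : #|A| = 10 -> sal A <= 3 ->
  K4free A -> intersecting_triangles A -> v \in A ->
  T \subset A :\ v -> clique T -> #|T| = 3 ->
  (forall E : {set G}, E \in [:: E1; E2; E3] ->
     [/\ E \subset A :\ v, clique E, #|E| = 2 & [disjoint T & E]]) ->
  A \subset v |: (T :|: E1 :|: E2 :|: E3) -> False.
Proof.
move=> A10 A3 k4 it vA sT hT cT hE cov.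
pose P (E : {set G}) x y := [/\ E =i [:: x; y], x \in A /\ y \in A, adj x y & ~~ cadj v y].
have vT : v \notin T by apply: contraTN (subxx T) => vT; move: (subsetP sT v vT); rewrite !inE eqxx.
have sTA : T \subset A by apply: subset_trans sT (subsetDl _ _).
have pick (E : {set G}) : E \in [:: E1; E2; E3] -> exists x y, P E x y.
  case/hE=> sE clE /eqP/cards2P[a [b [nab eE]]] dTE.
  have [aE bE] : a \in E /\ b \in E by rewrite eE !inE !eqxx orbT.
  have := subsetP sE a aE; have := subsetP sE b bE; rewrite !inE => /andP[nbv bA] /andP[nav aA].
  have ab : adj a b by move/cliqueP: clE => /(_ a b aE bE); rewrite /cadj (negbTE nab).
  have [vb|vb] := boolP (cadj v b); last first.
    by exists a, b; split=> // w; rewrite eE !inE.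
  have [va|va] := boolP (cadj v a); last first.
    by exists b, a; split=> //; [move=> w; rewrite eE !inE orbC | rewrite adj_sym].
  exfalso; have dT : [disjoint T & [set v; a; b]].
    rewrite disjoint_sym -setI_eq0; apply/eqP/setP => w; rewrite !inE -!orbA.
    apply/negP => /andP[/or3P[]/eqP-> wT]; first by rewrite wT in vT.
      by have := disjointFr dTE wT; rewrite aE.
    by have := disjointFr dTE wT; rewrite bE.
  suff: ~~ [disjoint T & [set v; a; b]] by rewrite dT.
  apply: it => //; first by rewrite !subUset !sub1set vA aA.
    apply/cliqueP => p q; rewrite !inE -!orbA.
    by case/or3P=> /eqP-> /or3P[]/eqP->; rewrite ?cadjxx ?(adj_cadj ab) //
      cadj_sym ?(adj_cadj ab).
  by rewrite -setUA cardsU1 cards2 !inE negb_or nab ![v == _]eq_sym nav nbv.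
have [t0 [t1 [t2 eT]]] := card3_seq cT.
have [a01 a02 a12] := clique3_cadj hT eT.
have core x1 y1 x2 y2 x3 y3 (F1 F2 F3 : {set G}) : P F1 x1 y1 -> P F2 x2 y2 -> P F3 x3 y3 ->
    A \subset v |: (T :|: F1 :|: F2 :|: F3) ->
    cadj v x2 ==> cadj v x1 -> cadj v x3 ==> cadj v x2 -> False.
  move=> [m1 [x1A y1A] e1 n1] [m2 [x2A y2A] e2 n2] [m3 [x3A y3A] e3 n3] sub h21 h32.
  set s := [:: t0; t1; t2; x1; y1; x2; y2; x3; y3; v].
  have As : {subset A <= s}.
    move=> w /(subsetP sub); rewrite in_setU1 !in_setU eT m1 m2 m3 !inE -!orbA.
    by case/orP=> [->|]; rewrite ?orbT //; do ?[case/orP=> [->|]]; rewrite ?orbT // => ->; rewrite ?orbT.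
  have us : uniq s by apply: card_seq_uniq As _; rewrite A10.
  have sA : {subset s <= A}.
    move=> w; rewrite !inE.
    have [t0A t1A t2A] : [/\ t0 \in A, t1 \in A & t2 \in A].
      by split; apply: (subsetP sTA); rewrite eT !inE eqxx ?orbT.
    by do 9?[case/orP=> [/eqP->//|]]; move=> /eqP->.
  have t0A : t0 \in A by apply: sA; rewrite mem_head.
  have base b1 b2 b3 : cadj v x1 = b1 -> cadj v x2 = b2 -> cadj v x3 = b3 ->
      all (holds (lab t0 s)) (start_intersecting b1 b2 b3).
    move=> h1 h2 h3; rewrite /holds /lab /= a01 a02 a12 h1 h2 h3 (adj_cadj e1) (adj_cadj e2) (adj_cadj e3).
    by rewrite (negbTE n1) (negbTE n2) (negbTE n3) !eqxx.
  have go b1 b2 b3 code : cadj v x1 = b1 -> cadj v x2 = b2 -> cadj v x3 = b3 ->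
    checks leaf_intersecting (start_intersecting b1 b2 b3) code -> False := fun h1 h2 h3 =>
      absurd_by_cases us sA t0A erefl A3 k4 it (base b1 b2 b3 h1 h2 h3).
  case h1: (cadj v x1) h21; case h2: (cadj v x2) h32; case h3: (cadj v x3) => // _ _.
  - exact: go h1 h2 h3 check_intersecting3.
  - exact: go h1 h2 h3 check_intersecting2.
  - exact: go h1 h2 h3 check_intersecting1.
  - exact: go h1 h2 h3 check_intersecting0.
have [x1 [y1 P1]] : exists x y, P E1 x y by apply: pick; rewrite mem_head.
have [x2 [y2 P2]] : exists x y, P E2 x y by apply: pick; rewrite !inE eqxx orbT.
have [x3 [y3 P3]] : exists x y, P E3 x y by apply: pick; rewrite !inE eqxx !orbT.
have sub (F1 F2 F3 : {set G}) : F1 :|: F2 :|: F3 = E1 :|: E2 :|: E3 ->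
  A \subset v |: (T :|: F1 :|: F2 :|: F3).
  by move=> e; rewrite -!setUA (setUA F1) e; rewrite -!setUA in cov *.
(* The edges are permuted so that those with an end adjacent to [v] come first; eight patterns
   reduce to four. *)
case h1: (cadj v x1); case h2: (cadj v x2); case h3: (cadj v x3).
- by apply: (core _ _ _ _ _ _ _ _ _ P1 P2 P3); rewrite ?h1 ?h2 ?h3 //; apply: sub.
- by apply: (core _ _ _ _ _ _ _ _ _ P1 P2 P3); rewrite ?h1 ?h2 ?h3 //; apply: sub.
- by apply: (core _ _ _ _ _ _ _ _ _ P1 P3 P2); rewrite ?h1 ?h2 ?h3 //; apply: sub; rewrite setUAC.
- by apply: (core _ _ _ _ _ _ _ _ _ P1 P2 P3); rewrite ?h1 ?h2 ?h3 //; apply: sub.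
- by apply: (core _ _ _ _ _ _ _ _ _ P2 P3 P1); rewrite ?h1 ?h2 ?h3 //; apply: sub; rewrite setUC setUA.
- by apply: (core _ _ _ _ _ _ _ _ _ P2 P1 P3); rewrite ?h1 ?h2 ?h3 //; apply: sub; rewrite (setUC E2).
- by apply: (core _ _ _ _ _ _ _ _ _ P3 P1 P2); rewrite ?h1 ?h2 ?h3 //; apply: sub; rewrite -setUA setUC.
- by apply: (core _ _ _ _ _ _ _ _ _ P1 P2 P3); rewrite ?h1 ?h2 ?h3 //; apply: sub.
Qed.

End Sal3.

(** * Gap one on ten vertices with a triangle, gap two on twelve *)

Section Gap2.
Variable G : sgraph.
Implicit Types (A B E F K S T : {set G}) (x y z : G).

Lemma disjoint_of_D A K E F : E \subset K -> F \subset A :\: K -> [disjoint E & F].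
Proof.
move=> sEK; rewrite subsetD => /andP[_ dFK].
by apply: disjointWl sEK _; rewrite disjoint_sym.
Qed.

Lemma sum4_eq9 a b c d : a + b + c + d = 9 ->
  [/\ a <= 3, b <= 3, c <= 3 & d <= 3] ->
  [/\ ~ (a = 3 /\ b = 3), ~ (a = 3 /\ c = 3) & ~ (a = 3 /\ d = 3)] ->
  [/\ ~ (b = 3 /\ c = 3), ~ (b = 3 /\ d = 3) & ~ (c = 3 /\ d = 3)] ->
  [\/ [/\ a = 3, b = 2, c = 2 & d = 2], [/\ b = 3, a = 2, c = 2 & d = 2],
      [/\ c = 3, a = 2, b = 2 & d = 2] | [/\ d = 3, a = 2, b = 2 & c = 2]].
Proof.
move=> e [ha hb hc hd] [h1 h2 h3] [h4 h5 h6].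
have [a3|na] := eqVneq a 3; first by constructor 1; split; lia.
have [b3|nb] := eqVneq b 3; first by constructor 2; split; lia.
have [c3|nc] := eqVneq c 3; first by constructor 3; split; lia.
by constructor 4; split; lia.
Qed.

(** A 4-clique leaves 6 vertices, few enough for [cover_remove_clique], and disjoint triangles are
    settled. Otherwise four cliques cover the 9 vertices other than some [v]; made disjoint, they
    have at most 3 vertices each and at most one has 3, so the sizes are 3, 2, 2, 2. *)
Lemma cover_sal3 A : #|A| <= 10 -> sal A <= 3 -> cov 4 A.
Proof.
move=> A10 A3; have [A9|A9] := leqP #|A| 9; first exact: cov_leq (cover_9 A9).
have {A9}cA : #|A| = 10 by lia.
have [A2|A2] := leqP (sal A) 2; first exact: cov_leq (cover_sal2 A10 A2).
have sA : sal A = 3 by lia.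
have [/existsP[K /and3P[sKA hK K4]]|k4] :=
    boolP [exists K : {set G}, [&& K \subset A, clique K & 3 < #|K|]].
  rewrite -sA; apply: (cover_remove_clique hK sKA); rewrite ?sA //.
  - by rewrite -card_gt0; lia.
  - by rewrite cardsD (setIidPr sKA); lia.
  - move=> B pB lt; apply: (@cov_leq _ (sal B).+1) => //.
    by apply: cover_9; have := proper_card pB; lia.
have {}k4 : K4free A.
  by move=> K sKA hK; rewrite leqNgt; apply: contra k4 => K4; apply/existsP; exists K; apply/and3P.
have [/existsP[[T1 T2] /= /and5P[s1 s2 h1 h2 /and3P[/eqP c1 /eqP c2 d]]]|it] :=
    boolP [exists t : {set G} * {set G}, [&& t.1 \subset A, t.2 \subset A,
      clique t.1, clique t.2 & [&& #|t.1| == 3, #|t.2| == 3 & [disjoint t.1 & t.2]]]].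
  exact: (cover_disjoint_triangles cA A3 k4 s1 s2 h1 h2 c1 c2 d).
have {}it : intersecting_triangles A.
  move=> T1 T2 s1 s2 h1 h2 c1 c2; apply: contra it => d; apply/existsP.
  by exists (T1, T2); rewrite /= s1 s2 h1 h2 c1 c2 d.
exfalso; have /card_gt0P[v vA] : 0 < #|A| by lia.
have cB : #|A :\ v| = 9 by have := cardsD1 v A; rewrite vA; lia.
have sB := subsetDl A [set v]; have B3 := leq_trans (sal_sub sB) A3.
have [||K1 h1 [K2 h2 [K3 h3 [K4 h4 e4]]]] := @cov_leq _ (sal (A :\ v)).+1 4 (A :\ v).
- by [].
- by apply: cover_9; rewrite cB.
move: sB cB e4; set B := A :\ v => sB cB e4.
(* The covering cliques may overlap and leave [B]; these are disjoint pieces of them that partition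
   [B]. *)
pose C1 := B :&: K1; pose R1 := B :\: K1; pose C2 := R1 :&: K2; pose R2 := R1 :\: K2.
pose C3 := R2 :&: K3; pose C4 := R2 :\: K3.
have s4 : C4 \subset K4 by rewrite -setD_eq0 e4.
have [sR1 sR2] : R1 \subset B /\ R2 \subset B.
  by split; [exact: subsetDl | apply: subset_trans (subsetDl _ _) (subsetDl _ _)].
have [b1 b2 b3 b4] : [/\ C1 \subset B, C2 \subset B, C3 \subset B & C4 \subset B].
  split; first exact: subsetIl.
  - exact: subset_trans (subsetIl _ _) sR1.
  - exact: subset_trans (subsetIl _ _) sR2.
  - exact: subset_trans (subsetDl _ _) sR2.
have [q1 q2 q3 q4] : [/\ clique C1, clique C2, clique C3 & clique C4].
  by split; [apply: clique_sub h1 | apply: clique_sub h2 | apply: clique_sub h3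
    | apply: clique_sub h4]; rewrite ?subsetIr.
have d1 F : F \subset R1 -> [disjoint C1 & F] by apply: disjoint_of_D; apply: subsetIr.
have d2 F : F \subset R2 -> [disjoint C2 & F] by apply: disjoint_of_D; apply: subsetIr.
have d3 F : F \subset C4 -> [disjoint C3 & F] by apply: disjoint_of_D; apply: subsetIr.
have s32 : C3 \subset R2 := subsetIl _ _; have s42 : C4 \subset R2 := subsetDl _ _.
have s21 : R2 \subset R1 := subsetDl _ _.
have [D12 D13 D14] : [/\ [disjoint C1 & C2], [disjoint C1 & C3] & [disjoint C1 & C4]].
  by split; apply: d1; [exact: subsetIl | apply: subset_trans s21 | apply: subset_trans s21].
have [D23 D24] : [disjoint C2 & C3] /\ [disjoint C2 & C4] by split; apply: d2.
have D34 : [disjoint C3 & C4] by apply: d3.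
have sum : #|C1| + #|C2| + #|C3| + #|C4| = 9.
  by rewrite -!addnA (cardsID K3 R2) (cardsID K2 R1) (cardsID K1 B).
have le3 F : F \subset B -> clique F -> #|F| <= 3.
  by move=> sF; apply: k4; apply: subset_trans sB.
have not33 F F' : F \subset B -> F' \subset B -> clique F -> clique F' ->
    [disjoint F & F'] -> ~ (#|F| = 3 /\ #|F'| = 3).
  move=> sF sF' hF hF' dF [cF cF'].
  have /negP := it F F' (subset_trans sF sB) (subset_trans sF' sB) hF hF' cF cF'.
  by apply.
have cover : A \subset v |: (C1 :|: C2 :|: C3 :|: C4).
  apply/subsetP => w wA; rewrite !inE; case: (w == v) => //=; rewrite wA /=.
  by case: (w \in K1); case: (w \in K2); case: (w \in K3).
have fin T F1 F2 F3 : T \subset B -> clique T -> #|T| = 3 ->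
   [/\ F1 \subset B, F2 \subset B & F3 \subset B] ->
   [/\ clique F1, clique F2 & clique F3] ->
   [/\ #|F1| = 2, #|F2| = 2 & #|F3| = 2] ->
   [/\ [disjoint T & F1], [disjoint T & F2] & [disjoint T & F3]] ->
   C1 :|: C2 :|: C3 :|: C4 \subset T :|: F1 :|: F2 :|: F3 -> False.
  move=> sT hT cT [f1 f2 f3] [g1 g2 g3] [c1 c2 c3] [e1 e2 e3] sub.
  apply: (@no_intersecting_triangles _ A v T F1 F2 F3) => //; last first.
    by apply: subset_trans cover _; apply: setUS.
  by move=> F; rewrite !inE => /or3P[]/eqP->.
have n1 : [/\ ~ (#|C1| = 3 /\ #|C2| = 3), ~ (#|C1| = 3 /\ #|C3| = 3) &
    ~ (#|C1| = 3 /\ #|C4| = 3)] by split; apply: not33.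
have n2 : [/\ ~ (#|C2| = 3 /\ #|C3| = 3), ~ (#|C2| = 3 /\ #|C4| = 3) &
    ~ (#|C3| = 3 /\ #|C4| = 3)] by split; apply: not33.
have l4 : [/\ #|C1| <= 3, #|C2| <= 3, #|C3| <= 3 & #|C4| <= 3] by split; apply: le3.
have dsym E F : [disjoint E & F] -> [disjoint F & E] by rewrite disjoint_sym.
case: (sum4_eq9 sum l4 n1 n2) => -[c3 c2 c2' c2''].
- by apply: (fin C1 C2 C3 C4).
- by apply: (fin C2 C1 C3 C4) => //; [split=> //; apply: dsym | rewrite (setUC C2)].
- apply: (fin C3 C1 C2 C4) => //; first by split=> //; apply: dsym.
  by rewrite -[C3 :|: C1 :|: C2]setUA (setUC C3).
- apply: (fin C4 C1 C2 C3) => //; first by split=> //; apply: dsym.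
  by rewrite -[C4 :|: C1 :|: C2]setUA -[C4 :|: _ :|: C3]setUA (setUC C4).
Qed.

(** Stability number at least 4 is what the bound 7 <= [sal] + 3 of [cover_remove_clique] requires;
    smaller values have their own covers. *)
Lemma cover_10_triangle A T : #|A| <= 10 -> T \subset A -> clique T -> #|T| = 3 ->
  cov (sal A).+1 A.
Proof.
move=> A10 sTA hT T3; have [|k1] := leqP (sal A) 1; first exact: cov_clique.
have [k3|k3] := leqP (sal A) 3.
  have [k2|k2] := eqVneq (sal A) 2; first by rewrite k2; apply: cover_sal2; lia.
  have -> : sal A = 3 by lia.
  exact: cover_sal3.
apply: (cover_remove_clique hT sTA); first by rewrite -card_gt0 T3.
- by rewrite cardsD (setIidPr sTA) T3; lia.
- lia.
- move=> B pB lt; apply: (@cov_leq _ (sal B).+1) => //.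
  by apply: cover_9; have := proper_card pB; lia.
Qed.

(** Removing a triangle leaves at most 9 vertices of gap at most 1. In a split where both parts have
    at least five vertices, both have gap at most 1, and the gaps add up to 2. *)
Lemma cover_12 A : #|A| <= 12 -> cov (sal A + 2) A.
Proof.
have [n] := ubnP #|A|; elim: n A => // n IH A An A12.
have IHp B : B \proper A -> cov (sal B + 2) B.
  by move=> /proper_card pB; apply: IH; lia.
have [k1|k1] := leqP (sal A) 1.
  by apply: cov_leq (cov_clique k1); lia.
have [tA|[T [sTA hT T3]]] := tfree_or_triangle A; last first.
  rewrite addn2; apply: (covI hT); apply: cov_leq (@cover_9 _ (A :\: T) _).
    by rewrite ltnS; apply/sal_sub/subsetDl.
  by rewrite cardsD (setIidPr sTA) T3; lia.
have [//|nc] := cov_em (sal A + 2) A.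
have [v vA|big|[B [B0 pB hB]]] := gallai tA nc.
- apply: cov_leq (IHp _ (properD1 vA)); rewrite leq_add2r; exact: sal_sub (subsetDl _ _).
(* Here 2([sal] + 2) < |A| <= 12 gives stability number at most 3, so |A| <= 8 by R(3,4), and then
   stability number at most 1. *)
- have A8 : 9 <= #|A| -> 4 <= sal A by apply: ramsey34.
  by exfalso; lia.
have sBA := proper_sub pB; have cAB := cardsID B A; rewrite (setIidPr sBA) in cAB.
have [small|large] := boolP ((#|B| <= 4) || (#|A :\: B| <= 4)).
  apply: (@cov_split_small _ 2 A B sBA hB); [exact/orP | exact: IHp | ].
  exact/IHp/proper_split.
have B9 : #|B| <= 9 by lia.
have D9 : #|A :\: B| <= 9 by lia.
apply: cov_leq (cov_split sBA (cover_9 B9) (cover_9 D9)).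
by have := sal_split sBA hB; lia.
Qed.

Lemma sal_clique_add B T k : clique T -> sal B <= k ->
  (forall t, t \in T -> sal (t |: B) <= k) -> sal (T :|: B) <= k.
Proof.
move=> /cliqueP hT hB h; apply: sal_leP => S hS sS.
have [e|[t]] := set_0Vmem (S :&: T).
  apply: leq_trans hB; apply: sal_ge => //; apply/subsetP => x xS.
  have := subsetP sS x xS; rewrite inE => /orP[xT|//].
  by have := in_set0 x; rewrite -e inE xS xT.
rewrite inE => /andP[tS tT]; apply: leq_trans (h t tT); apply: sal_ge => //.
apply/subsetP => x xS; have := subsetP sS x xS; rewrite !inE => /orP[xT|->]; last by rewrite orbT.
have := hT x t xT tT; rewrite /cadj => /orP[->//|xt].
by move/stableP: hS => /(_ x t xS tS); rewrite xt.
Qed.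

Lemma mem_of_sal t B k S : sal B <= k -> stable S -> S \subset t |: B -> k < #|S| -> t \in S.
Proof.
move=> hB hS sS; apply: contraLR => tS; rewrite -leqNgt; apply: leq_trans hB.
apply: sal_ge => //; apply/subsetP => x xS; have := subsetP sS x xS.
by rewrite !inE => /orP[/eqP e|//]; rewrite -e xS in tS.
Qed.

(** No vertex of [T] raises the stability number of both parts, so [T] can be divided between them
    with both numbers staying 2. Each enlarged part has at most 8 vertices and is covered by three
    cliques. *)
Lemma cover_triangle_two_parts A T B1 B2 : clique T -> T \subset A ->
  A :\: T = B1 :|: B2 -> [disjoint B1 & B2] -> #|T| = 3 -> #|B1| = 5 -> #|B2| = 5 ->
  sal B1 = 2 -> sal B2 = 2 -> sal A <= 4 ->
  (forall x y, x \in B1 -> y \in B2 -> ~~ adj x y) -> cov 6 A.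
Proof.
move=> hT sTA eAT d12 T3 c1 c2 k1 k2 kA h.
have [s1 s2] : B1 \subset A :\: T /\ B2 \subset A :\: T by rewrite eAT subsetUl subsetUr.
have [sA1 sA2] : B1 \subset A /\ B2 \subset A.
  by split; [apply: subset_trans s1 _ | apply: subset_trans s2 _]; apply: subsetDl.
pose T1 := [set t in T | sal (t |: B1) <= 2].
have sT1 : T1 \subset T by apply/subsetP => t; rewrite inE => /andP[].
have q1 : sal (T1 :|: B1) <= 2.
  apply: sal_clique_add; [exact: clique_sub hT | by rewrite k1 |].
  by move=> t; rewrite inE => /andP[].
have q2 : sal ((T :\: T1) :|: B2) <= 2.
  apply: sal_clique_add; [exact: clique_sub (subsetDl _ _) hT | by rewrite k2 |].
  move=> t; rewrite !inE => /andP[]; rewrite negb_and => /orP[/negP//|ht] tT.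
  rewrite -ltnNge in ht; rewrite leqNgt; apply/negP => ht2.
  have [S1 [hS1 sS1 eS1]] := salP (t |: B1); have [S2 [hS2 sS2 eS2]] := salP (t |: B2).
  have t1 : t \in S1 by apply: (mem_of_sal _ hS1 sS1 (k := 2)); rewrite ?k1 ?eS1.
  have t2 : t \in S2 by apply: (mem_of_sal _ hS2 sS2 (k := 2)); rewrite ?k2 ?eS2.
  have tA := subsetP sTA t tT.
  (* Stable sets of size 3 in the two enlarged parts would share only [t], and their union would be
     stable with 5 elements. *)
  suff : #|S1 :|: (S2 :\ t)| <= 4.
    rewrite cardsU disjoint_setI0 ?cards0 ?subn0.
      have := cardsD1 t S2; rewrite t2 eS2 eS1; move: ht ht2.
      by move: #|S2 :\ t| (sal (t |: B1)) (sal (t |: B2)) => a b c; clear; lia.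
    rewrite -setI_eq0; apply/eqP/setP => x; rewrite !inE; apply/negP.
    case/and3P=> x1 nxt x2; have := subsetP sS1 x x1; have := subsetP sS2 x x2.
    rewrite !inE (negbTE nxt) /= => xB2 xB1.
    by have := disjointFr d12 xB1; rewrite xB2.
  apply: leq_trans kA; apply: sal_ge; last first.
    rewrite subUset (subset_trans sS1) ?subUset ?sub1set ?tA //=.
    by apply: subset_trans (subsetDl _ _) (subset_trans sS2 _); rewrite subUset sub1set tA.
  apply: stableU => //; first exact: stable_sub (subsetDl _ _) hS2.
  move=> x y x1; rewrite !inE => /andP[nyt y2].
  have := subsetP sS2 y y2; rewrite !inE (negbTE nyt) /= => yB2.
  have := subsetP sS1 x x1; rewrite !inE => /orP[/eqP->|xB1]; last exact: h.
  by move/stableP: hS2; apply.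
have cv1 : cov 3 (T1 :|: B1).
  apply: cover_sal2 => //; apply: leq_trans (leq_card_setU _ _) _.
  by rewrite c1; have := subset_leq_card sT1; lia.
have cv2 : cov 3 ((T :\: T1) :|: B2).
  apply: cover_sal2 => //; apply: leq_trans (leq_card_setU _ _) _.
  by rewrite c2; have := subset_leq_card (subsetDl T T1); lia.
apply: cov_sub (covU cv1 cv2); apply/subsetP => x xA.
have [xT|xT] := boolP (x \in T).
  by rewrite !in_setU in_setD xT andbT; case: (x \in T1); rewrite ?orbT.
have : x \in A :\: T by rewrite inE xT.
by rewrite eAT !in_setU => /orP[]->; rewrite ?orbT.
Qed.

End Gap2.

Lemma r13E (k l : 'I_13) : r13 k l = R13_adj k l.
Proof.
rewrite /r13 /R13_adj /R13_arc !(modn_small (ltn_ord _)).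
rewrite ![nat_of_ord k == _]eq_sym ![nat_of_ord l == _]eq_sym.
by do 4?[case: (_ == _)].
Qed.

(** * Thirteen vertices *)

Section Gap3.
Variable G : sgraph.
Implicit Types (A B E F K S T : {set G}) (x y z : G).

(** It suffices to cover the other 10 vertices by [sal A] + 1 cliques. Every case allows this except
    a split into two sets of 5 vertices with stability number 2 and [sal A] = 4, where
    [cover_triangle_two_parts] covers everything at once. *)
Lemma cover_13_triangle A T : #|A| = 13 -> T \subset A -> clique T -> #|T| = 3 ->
  cov (sal A + 2) A.
Proof.
move=> A13 sTA hT T3; set B := A :\: T; have sBA : B \subset A := subsetDl A T.
have cB : #|B| = 10 by rewrite cardsD (setIidPr sTA) A13 T3.
have kB := sal_sub sBA.
have fin : cov (sal A).+1 B -> cov (sal A + 2) A by rewrite addn2; apply: covI.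
have [lt|ge] := ltnP (sal B) (sal A).
  by apply: fin; apply: (@cov_leq _ (sal B + 2)); [rewrite addn2 | apply: cover_12; rewrite cB].
have eB : sal B = sal A by apply/eqP; rewrite eqn_leq kB ge.
have [tB|[T' [sT' hT' T'3]]] := tfree_or_triangle B; last first.
  by apply: fin; rewrite -eB; apply: (cover_10_triangle _ sT' hT' T'3); rewrite cB.
have [/fin//|nc] := cov_em (sal A).+1 B.
have [v vB|big|[B1 [B10 pB1 hB1]]] := gallai tB nc.
- apply: cov_leq (@cover_9 _ (B :\ v) _).
    by rewrite ltnS -eB; apply: sal_sub (subsetDl _ _).
  by have := cardsD1 v B; rewrite vB cB; clear; lia.
- have := ramsey34 tB; rewrite cB eB => /(_ isT); move: big; rewrite cB.
  by clear; lia.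
have sB1 := proper_sub pB1; have cB12 := cardsID B1 B; rewrite (setIidPr sB1) cB in cB12.
have pB2 := proper_split B10 pB1.
have h9 F : F \proper B -> cov (sal F).+1 F.
  by move/proper_card; rewrite cB => cF; apply: cover_9.
have c1 := h9 _ pB1; have c2 := h9 _ pB2.
have [small|large] := boolP ((#|B1| <= 4) || (#|B :\: B1| <= 4)).
  by case: nc; rewrite -eB -addn1; apply: (cov_split_small sB1 hB1 (orP small)); rewrite addn1.
have [e1 e2] : #|B1| = 5 /\ #|B :\: B1| = 5 by move: large cB12; clear; lia.
have hs := sal_split sB1 hB1; rewrite eB in hs.
have [k1|k1] := eqVneq (sal B1) 2; last first.
  case: nc; apply: cov_leq (cov_split sB1 (cover_small _ _) c2); rewrite ?e1 //.
    by rewrite addnS ltnS.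
  by right; apply/eqP.
have [k2|k2] := eqVneq (sal (B :\: B1)) 2; last first.
  case: nc; apply: cov_leq (cov_split sB1 c1 (cover_small _ _)); rewrite ?e2 //.
  by right; apply/eqP.
rewrite k1 in c1; rewrite k2 in c2; have c6 := cov_split sB1 c1 c2.
(* Six cliques cover the 10 vertices, which is already enough when the stability number exceeds
   4. *)
have kA : sal A = 4.
  move: hs; rewrite k1 k2 leq_eqVlt => /orP[/eqP<-//|lt].
  by case: nc; apply: cov_leq c6.
rewrite kA; apply: (@cover_triangle_two_parts _ A T B1 (B :\: B1)) => //.
- by apply/setP => x; rewrite !inE; case: (boolP (x \in B1)) => //= /(subsetP sB1); rewrite inE.
- by rewrite -setI_eq0 setIDA setDIl setDv set0I.
- by rewrite kA.
Qed.

(** Gallai's lemma gives 2([sal] + 2) < 13, hence the bound 4; in a split the gaps of the parts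
    would add up to at most 2. *)
Lemma sal_13_tfree A : #|A| = 13 -> tfree A -> ~ cov (sal A + 2) A -> sal A <= 4.
Proof.
move=> A13 tA nc; have [v vA|big|[B [B0 pB hB]]] := gallai tA nc.
- apply: cov_leq (@cover_12 _ (A :\ v) _).
    by rewrite leq_add2r; apply: sal_sub (subsetDl _ _).
  by have := cardsD1 v A; rewrite vA A13; clear; lia.
- by move: big; rewrite A13; clear; lia.
case: nc; have sBA := proper_sub pB; have cAB := cardsID B A.
rewrite (setIidPr sBA) A13 in cAB; have pB2 := proper_split B0 pB.
have h12 F : F \proper A -> cov (sal F + 2) F.
  by move/proper_card; rewrite A13 => cF; apply: cover_12.
have [small|large] := boolP ((#|B| <= 4) || (#|A :\: B| <= 4)).
  by apply: (cov_split_small sBA hB (orP small)); apply: h12.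
have [B9 D9] : #|B| <= 9 /\ #|A :\: B| <= 9 by move: large cAB; clear; lia.
apply: cov_leq (cov_split sBA (cover_9 B9) (cover_9 D9)).
by have := sal_split sBA hB; clear; lia.
Qed.

(** * Uniqueness of the (3,5)-graph on 13 vertices *)

Section Uniqueness.
Hypothesis tG : tfree [set: G].
Hypothesis G13 : #|G| = 13.
Hypothesis kG : sal [set: G] <= 4.
Local Notation V := [set: G].

(** Neighbours are at most 4 and, by R(3,4) = 9, non-neighbours at most 8; since 1 + 4 + 8 = 13 both
    bounds are attained. *)
Lemma deg_nonnbh_13 x : #|nbh V x| = 4 /\ #|nonnbh V x| = 8.
Proof.
have xV := in_setT x; have := card_nbh xV; rewrite cardsT G13.
have := leq_trans (nbh_sal tG xV) kG.
have : #|nonnbh V x| <= 8.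
  rewrite leqNgt; apply/negP => /(ramsey34 (tfree_sub (subsetT _) tG)) h.
  by have := leq_trans h (leq_trans (nonnbh_sal xV) kG).
by clear; lia.
Qed.

Lemma leaf_r13_sound x0 s p i j b : uniq s -> size s = 13 ->
  consistent (lab x0 s) p -> leaf_r13 p i j b -> isomorphic G R13.
Proof.
move=> us szs cp; have sV : {subset s <= V} by move=> x _; rewrite inE.
have x0V : x0 \in V by rewrite inE.
have countP c k : k < 13 -> count (known c p k) (iota 0 13) <=
    (if c then #|nbh V (nth x0 s k)| else #|nonnbh V (nth x0 s k)|).
  move=> k13; rewrite -size_filter; set l := filter _ _.
  have ul : uniq (map (nth x0 s) l).
    rewrite map_inj_in_uniq ?filter_uniq ?iota_uniq // => a d.
    rewrite !mem_filter !mem_iota => /andP[_ ha] /andP[_ hd] /eqP.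
    by rewrite nth_uniq ?szs // => /eqP.
  rewrite -(size_map (nth x0 s)) -(card_uniqP ul).
  have h a : a \in l -> nth x0 s k != nth x0 s a /\ cadj (nth x0 s k) (nth x0 s a) = c.
    rewrite mem_filter mem_iota => /andP[/(knownP cp)/andP[nka /eqP e] a13].
    by rewrite nth_uniq ?szs.
  case: c @l ul h => l ul h; apply/subset_leq_card/subsetP => x /mapP[a /h[nka]];
    rewrite /cadj (negbTE nka) => /= e ->; rewrite !inE /cadj ?(negbTE nka) e //.
rewrite /leaf_r13; case: ifP => // /negbFE/andP[i13 j13].
case: ifP => [h _|_].
  exfalso; case: b h => /orP[/orP[]|].
  - case/clique_atP=> l [pl szl ll].
    have [|sK hK cK] := known_true_clique us sV cp pl; first by move=> k /ll; rewrite szs.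
    by have := tfree_clique tG sK hK; rewrite cK szl.
  - by rewrite ltnNge (leq_trans (countP true i i13)) // (deg_nonnbh_13 _).1.
  - by rewrite ltnNge (leq_trans (countP true j j13)) // (deg_nonnbh_13 _).1.
  - case/clique_atP=> l [pl szl _]; have := known_false_stable sV x0V cp pl.
    by rewrite szl leqNgt ltnS kG.
  - by rewrite ltnNge (leq_trans (countP false i i13)) // (deg_nonnbh_13 _).2.
  - by rewrite ltnNge (leq_trans (countP false j j13)) // (deg_nonnbh_13 _).2.
case: ifP => // _ h.
have [//||//|f [szf f13 hf]] := embedsP (acc := [::]) _ _ _ h.
  by move=> k l; rewrite ltn0 andbF.
pose g (k : 'I_13) := nth x0 s (nth 0 f k).
have fk (k : 'I_13) : nth 0 f k < 13 by apply/f13/mem_nth; rewrite szf.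
have hg (k l : 'I_13) : k < l -> g l != g k /\ cadj (g l) (g k) = r13 l k.
  move=> kl; have /(hf k l) : k < l < 13 by rewrite kl /=.
  by case/(knownP cp)/andP=> nlk /eqP e; rewrite /g nth_uniq ?szs.
have ginj : injective g.
  move=> k l e; have [kl|kl|/val_inj//] := ltngtP k l; have [] := hg _ _ kl;
    by rewrite e eqxx.
have gadj (k l : 'I_13) : adj (g k) (g l) = R13_adj k l.
  have [kl|lk|/val_inj ->] := ltngtP k l; last by rewrite adj_irrefl R13_adj_irrefl.
    have [nlk] := hg _ _ kl; rewrite /cadj (negbTE nlk) /= => e.
    by rewrite adj_sym e r13E R13_adj_sym.
  by have [nlk] := hg _ _ lk; rewrite /cadj (negbTE nlk) /= => e; rewrite e r13E.
have [|g' gK g'K] := inj_card_bij ginj; first by rewrite card_ord G13.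
exists g'; first by exists g.
by move=> x y; rewrite /= -gadj !g'K.
Qed.

Lemma no_triangle x y z : adj x y -> adj y z -> adj x z = false.
Proof. by move=> xy yz; apply/negbTE; apply: tG xy yz; rewrite inE. Qed.

(** Three neighbours of [u] each have three further neighbours, all among the 8 non-neighbours of
    [u]. As 9 > 8, two of them share one, which serves as [v]. *)
Lemma two_common_nbrs : exists u v a b : G, [/\ ~~ cadj u v, a != b,
  adj u a /\ adj u b & adj v a /\ adj v b].
Proof.
have /card_gt0P[u _] : 0 < #|G| by rewrite G13.
have [c4 c8] := deg_nonnbh_13 u.
have /card_gt2P[a [b [c [[aN bN cN] [nab nbc nca]]]]] : 2 < #|nbh V u| by rewrite c4.
pose X w := nbh V w :\ u.
have cX w : w \in nbh V u -> #|X w| = 3.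
  rewrite !inE /= => uw; have [cw _] := deg_nonnbh_13 w.
  by move: cw; rewrite (cardsD1 u) !inE /= adj_sym uw => -[].
have sX w : w \in nbh V u -> X w \subset nonnbh V u.
  rewrite !inE /= => uw; apply/subsetP => v; rewrite !inE /= => /andP[nvu wv].
  by rewrite /cadj eq_sym (negbTE nvu) (no_triangle uw wv).
have fin w w' : w \in nbh V u -> w' \in nbh V u -> w != w' ->
    ~~ [disjoint X w & X w'] -> exists u v a b : G,
    [/\ ~~ cadj u v, a != b, adj u a /\ adj u b & adj v a /\ adj v b].
  move=> wN w'N nww; rewrite -setI_eq0 => /set0Pn[v]; rewrite inE => /andP[vX vX'].
  have := subsetP (sX w wN) v vX; rewrite inE => /andP[_ nuv].
  move: vX vX' wN w'N; rewrite !inE /= => /andP[_ wv] /andP[_ w'v] uw uw'.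
  by exists u, v, w, w'; split=> //; split=> //; rewrite adj_sym.
have [dab|] := boolP [disjoint X a & X b]; last exact: fin.
have [dbc|] := boolP [disjoint X b & X c]; last exact: fin.
have [dca|] := boolP [disjoint X c & X a]; last exact: fin.
have : #|X a :|: X b :|: X c| <= 8.
  by rewrite -c8; apply: subset_leq_card; rewrite !subUset !sX.
rewrite cardsU cardsU (disjoint_setI0 dab) setIUl (setIC (X a)) (disjoint_setI0 dca).
by rewrite (disjoint_setI0 dbc) setU0 !cards0 !cX.
Qed.

Lemma nth_rot5 x0 (s : seq G) k l : size s = 5 -> k < 5 -> l < 5 ->
  nth x0 (rot k s) l = nth x0 s ((k + l) %% 5).
Proof.
move=> sz k5 l5; rewrite /rot nth_cat size_drop sz nth_drop.
have [lk|lk] := ltnP l (5 - k); first by rewrite modn_small //; move: lk; clear; lia.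
rewrite nth_take; last by move: l5 lk k5; clear; lia.
congr nth; have -> : k + l = (l - (5 - k)) + 5 by move: l5 lk k5; clear; lia.
by rewrite modnDr modn_small //; move: l5 lk k5; clear; lia.
Qed.

Lemma c5_rot x0 s k : is_c5 x0 s -> k < 5 -> is_c5 x0 (rot k s).
Proof.
case=> sz us h k5; split; rewrite ?size_rot ?rot_uniq // => i j i5 j5.
rewrite !nth_rot5 // h ?ltn_pmod // /c5 !modnDml -!addnA.
have e a b : a < 5 -> b < 5 -> ((k + (a + 1)) %% 5 == (k + b) %% 5) = ((a + 1) %% 5 == b).
  by move=> a5 b5; rewrite eqn_modDl [b %% 5]modn_small.
by rewrite !e.
Qed.

Lemma c5_nonadj i j : i < 5 -> j < 5 -> i != j -> c5 i j = false ->
  j = (i + 2) %% 5 \/ i = (j + 2) %% 5.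
Proof.
by case: i => [|[|[|[|[|i]]]]] //; case: j => [|[|[|[|[|j]]]]] //; auto.
Qed.

Lemma lab_adj x0 (s : seq G) i j : uniq s -> i < size s -> j < size s -> i != j ->
  lab x0 s i j = adj (nth x0 s i) (nth x0 s j).
Proof. by move=> us is_ js nij; rewrite /lab /cadj nth_uniq // (negbTE nij). Qed.

(** The vertices adjacent to neither [u] nor [v] turn out to form a 5-cycle, which is rotated so
    that the common neighbour [a] sees its vertices 0 and 2. This fixes the starting data of the
    tree. *)
Lemma R13_unique : isomorphic G R13.
Proof.
have [u [v [a [b [nuv nab [ua ub] [va vb]]]]]] := two_common_nbrs.
have [dU nU] := deg_nonnbh_13 u; have [dV nV] := deg_nonnbh_13 v.
pose Z := nonnbh (nonnbh V u) v.
have vM : v \in nonnbh V u by rewrite inE in_setT.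
have sZ : Z \subset nonnbh V u := nonnbh_sub _ _.
have Z2 : sal Z <= 2.
  have := nonnbh_sal vM; have := nonnbh_sal (in_setT u); move: kG.
  by rewrite -/Z; clear; lia.
have tZ : tfree Z := tfree_sub (subsetT _) tG.
have Z5 : #|Z| <= 5.
  by rewrite leqNgt; apply/negP => /(ramsey33 tZ); rewrite leqNgt ltnS Z2.
pose N := nbh V u :&: nbh V v.
pose Nu := nbh V u :\: nbh V v; pose Nv := nbh V v :\: nbh V u.
have eNu : #|N| + #|Nu| = 4 by rewrite -dU -(cardsID (nbh V v) (nbh V u)).
have eNv : #|N| + #|Nv| = 4 by rewrite -dV -(cardsID (nbh V u) (nbh V v)) setIC.
have eNv' : nbh (nonnbh V u) v = Nv.
  apply/setP => w; rewrite !inE /cadj /= negb_or; case vw: (adj v w); rewrite ?andbF // !andbT.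
  by case: eqP => // e; move: nuv; rewrite e cadj_sym /cadj vw orbT.
have eZ : #|Nv| + #|Z| = 7 by have := card_nbh vM; rewrite nU eNv' -/Z => -[].
have N2 : 1 < #|N|.
  by apply/card_gt1P; exists a, b; rewrite !inE /= ua ub va vb.
(* From |Z| <= 5 and |Nv| + |Z| = 7, |Nv| is at least 2; as |N| is at least 2 and |N| + |Nv| = 4,
   equality holds throughout. *)
have [cN cNu cNv cZ] : [/\ #|N| = 2, #|Nu| = 2, #|Nv| = 2 & #|Z| = 5].
  by move: eNu eNv eZ N2 Z5; clear => *; split; lia.
have eN : N = [set a; b].
  apply/esym/eqP; rewrite eqEcard cN cards2 nab /= andbT subUset !sub1set.
  by rewrite !inE /= ua ub va vb.
have /eqP/cards2P[c [d [ncd eU]]] := cNu.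
have /eqP/cards2P[e [f [nef eV]]] := cNv.
(* Two cliques cannot cover the five vertices of the triangle-free set [Z], so the 5-cycle
   remains. *)
have [|cov2|/(_ u)[s0 hs0 sZ0]] := @c5_or_cover G Z _ Z2; first by rewrite cZ.
  by have [m _] := cov_matching tZ cov2; rewrite cZ.
have [sz0 us0 adj0] := hs0.
have ZE w : (w \in Z) = [&& w != u, w != v, ~~ adj u w & ~~ adj v w].
  by rewrite !inE /cadj !negb_or ![_ == w]eq_sym /= andbACA -andbA.
have Zs0 : {subset Z <= s0}.
  have /eqP <- : [set x in s0] == Z.
    rewrite eqEcard cZ cardsE (card_uniqP us0) sz0 andbT.
    by apply/subsetP => w; rewrite inE => /sZ0.
  by move=> w; rewrite inE.
(* Two of the four neighbours of [a] are [u] and [v]; the other two lie in [Z], since a neighbour of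
   [u] or [v] would close a triangle. *)
have [p [q [pZ qZ npq [ap aq]]]] : exists p q, [/\ p \in Z, q \in Z, p != q & adj a p /\ adj a q].
  have /card_gt1P[p [q [pD qD npq]]] : 1 < #|nbh V a :\: [set u; v]|.
    have [cA _] := deg_nonnbh_13 a; rewrite cardsD cA (leq_trans _ (leq_sub2l 4 (subset_leq_card (subsetIr _ _)))) //.
    by rewrite cards2; case: (u != v).
  have inZ w : w \in nbh V a :\: [set u; v] -> w \in Z /\ adj a w.
    rewrite ZE !inE /= negb_or => /andP[/andP[-> ->] aw]; split=> //.
    by rewrite (no_triangle ua aw) (no_triangle va aw).
  have [pZ ap] := inZ p pD; have [qZ aq] := inZ q qD.
  by exists p, q.
(* Being non-adjacent, [p] and [q] are at distance two on the 5-cycle; [k] is the index from which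
   the other is two steps ahead. *)
have [k k5 [a0 a2]] : exists2 k, k < 5 & adj a (nth u s0 k) /\ adj a (nth u s0 ((k + 2) %% 5)).
  have ip := Zs0 p pZ; have iq := Zs0 q qZ.
  have i5 : index p s0 < 5 by rewrite -sz0 index_mem.
  have j5 : index q s0 < 5 by rewrite -sz0 index_mem.
  have nij : index p s0 != index q s0.
    by apply: contra npq => /eqP e'; rewrite -(nth_index u ip) e' nth_index.
  have nc : c5 (index p s0) (index q s0) = false.
    rewrite -adj0 // !nth_index //; apply: no_triangle aq; by rewrite adj_sym.
  have [e'|e'] := c5_nonadj i5 j5 nij nc.
    by exists (index p s0) => //; rewrite -e' !nth_index.
  by exists (index q s0) => //; rewrite -e' !nth_index.
have hs1 := c5_rot hs0 k5.
have a0' : adj a (nth u (rot k s0) 0) by rewrite nth_rot5 // addn0 modn_small.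
have a2' : adj a (nth u (rot k s0) 2) by rewrite nth_rot5.
have Zs1 : Z =i rot k s0.
  by move=> w; rewrite mem_rot; apply/idP/idP => [/Zs0|/sZ0].
case: (rot k s0) hs1 a0' a2' Zs1 => [|z0 [|z1 [|z2 [|z3 [|z4 [|? ?]]]]]] [] //= _ _ adj1 az0 az2 Zs1.
set s := [:: u; v; a; b; c; d; e; f; z0; z1; z2; z3; z4].
have As : {subset V <= s}.
  move=> w _; rewrite /s -[_ :: _]/([:: u; v] ++ ([:: a; b] ++ ([:: c; d] ++ ([:: e; f] ++ [:: z0; z1; z2; z3; z4])))).
  rewrite !mem_cat -Zs1 ZE.
  have -> : w \in [:: a; b] = (w \in N) by rewrite eN !inE.
  have -> : w \in [:: c; d] = (w \in Nu) by rewrite eU !inE.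
  have -> : w \in [:: e; f] = (w \in Nv) by rewrite eV !inE.
  rewrite !inE /=.
  by case: (w == u); case: (w == v); case: (adj u w); case: (adj v w).
have us : uniq s by apply: card_seq_uniq As _; rewrite cardsT G13.
have inU w : w \in Nu -> adj u w /\ adj v w = false.
  by rewrite !inE /= => /andP[/negbTE ? ?].
have inV w : w \in Nv -> adj v w /\ adj u w = false.
  by rewrite !inE /= => /andP[/negbTE ? ?].
have [uc vc] : adj u c /\ adj v c = false by apply: inU; rewrite eU !inE eqxx.
have [ud vd] : adj u d /\ adj v d = false by apply: inU; rewrite eU !inE eqxx orbT.
have [ve ue] : adj v e /\ adj u e = false by apply: inV; rewrite eV !inE eqxx.
have [vf uf] : adj v f /\ adj u f = false by apply: inV; rewrite eV !inE eqxx orbT.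
have inz w : w \in Z -> adj u w = false /\ adj v w = false.
  by rewrite ZE => /and4P[_ _ /negbTE ? /negbTE ?].
have [uz0 vz0] : adj u z0 = false /\ adj v z0 = false by apply: inz; rewrite Zs1 !inE eqxx.
have [uz1 vz1] : adj u z1 = false /\ adj v z1 = false.
  by apply: inz; rewrite Zs1 !inE eqxx ?orbT.
have [uz2 vz2] : adj u z2 = false /\ adj v z2 = false.
  by apply: inz; rewrite Zs1 !inE eqxx ?orbT.
have [uz3 vz3] : adj u z3 = false /\ adj v z3 = false.
  by apply: inz; rewrite Zs1 !inE eqxx ?orbT.
have [uz4 vz4] : adj u z4 = false /\ adj v z4 = false.
  by apply: inz; rewrite Zs1 !inE eqxx ?orbT.
have nuv' : adj u v = false by move: nuv; rewrite /cadj negb_or => /andP[_ /negbTE].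
have az1 : adj a z1 = false by apply: no_triangle az0 _; apply: (adj1 0 1).
have az3 : adj a z3 = false by apply: no_triangle az2 _; apply: (adj1 2 3).
have az4 : adj a z4 = false by apply: no_triangle az0 _; apply: (adj1 0 4).
have hall : all (fun t => adj (nth u s t.1.1) (nth u s t.1.2) == t.2) start_r13.
  rewrite /start_r13 /= nuv' ua ub uc ud ue uf uz0 uz1 uz2 uz3 uz4.
  rewrite va vb vc vd ve vf vz0 vz1 vz2 vz3 vz4 az0 az1 az2 az3 az4.
  have /= -> := adj1 1 0 isT isT; have /= -> := adj1 2 0 isT isT.
  have /= -> := adj1 2 1 isT isT; have /= -> := adj1 3 0 isT isT.
  have /= -> := adj1 3 1 isT isT; have /= -> := adj1 3 2 isT isT.
  have /= -> := adj1 4 0 isT isT; have /= -> := adj1 4 1 isT isT.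
  by have /= -> := adj1 4 2 isT isT; have /= -> := adj1 4 3 isT isT.
apply: (@run_sound (lab u s) (lab_sym u s) leaf_r13 _ _ start_r13 tree_r13 _ check_r13).
  by move=> p' i j b'; apply: leaf_r13_sound.
apply/allP => t ht; have /allP/(_ t ht) := hall.
have : all (fun t => [&& t.1.1 < 13, t.1.2 < 13 & t.1.1 != t.1.2]) start_r13 by [].
move/allP/(_ t ht)/and3P=> [h1 h2 h3].
by rewrite /holds lab_adj.
Qed.

End Uniqueness.

End Gap3.

(** * The gap *)

Section Gap.
Variable G : sgraph.
Implicit Types (A B K S : {set G}) (x y : G).

Lemma alphaE : alpha G = sal [set: G].
Proof. by apply: eq_bigl => S; rewrite subsetT andbT. Qed.

Lemma triangle_freeE : triangle_free G <-> tfree [set: G].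
Proof.
split=> [h x y z _ _ _ xy yz|h x y z [xy yz xz]].
  by apply/negP => xz; apply: (h x y z).
by have := h x y z (in_setT _) (in_setT _) (in_setT _) xy yz; rewrite xz.
Qed.

(** Intersecting each clique with what is still uncovered, and dropping empty pieces, turns a cover
    into a partition. *)
Lemma cov_partition j A : cov j A -> exists P : {set {set G}},
  [/\ partition P A, [forall K in P, clique K] & #|P| <= j].
Proof.
elim: j A => [|j IH] A /=.
  move=> ->; exists set0; rewrite partition_set0 eqxx cards0; split=> //.
  by apply/forall_inP => K; rewrite inE.
case=> K hK /IH[P [pP /forall_inP hP cP]].
have eA := setID A K; have [A0|A0] := eqVneq (A :&: K) set0.
  exists P; rewrite -{1}eA A0 set0U; split=> //; first exact/forall_inP.
  exact: leqW.
exists ((A :&: K) |: P); split.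
- rewrite -{2}eA; apply: partitionU1 => //.
  exact: (disjoint_of_D (subsetIr _ _) (subxx _)).
- apply/forall_inP => L; rewrite !inE => /orP[/eqP->|/hP//].
  exact: clique_sub (subsetIr _ _) hK.
- by rewrite cardsU1; case: (_ \notin _); rewrite // (leq_trans cP).
Qed.

Lemma cover_cov (P : {set {set G}}) A : [forall K in P, clique K] ->
  A \subset cover P -> cov #|P| A.
Proof.
elim: {P}_.+1 {-2}P A (ltnSn #|P|) => // n IH P A Pn /forall_inP hP sA.
have [P0|[K KP]] := set_0Vmem P.
  by rewrite P0 cards0 /=; apply/eqP; rewrite -subset0 (subset_trans sA) // P0 /cover big_set0.
rewrite (cardsD1 K) KP; apply: (covI (hP K KP)); apply: IH.
- by move: Pn; rewrite (cardsD1 K) KP.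
- by apply/forall_inP => L; rewrite !inE => /andP[_ /hP].
apply/subsetP => x; rewrite !inE => /andP[xK /(subsetP sA)/bigcupP[L LP xL]].
by apply/bigcupP; exists L => //; rewrite !inE LP andbT; apply: contraNneq xK => <-.
Qed.

Lemma theta_leP j : theta G <= j <-> cov j [set: G].
Proof.
have [[P /andP[pP hP] eP] hmin] := thetaP G; split=> [le|/cov_partition[Q [pQ hQ cQ]]].
  by apply: (cov_leq le); rewrite -eP; apply: cover_cov; rewrite // (cover_partition pP).
by apply: leq_trans (hmin Q _) cQ; rewrite /clique_partition pQ.
Qed.

Lemma gap_leP t : gap G <= t <-> cov (alpha G + t) [set: G].
Proof. by rewrite /gap leq_subLR; apply: theta_leP. Qed.

Lemma gap_le2 : #|G| <= 12 -> gap G <= 2.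
Proof. by move=> G12; apply/gap_leP; rewrite alphaE; apply: cover_12; rewrite cardsT. Qed.

Lemma tfree_cov_card j : triangle_free G -> cov j [set: G] -> #|G| <= 2 * j.
Proof.
by move=> /triangle_freeE tG /(cov_matching tG)[m _]; rewrite cardsT; lia.
Qed.

Lemma alpha_ge4 : triangle_free G -> 9 <= #|G| -> 4 <= alpha G.
Proof. by move=> /triangle_freeE tG G9; rewrite alphaE ramsey34 // cardsT. Qed.

(** The stability number is 4 by R(3,4). A gap of at most 2 would mean six cliques of at most two
    vertices covering 13 vertices; for the upper bound, one vertex is split off and [cover_12]
    covers the others. *)
Lemma gap3_of_13 : triangle_free G -> #|G| = 13 -> alpha G <= 4 -> gap G = 3.
Proof.
move=> tG G13 a4.
have a : alpha G = 4 by apply/eqP; rewrite eqn_leq a4 alpha_ge4 // G13.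
apply/eqP; rewrite eqn_leq; apply/andP; split.
  apply/gap_leP; have /card_gt0P[x _] : 0 < #|G| by rewrite G13.
  rewrite addnS; apply: (covI (clique1 x)); apply: cov_leq (@cover_12 _ (setT :\ x) _).
    by rewrite alphaE leq_add2r; apply/sal_sub/subsetDl.
  by have := cardsD1 x [set: G]; rewrite in_setT cardsT G13; clear; lia.
rewrite ltnNge; apply/negP => /gap_leP /(tfree_cov_card tG).
by rewrite a G13.
Qed.

Lemma gap3_13_unique : #|G| = 13 -> gap G = 3 -> isomorphic G R13.
Proof.
move=> G13 g3; have nc : ~ cov (sal [set: G] + 2) [set: G].
  by rewrite -alphaE => /gap_leP; rewrite g3.
have V13 : #|[set: G]| = 13 by rewrite cardsT.
have [tG|[T [sT hT T3]]] := tfree_or_triangle [set: G].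
  by apply: R13_unique => //; apply: sal_13_tfree.
by case: nc; apply: cover_13_triangle sT hT T3.
Qed.

Lemma tfree_card_sal A k : tfree A -> sal A <= k ->
  [/\ k <= 1 -> #|A| <= 2, k <= 2 -> #|A| <= 5 & k <= 3 -> #|A| <= 8].
Proof.
move=> tA hA; split=> hk.
- exact: tfree_clique tA (subxx A) (sal1 (leq_trans hA hk)).
- by rewrite leqNgt; apply/negP => /(ramsey33 tA); rewrite ltnNge (leq_trans hA hk).
- by rewrite leqNgt; apply/negP => /(ramsey34 tA); rewrite ltnNge (leq_trans hA hk).
Qed.

(** In a disconnected graph the stability numbers of a component and of the rest add up to at most
    4. The Ramsey bounds then allow at most 2 + 8 or 5 + 5 vertices, hence at most 10. *)
Lemma connected_of_alpha : triangle_free G -> 11 <= #|G| -> alpha G <= 4 -> connected G.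
Proof.
move=> /triangle_freeE tG G11; rewrite alphaE => a4 x y; apply: contraLR G11 => nxy.
set B := [set z | connect (@adj G) x z].
have hB u v : u \in B -> v \in [set: G] :\: B -> ~~ adj u v.
  rewrite !inE andbT => xu; apply: contra => uv; exact: connect_trans xu (connect1 uv).
have hs := leq_trans (sal_split (subsetT B) hB) a4.
have pos A z : z \in A -> 0 < sal A.
  by move=> zA; have := @sal_ge _ [set z] A (stable1 z); rewrite sub1set zA cards1; apply.
have p1 : 0 < sal B by apply: (pos _ x); rewrite inE connect0.
have p2 : 0 < sal (setT :\: B) by apply: (pos _ y); rewrite !inE nxy.
have [b1 b2 b3] := tfree_card_sal (tfree_sub (subsetT B) tG) (leqnn _).
have [d1 d2 d3] := tfree_card_sal (tfree_sub (subsetT (setT :\: B)) tG) (leqnn _).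
have := cardsID B [set: G]; rewrite setTI cardsT => <-.
move: hs p1 p2 b1 b2 b3 d1 d2 d3; move: #|B| #|_ :\: B| (sal B) (sal _) => p q r s.
by clear; lia.
Qed.

End Gap.

(** * The graph [R13], by exhaustive search *)

Lemma clqs_complete (r : rel nat) m l acc vs : subseq l vs -> size l = m ->
  pairwise (fun i j => r j i) l -> {in l & acc, forall i j, r i j} ->
  clqs r m acc vs != [::].
Proof.
elim: vs m l acc => [|v vs IH] [|m] l acc; rewrite ?subseq0 //.
  by move=> /eqP->.
case: l => [//|w l] /= sl [sz] /andP[rw pl] racc.
rewrite -size_eq0 size_cat addn_eq0 negb_and !size_eq0.
case: eqP sl => [ew|_] sl; last first.
  by rewrite (IH m.+1 (w :: l)) ?orbT //= ?sz ?rw.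
rewrite -ew (_ : all (r w) acc); last first.
  by apply/allP => j ja; apply: racc; rewrite ?mem_head.
rewrite (IH m l) // => i j il; rewrite inE => /orP[/eqP->|ja].
  by move/allP: rw; apply.
by apply: racc; rewrite // inE il orbT.
Qed.

Lemma R13_triangle_free : triangle_free R13.
Proof.
move=> x y z [xy yz xz].
have : all (fun i => all (fun j => all (fun k =>
  ~~ [&& r13 i j, r13 j k & r13 i k]) (iota 0 13)) (iota 0 13)) (iota 0 13).
  by vm_compute.
have i13 (i : 'I_13) : (i : nat) \in iota 0 13 by rewrite mem_iota ltn_ord.
move=> /allP/(_ _ (i13 x))/allP/(_ _ (i13 y))/allP/(_ _ (i13 z)).
by rewrite !r13E /= in xy yz xz *; rewrite xy yz xz.
Qed.

(** By [clqs_complete] the search misses no stable set of size 5 listed in increasing order, and it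
    finds none. *)
Lemma R13_alpha : alpha R13 <= 4.
Proof.
have nil : clqs (fun i j => ~~ r13 i j) 5 [::] (iota 0 13) = [::] by vm_compute.
apply/bigmax_leqP => S hS; rewrite leqNgt; apply/negP => S5.
suff : clqs (fun i j => ~~ r13 i j) 5 [::] (iota 0 13) != [::] by rewrite nil.
apply: (@clqs_complete _ _ (map val (take 5 (enum S)))).
- rewrite -val_enum_ord; apply/map_subseq.
  apply: subseq_trans (take_subseq _ _) _.
  by rewrite [X in subseq _ X]enumT; apply: filter_subseq.
- by rewrite size_map size_takel // -cardE.
- rewrite pairwise_map; apply: (@sub_in_pairwise _ (mem S) (fun _ _ => true)).
  + by move=> i j iS jS _; rewrite /= r13E; move/stableP: hS => /(_ j i jS iS).
  + by apply/allP => i /mem_take; rewrite mem_enum.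
  + by elim: (take 5 (enum S)) => //= i l ->; rewrite andbT; apply/allP.
- by [].
Qed.

Lemma isomorphic_R13 (G : sgraph) : isomorphic G R13 ->
  [/\ triangle_free G, #|G| = 13 & alpha G <= 4].
Proof.
case=> f bf hf; have fi := bij_inj bf; split.
- move=> x y z [xy yz xz]; apply: (@R13_triangle_free (f x) (f y) (f z)).
  by rewrite !hf.
- by rewrite (bij_eq_card bf) card_ord.
- apply/bigmax_leqP => S /stableP hS; rewrite -(card_imset _ fi).
  apply: leq_trans R13_alpha; apply: (leq_bigmax_cond (P := @stable R13)).
  by apply/stableP => _ _ /imsetP[x xS ->] /imsetP[y yS ->]; rewrite hf; apply: hS.
Qed.

Theorem theorem5p4 :
  [/\ gap_extremal R13,
      is_s 3 13 /\ is_s2 3 13,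
      (forall G : sgraph, extremal 3 G <-> isomorphic G R13)
    & (forall G : sgraph, triangle_free G -> #|G| = 11 \/ #|G| = 12 ->
         alpha G <= 4 -> stable_gap_optimal G /\ connected G)].
Proof.
have cR : #|R13| = 13 by rewrite card_ord.
have gR : gap R13 = 3 := gap3_of_13 R13_triangle_free cR R13_alpha.
have min (G : sgraph) : gap G = 3 -> 13 <= #|G|.
  by move=> g3; rewrite ltnNge; apply/negP => /gap_le2; rewrite g3.
have s3 : is_s 3 13.
  by split=> [|k [G [<- /min]]] //; exists R13; split.
split.
- by exists 3; split; rewrite ?cR.
- by split=> //; split=> [|k [G [_ <- /min]]] //; exists R13; split=> //; apply: R13_triangle_free.
- move=> G; split=> [[g3 [_ sG]]|/isomorphic_R13[tG cG aG]]; last first.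
    by split; [exact: gap3_of_13 | rewrite cG].
  apply: gap3_13_unique => //; apply/eqP; rewrite eqn_leq min // andbT.
  by apply: sG; exists R13; split.
move=> G tG cG a4; have [c11 c12] : 11 <= #|G| /\ #|G| <= 12 by lia.
split; last exact: connected_of_alpha.
(* With gap at most 1, at most 4 + 1 cliques of at most two vertices would cover 11 vertices. *)
have g2 : 2 <= gap G.
  rewrite ltnNge; apply/negP => /gap_leP /(tfree_cov_card tG); lia.
split=> //; split.
- by exists G.
- by move=> k [H [tH cH <-]]; apply: leq_trans g2; apply: gap_le2; rewrite cH.
- by exists G.
- move=> k [H [tH cH <-]]; apply: leq_trans a4 _; apply: alpha_ge4 => //; lia.
Qed.
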